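(* Let $n\ge3$ and let $\mathcal{J}_n$ (respectively $\mathcal{J}_n^{\circ}$, $\mathcal{J}_n^{\wedge}$) be the ideal in $\mathbb{C}[c_1,\dots,c_n]$ of the set-theoretic intersection of the variety $Z_n$ (respectively $Z_n^{\circ}$, $Z_n^{\wedge}$) of cycle-sums of general (respectively symmetric, skew-symmetric) $n\times n$ matrices with the linear space of symmetrized cycle-sums. (1) $\mathcal{J}_3^{\circ}$ is the principal ideal $\langle -4c_2^3+c_3^2\rangle$. For $n\ge4$, $\mathcal{J}_n^{\circ}$ is the prime ideal generated by the $n-2$ binomials $$\{4c_2^3-c_3^2\}\cup\{(s-1)!\,c_2c_{s-2}-(s-3)!\,c_s\;:\;4\le s\le n\}.$$ (2) $\mathcal{J}_3^{\wedge}=\langle c_1,c_3\rangle$. $\mathcal{J}_4^{\wedge}$ decomposes as the intersection of two prime components $$\mathcal{J}_4^{\wedge}=\langle-2c_2^2+c_4,\;c_1,\;c_3\rangle\cap\langle6c_2^2+c_4,\;c_1,\;c_3\rangle.$$ For $n\ge5$, $\mathcal{J}_n^{\wedge}$ is the prime ideal generated by $$\{c_{2k-1}:1\le k\le\lceil n/2\rceil\}\cup\{E_{2(i+j)-1}\,c_{2i}c_{2j}-E_{2i-1}E_{2j-1}\,c_{2(i+j)}:1\le i\le j,\ 2(i+j)\le n\},$$ where $E_m$ denotes the $m$-th Euler number. (3) $\mathcal{J}_3$ is the zero ideal. $\mathcal{J}_4$ decomposes as the intersection of the two prime ideals $$\langle2c_2^3+c_3^2-c_2c_4\rangle\quad\text{and}\quad\langle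 c_3,\;6c_2^2+c_4\rangle.$$ For $n\ge5$, $\mathcal{J}_n$ is the prime ideal generated by the maximal ($3\times3$) minors of $$\begin{pmatrix}d_0&d_1&d_2&\cdots&d_{n-2}\\d_1&d_2&d_3&\cdots&d_{n-1}\\d_2&d_3&d_4&\cdots&d_n\end{pmatrix},$$ where $d_0=1$ and $d_1,\dots,d_n$ are the symmetrized principal minor coordinates, viewed as polynomials in $c_1,\dots,c_n$.
   Context: For $A=(a_{i,j})\in\mathbb{C}^{n\times n}$ and $I\subseteq[n]=\{1,\dots,n\}$, the cycle-sum is $$C_I(A)=\sum_{\{i_1,\dots,i_k\}=I,\ i_1=\min I}a_{i_1,i_2}a_{i_2,i_3}\cdots a_{i_{k-1},i_k}a_{i_k,i_1},$$ the sum being over all orderings $(i_2,\dots,i_k)$ of $I\setminus\{\min I\}$, with $C_\emptyset(A)=1$. $Z_n$ (respectively $Z_n^{\circ}$, $Z_n^{\wedge}$) is the image of all (respectively all symmetric, all skew-symmetric) matrices in $\mathbb{C}^{n\times n}$ under $A\mapsto(C_I(A))_{I\subseteq[n]}\in\mathbb{C}^{2^n}$. The linear space of symmetrized cycle-sums consists of the vectors $(C_I)_I$ with $C_I=C_J$ whenever $|I|=|J|$; its coordinates are $c_k:=C_I$ for $|I|=k$. Since $c_0=1$ on all the sets considered, the intersections are regarded as subsets of $\mathbb{C}^n$ with coordinates $c_1,\dots,c_n$; e.g. $\mathcal{J}_n$ is the ideal of all polynomials in $\mathbb{C}[c_1,\dots,c_n]$ vanishing at every $(c_1,\dots,c_n)$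 for which some $A\in\mathbb{C}^{n\times n}$ has $C_I(A)=c_{|I|}$ for all nonempty $I\subseteq[n]$. The symmetrized principal minor coordinates are the polynomials $$d_s=\sum_{\{S_1,\dots,S_k\}}(-1)^{s-k}\,c_{|S_1|}\cdots c_{|S_k|}\qquad(1\le s\le n),$$ the sum being over all set-partitions of $[s]$ into nonempty blocks; when $A$ has symmetrized cycle-sums, $d_s$ is the common value of its $s\times s$ principal minors. The Euler number $E_m$ is the number of alternating permutations of $[m]$ (i.e. $\sum_{m\ge0}E_mx^m/m!=\tan x+\sec x$). *)

(* Defs.v *)
From mathcomp Require Import all_boot all_algebra all_fingroup.
From mathcomp Require Import boolp classical_sets reals.
From mathcomp Require Import complex.
From mathcomp Require Import mpoly.

Set Implicit Arguments.
Unset Strict Implicit.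
Unset Printing Implicit Defensive.

Import GRing.Theory.

Local Open Scope classical_set_scope.
Local Open Scope ring_scope.

Section CycleSums.
Variables (K : comNzRingType) (n : nat).
Implicit Types (A : 'M[K]_n) (I : {set 'I_n}) (v : {set 'I_n} -> K).

Definition cycle_product A (c : seq 'I_n) : K := \prod_(i <- c) A i (next c i).

(* [enum I] lists I in increasing order, so its head is min I;
   [permutations s] is duplicate-free. *)
Definition cycle_sum A I : K :=
  if enum I is i1 :: s
  then \sum_(p <- permutations s) cycle_product A (i1 :: p)
  else 1.

Definition cycle_sums A : {set 'I_n} -> K := fun I => cycle_sum A I.

Definition Z : set ({set 'I_n} -> K) := range cycle_sums.
Definition Zsym : set ({set 'I_n} -> K) := cycle_sums @` [set A | A^T = A].
Definition Zskew : set ({set 'I_n} -> K) := cycle_sums @` [set A | A^T = - A].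

Definition symmetrized : set ({set 'I_n} -> K) :=
  [set v | forall I I', #|I| = #|I'| -> v I = v I'].

(* The point (c_1, ..., c_n) of K^n is the function sending k : 'I_n to
   c_(k+1). *)
Definition symmetrized_points (V : set ({set 'I_n} -> K)) : set ('I_n -> K) :=
  [set c | exists2 v, (V `&` symmetrized) v &
           forall (k : 'I_n) I, #|I| = k.+1 -> v I = c k].

Definition vanishing_ideal (X : set ('I_n -> K)) : set {mpoly K[n]} :=
  [set p | forall c, X c -> p.@[c] = 0].

Definition J := vanishing_ideal (symmetrized_points Z).
Definition Jsym := vanishing_ideal (symmetrized_points Zsym).
Definition Jskew := vanishing_ideal (symmetrized_points Zskew).

(* The coordinate c_k, that is 'X_(k-1), for 1 <= k <= n; c_0 = 1.
   The value 0 for k > n is never used. *)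
Definition cvar (k : nat) : {mpoly K[n]} :=
  if k is k'.+1 then oapp (fun i : 'I_n => 'X_i) 0 (insub k') else 1.

(* For s = 0 the only partition is the empty one, so that d_0 = 1. *)
Definition dvar (s : nat) : {mpoly K[n]} :=
  \sum_(P : {set {set 'I_s}} | finset.partition P (finset.setTfor 'I_s))
     (-1) ^+ (s - #|P|) * \prod_(B in P) cvar #|B|.

Definition hankel_mx : 'M[{mpoly K[n]}]_(3, n.-1) :=
  \matrix_(i < 3, j < n.-1) dvar (i + j).

End CycleSums.

Arguments J K n : clear implicits.
Arguments Jsym K n : clear implicits.
Arguments Jskew K n : clear implicits.
Arguments cvar K n k : clear implicits.
Arguments dvar K n s : clear implicits.
Arguments hankel_mx K n : clear implicits.

Notation "''c_' k" := (cvar _ _ k) (at level 8, k at level 2, format "''c_' k").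

Section Ideals.
Variable R : comNzRingType.
Implicit Types I G : set R.

Definition ideal_gen G : set R :=
  [set p | exists2 s : seq (R * R),
           (forall x, x \in s -> G x.2) & p = \sum_(x <- s) x.1 * x.2].

(* [idealr_closed] includes properness. *)
Definition prime_ideal I : Prop :=
  idealr_closed (mem I) /\ prime_idealr_closed (mem I).

Definition decomposes_into_primes I I1 I2 : Prop :=
  [/\ I = I1 `&` I2, prime_ideal I1, prime_ideal I2, ~ I1 `<=` I2 &
      ~ I2 `<=` I1].

Definition maximal_minors m k (M : 'M[R]_(m, k)) : set R :=
  [set p | exists2 f : 'I_m -> 'I_k,
           {homo f : i j / (i < j)%N} & p = \det (colsub f M)].

End Ideals.

(* Alternating means s 0 < s 1 > s 2 < s 3 > ..., so that E_3 = 2. *)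
Definition alternating m (s : 'S_m) : bool :=
  [forall i : 'I_m, forall j : 'I_m,
     (j == i.+1 :> nat) ==> (if odd i then s j < s i else s i < s j)%N].

Definition euler_number (m : nat) : nat := #|[pred s : 'S_m | alternating s]|.

(* Main.v *)
(* Let [A] have symmetrized cycle-sums. If [c_2 != 0], conjugating [A] by a
   diagonal matrix makes its first row constant; the other off-diagonal entries
   then take two values [a] and [b], i.e. they form a weighted tournament, and
   comparing 4-cycles shows that its triples are all transitive or all cyclic.
   In the first case [A] is, up to a permutation, constant above and constant
   below the diagonal; the second one requires [n = 4] and gives the additional
   component. If [c_2 = 0], then [c_3 = ... = c_(n-1) = 0].

   Splitting a permutation at its maximum yields a Riccati equation for the
   generating function of the cycle-sums of a two-valued matrix. For [a = b]
   they are given by factorials, for [b = - a] by Euler numbers, and in general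
   the principal minors satisfy a linear recurrence of order two, so that the
   Hankel matrix has rank at most two. Hence the ideals are, up to the component
   above, kernels of morphisms to polynomial rings.

   That the kernel for general matrices is generated by the maximal minors is
   reduced to [c_1 = 0]. With [x_k = d_(k+2)], the minors containing the first
   column then rewrite [x_i x_j] to [x_(i+1) x_(j-1)] modulo cubic terms of the
   same weight, which leaves one normal monomial for each degree and index sum.
   The images of these monomials at the generic two-valued matrix have distinct
   leading terms at [b = 0]. *)

From HB Require Import structures.
Require Import Defs.
From mathcomp Require Import boolp classical_sets reals.
From mathcomp Require Import complex.
From mathcomp Require Import mpoly.
From mathcomp Require Import all_boot all_order all_algebra all_fingroup.
From mathcomp Require Import zify ring.

Set Implicit Arguments.
Unset Strict Implicit.
Unset Printing Implicit Defensive.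

Import Order.TTheory GRing.Theory Num.Theory.

Local Open Scope ring_scope.

(** * Binomial convolution and sums over permutations *)

(** Each equality of ideals closes a circle of three inclusions. The stated generators vanish at
    every realized point, by the classification. A polynomial vanishing at all these points is
    killed by the morphism, because integer parameters already provide infinitely many points. The
    kernel lies in the generated ideal, by pure algebra. Primality then comes for free, the target
    being a domain. The values [a] and [b] are entries of the normalized matrix itself, so no root
    is ever extracted and the argument works over any [numFieldType]. The case [c_2 = 0] of general
    matrices cannot be absorbed in the two-valued family: there [c_n] may be nonzero, as for the
    matrix of an n-cycle, and such points are checked against the generators directly. Generating
    functions are never formed: their coefficient sequences are multiplied by binomial convolution,
    which turns differential equations into recurrences. *)

Section BinomialConvolution.
Variable K : comNzRingType.
Implicit Types u v w : nat -> K.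

(** The coefficients of a product of exponential generating functions; on these, [shift] is the
    derivative. *)
Definition bconv u v m : K := \sum_(j < m.+1) ('C(m, j))%:R * u j * v (m - j)%N.

Definition shift u : nat -> K := fun k => u k.+1.

Lemma eq_bconv u u' v v' m : (forall j, (j <= m)%N -> u j = u' j) ->
  (forall j, (j <= m)%N -> v j = v' j) -> bconv u v m = bconv u' v' m.
Proof.
move=> eu ev; apply: eq_bigr => j _; rewrite eu ?ev ?leq_subr //.
by rewrite -ltnS ltn_ord.
Qed.

Lemma bconvC u v m : bconv u v m = bconv v u m.
Proof.
rewrite /bconv (reindex_inj rev_ord_inj); apply: eq_bigr => j _ /=.
have le_jm : (j <= m)%N by rewrite -ltnS ltn_ord.
by rewrite subSS bin_sub // subKn //; ring.
Qed.

Lemma bconvDl u v w m :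
  bconv (fun j => u j + v j) w m = bconv u w m + bconv v w m.
Proof. by rewrite -big_split; apply: eq_bigr => j _ /=; ring. Qed.

Lemma bconvDr u v w m :
  bconv w (fun j => u j + v j) m = bconv w u m + bconv w v m.
Proof. by rewrite -big_split; apply: eq_bigr => j _ /=; ring. Qed.

Lemma bconvZl a u w m : bconv (fun j => a * u j) w m = a * bconv u w m.
Proof. by rewrite big_distrr; apply: eq_bigr => j _ /=; ring. Qed.

Lemma bconv0 u v : bconv u v 0 = u 0 * v 0.
Proof. by rewrite /bconv big_ord_recl big_ord0 bin0 subnn /=; ring. Qed.

(** The Leibniz rule; it comes from Pascal's rule. *)
Lemma bconvS u v m :
  bconv u v m.+1 = bconv (shift u) v m + bconv u (shift v) m.
Proof.
rewrite /bconv big_ord_recl big_ord_recr /= bin0 binn subn0 subnn.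
rewrite [in RHS]big_ord_recr [X in _ = _ + X]big_ord_recl /= bin0 binn subn0
  subnn.
rewrite (eq_bigr (fun i : 'I_m => ('C(m, i))%:R * shift u i * v (m - i)%N +
           ('C(m, i.+1))%:R * u i.+1 * shift v (m - i.+1)%N)); last first.
  move=> i _; rewrite /bump /= add1n binS natrD /shift subSS.
  by rewrite -[(m - i.+1).+1]subSn ?ltn_ord // subSS; ring.
by rewrite big_split /= /shift; ring.
Qed.

(** Differentiating both sides and using the Leibniz rule gives an induction on [m] without
    multinomial coefficients. *)
Lemma bconvA u v w m : bconv u (bconv v w) m = bconv (bconv u v) w m.
Proof.
elim: m u v w => [|m IHm] u v w.
  by rewrite !bconv0 mulrA.
rewrite !bconvS.
have E1 : forall x y j, shift (bconv x y) j = bconv (shift x) y j + bconv x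
  (shift y) j.
  by move=> x y j; rewrite /shift bconvS.
rewrite (eq_bconv (u' := u) (v := shift (bconv v w))
   (v' := fun j => bconv (shift v) w j + bconv v (shift w) j)) //.
rewrite (eq_bconv (u := shift (bconv u v)) (v := w) (v' := w)
   (u' := fun j => bconv (shift u) v j + bconv u (shift v) j)) //.
by rewrite bconvDr bconvDl !IHm; ring.
Qed.

Definition delta0 : nat -> K := fun j => (j == 0)%:R.

Lemma bconv1 u m : bconv delta0 u m = u m.
Proof.
rewrite /bconv big_ord_recl big1 /delta0 /= ?bin0 ?subn0; first by ring.
by move=> i _; rewrite /bump /= mulr0 mul0r.
Qed.

Lemma bconv_exp a b m : bconv (fun j => a ^+ j) (fun j => b ^+ j) m = (a + b)
  ^+ m.
Proof.
rewrite addrC exprDn; apply: eq_bigr => j _.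
by rewrite -mulr_natl; ring.
Qed.

End BinomialConvolution.

Section PermutationSums.
Variable K : comNzRingType.

Definition psum (T : eqType) (G : seq T -> K) (s : seq T) : K :=
  \sum_(p <- permutations s) G p.

Lemma perm_psum (T : eqType) (G : seq T -> K) s t :
  perm_eq s t -> psum G s = psum G t.
Proof. by move=> st; apply/perm_big/perm_permutations. Qed.

Lemma eq_psum (T : eqType) (G H : seq T -> K) s :
  {in [pred p | perm_eq p s], G =1 H} -> psum G s = psum H s.
Proof.
move=> GH; rewrite /psum big_seq [RHS]big_seq; apply: eq_bigr => p.
by rewrite mem_permutations => /GH.
Qed.

Lemma psum_map (T U : eqType) (h : T -> U) (G : seq U -> K) s :
  uniq s -> {in s &, injective h} ->
  psum G (map h s) = psum (fun p => G (map h p)) s.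
Proof.
move=> us hinj; rewrite /psum -(big_map (map h) xpredT G).
have uhs : uniq (map h s) by rewrite map_inj_in_uniq.
have hmap_inj p q : {subset p <= s} -> {subset q <= s} ->
    map h p = map h q -> p = q.
  elim: p q => [|x p IHp] [|y q] //= sp sq [] hxy /IHp ->; first 1 last.
  - by move=> z zp; apply: sp; rewrite inE zp orbT.
  - by move=> z zq; apply: sq; rewrite inE zq orbT.
  by congr (_ :: _); apply: hinj => //; [apply: sp | apply: sq];
    rewrite mem_head.
have uh : uniq (map (map h) (permutations s)).
  rewrite map_inj_in_uniq ?permutations_uniq // => p q.
  rewrite !mem_permutations => /perm_mem ps /perm_mem qs.
  by apply: hmap_inj => x; rewrite ?ps ?qs.
apply: perm_big; rewrite perm_sym; apply: uniq_perm => //.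
  exact: permutations_uniq.
apply: (uniq_min_size uh _ _).2.
  move=> p /mapP[q]; rewrite !mem_permutations => qs ->.
  exact: perm_map.
by rewrite size_map !size_permutations ?size_map.
Qed.

(** Such a [G] sees only the relative order of the entries, so its sum over the permutations of a
    finite set depends on the cardinality alone. *)
Definition order_invariant (G : seq nat -> K) :=
  forall (h : nat -> nat) p,
    {in p &, {mono h : x y / (x < y)%N}} -> G (map h p) = G p.

Lemma psum_sorted (G : seq nat -> K) s : order_invariant G ->
  sorted ltn s -> psum G s = psum G (iota 0 (size s)).
Proof.
move=> Ginv ss; pose h := nth 0%N s.
have hmono : {in iota 0 (size s) &, {mono h : x y / (x < y)%N}}.
  have E x : (x \in iota 0 (size s)) = (x \in [pred n | (n < size s)%N]).
    by rewrite mem_iota add0n.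
  move=> x y; rewrite !E => xs ys.
  move: x y xs ys; apply: leqW_mono_in; apply: leq_mono_in.
  exact: (sorted_ltn_nth ltn_trans 0%N ss).
rewrite -{1}[s](mkseq_nth 0%N) /mkseq psum_map ?iota_uniq //; last first.
  move=> x y xs ys /eqP; rewrite eqn_leq => /andP[le1 le2]; apply/eqP.
  rewrite eqn_leq; apply/andP; split; rewrite leqNgt -hmono //;
    by rewrite -leqNgt.
apply: eq_psum => p; rewrite inE => /perm_mem ps.
by apply: Ginv => x y xp yp; apply: hmono; rewrite -ps.
Qed.

Lemma psum_insert (T : eqType) (F : seq T -> K) x s : uniq (x :: s) ->
  psum F (x :: s) =
  \sum_(j < (size s).+1) psum (fun p => F (take j p ++ x :: drop j p)) s.
Proof.
move=> /= /andP[xs us].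
pose ins j p : seq T := take j p ++ x :: drop j p.
pose L := [seq ins j p | j <- iota 0 (size s).+1, p <- permutations s].
have xp p : p \in permutations s -> x \notin p.
  by rewrite mem_permutations => /perm_mem ->.
have sp p : p \in permutations s -> size p = size s.
  by rewrite mem_permutations => /perm_size.
have uL : uniq L.
  apply: allpairs_uniq; rewrite ?iota_uniq ?permutations_uniq //.
  move=> x1 x2 /allpairsP[[j p] [jn pp ->]] /allpairsP[[k q] [kn qq ->]].
  rewrite [(j, p).1]/= [(k, q).1]/= in jn kn *.
  rewrite [(j, p).2]/= [(k, q).2]/= in pp qq * => E.
  (* Insertion is injective: [index x] recovers the position and [rem x] the permutation. *)
  have I i r : i \in iota 0 (size s).+1 -> r \in permutations s ->
      index x (ins i r) = i.
    rewrite mem_iota add0n /= ltnS => iS rs.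
    rewrite index_cat ifN; last by apply: contra (xp _ rs); apply: mem_take.
    by rewrite /= eqxx addn0 size_take_min sp //; apply/minn_idPl.
  have R i r : i \in iota 0 (size s).+1 -> r \in permutations s ->
      rem x (ins i r) = r.
    move=> iS rs; rewrite remE I // /ins.
    have st : size (take i r) = i.
      move: iS; rewrite mem_iota add0n ltnS /= => iS.
      by rewrite size_take_min sp //; apply/minn_idPl.
    rewrite take_size_cat // -cat_rcons drop_size_cat ?cat_take_drop //.
    by rewrite size_rcons st.
  move: (I _ _ jn pp) (R _ _ jn pp) (I _ _ kn qq) (R _ _ kn qq).
  by rewrite /= in E *; rewrite E => -> -> -> ->.
transitivity (\sum_(p <- L) F p); last first.
  rewrite big_allpairs_dep -[X in iota 0 X]subn0 -/(index_iota 0 _) big_mkord.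
  by apply: eq_bigr.
apply: perm_big; rewrite perm_sym; apply: uniq_perm => //.
  exact: permutations_uniq.
apply: (uniq_min_size uL _ _).2.
  move=> _ /allpairsP[[j p] /= [_ + ->]]; rewrite !mem_permutations => ps.
  by rewrite perm_catC /= perm_cons perm_catC cat_take_drop.
by rewrite size_allpairs size_iota !size_permutations //= ?xs ?us // factS.
Qed.

(** Group the permutations by the set [B] of their first [j] entries: a class consists of the
    concatenations of a permutation of [B] with one of its complement. *)
Lemma psum_split (T : finType) (G H : seq T -> K) (j : nat) :
  (j <= #|T|)%N ->
  psum (fun p => G (take j p) * H (drop j p)) (enum T) =
  \sum_(B : {set T} | #|B| == j) psum G (enum B) * psum H (enum (~: B)).
Proof.
move=> jT; rewrite /psum big_seq.
rewrite (partition_big (fun p => [set x in take j p]) (fun B => #|B| == j));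
  last first.
  move=> p; rewrite mem_permutations => pT /=.
  have up : uniq (take j p) by rewrite take_uniq // (perm_uniq pT) enum_uniq.
  rewrite cardsE (card_uniqP up) size_take_min (perm_size pT) -cardE.
  by apply/eqP/minn_idPl.
apply: eq_bigr => B /eqP cB; rewrite -big_filter.
transitivity (\sum_(p <- [seq q ++ r | q <- permutations (enum B),
    r <- permutations (enum (~: B))]) (G (take j p) * H (drop j p))).
  apply: perm_big; apply: uniq_perm.
  - exact/filter_uniq/permutations_uniq.
  - apply: allpairs_uniq; rewrite ?permutations_uniq //.
    move=> [q r] [q' r'] /allpairsP[[q1 r1] /= [q1P _ [-> _]]].
    move=> /allpairsP[[q2 r2] /= [q2P _ [-> _]]] /=.
    move=> /eqP; rewrite eqseq_cat; last first.
      by move: q1P q2P; rewrite !mem_permutations => /perm_size-> /perm_size->.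
    by move=> /andP[/eqP-> /eqP->].
  move=> p; rewrite mem_filter andbC andbA andbb mem_permutations.
  apply/andP/allpairsP => [[pT /eqP BE]|[[q r] /= []]].
  - have uT := enum_uniq T; have up : uniq p by rewrite (perm_uniq pT).
    have up' := up; rewrite -(cat_take_drop j p) cat_uniq in up'.
    case/and3P: up' => ut /hasPn utd ud.
    exists (take j p, drop j p); rewrite cat_take_drop; split => //=;
      rewrite mem_permutations; apply: uniq_perm; rewrite ?enum_uniq // => x;
      rewrite mem_enum -BE ?inE //.
    have : x \in p by rewrite (perm_mem pT) mem_enum.
    rewrite -{1}(cat_take_drop j p) mem_cat.
    by case: (boolP (x \in drop j p)) => [/utd-> //|_]; rewrite orbF => ->.
  rewrite !mem_permutations => qB rB ->.
  have sq : size q = j by rewrite (perm_size qB) -cardE.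
  rewrite take_size_cat //; split; last first.
    by apply/eqP/setP => x; rewrite inE (perm_mem qB) mem_enum.
  rewrite (perm_trans (perm_cat qB rB)) //.
  apply: uniq_perm; rewrite ?enum_uniq //.
    rewrite cat_uniq !enum_uniq andbT /=; apply/hasPn => x.
    by rewrite !mem_enum inE.
  by move=> x; rewrite mem_cat !mem_enum !inE orbN.
rewrite big_allpairs_dep big_distrl /= big_seq [RHS]big_seq.
apply: eq_bigr => q; rewrite mem_permutations => qB; rewrite big_distrr /=.
apply: eq_bigr => r _.
by rewrite take_size_cat ?drop_size_cat // (perm_size qB) -cardE.
Qed.

Lemma sorted_enum_ord m (B : {set 'I_m}) : sorted ltn (map val (enum B)).
Proof.
rewrite sorted_map; apply: sorted_filter.
  by move=> x y z; apply: ltn_trans.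
by rewrite -enumT -sorted_map val_enum_ord iota_ltn_sorted.
Qed.

(** By order invariance all sets [B] of [psum_split] contribute the same product, and there are
    ['C(m, j)] of them. *)
Lemma psum_iota_split (G H : seq nat -> K) m j : (j <= m)%N ->
  order_invariant G -> order_invariant H ->
  psum (fun p => G (take j p) * H (drop j p)) (iota 0 m) =
  ('C(m, j))%:R * psum G (iota 0 j) * psum H (iota 0 (m - j)).
Proof.
move=> jm Ginv Hinv.
rewrite -val_enum_ord psum_map ?enum_uniq //; last by move=> x y _ _;
  exact: val_inj.
rewrite (eq_psum (H := fun p : seq 'I_m => G (map val (take j p)) * H (map val
  (drop j p)))); last first.
  by move=> p _; rewrite map_take map_drop.
rewrite (psum_split (fun p => G (map val p)) (fun p => H (map val p)))
  ?card_ord //.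
transitivity (\sum_(B : {set 'I_m} | #|B| == j) psum G (iota 0 j) * psum H
  (iota 0 (m - j))).
  apply: eq_bigr => B /eqP cB.
  rewrite -!(psum_map _ (enum_uniq _) (in2W val_inj)).
  rewrite (psum_sorted Ginv (sorted_enum_ord B)).
  rewrite (psum_sorted Hinv (sorted_enum_ord (~: B))) !size_map -!cardE cB.
  by rewrite cardsCs finset.setCK card_ord cB.
rewrite (eq_bigl (fun B => B \in [set B : {set 'I_m} | #|B| == j])); last first.
  by move=> B; rewrite inE.
by rewrite sumr_const -[LHS]mulr_natl mulrA card_draws card_ord.
Qed.

End PermutationSums.

(** * Eulerian and alternating sums *)

Fixpoint path_prod (K : comNzRingType) (T : Type) (w : T -> T -> K) x p : K :=
  if p is y :: q then w x y * path_prod w y q else 1.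

Section PathProducts.
Variable K : comNzRingType.

Lemma path_prod_cat (T : Type) (w : T -> T -> K) x p q :
  path_prod w x (p ++ q) = path_prod w x p * path_prod w (last x p) q.
Proof. by elim: p x => [|y p IHp] x /=; rewrite ?mul1r // IHp mulrA. Qed.

Lemma path_prod_map (T U : Type) (h : T -> U) (w : U -> U -> K) x p :
  path_prod w (h x) (map h p) = path_prod (fun x y => w (h x) (h y)) x p.
Proof. by elim: p x => [|y p IHp] x //=; rewrite IHp. Qed.

Lemma eq_in_path_prod (T : eqType) (w w' : T -> T -> K) x p :
  {in x :: p &, forall y z, y != z -> w y z = w' y z} -> uniq (x :: p) ->
  path_prod w x p = path_prod w' x p.
Proof.
elim: p x => [|y p IHp] x //= Hw /andP[xp up].
rewrite Hw ?inE ?eqxx ?orbT //; last first.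
  by move: xp; rewrite inE negb_or => /andP[].
by congr (_ * _); apply: IHp => // z t zp tp; apply: Hw;
  rewrite inE ?zp ?tp orbT.
Qed.

End PathProducts.

Section EulerianSums.
Variable K : comNzRingType.
Variables a b : K.

Definition step_weight (i j : nat) : K := if (i < j)%N then a else b.

Definition list_weight (p : seq nat) : K :=
  if p is x :: q then path_prod step_weight x q else 1.

(* The homogeneous Eulerian polynomial: the sum over the permutations of [m] of
   [a ^ ascents * b ^ descents]. *)
Definition eulerian m : K := psum list_weight (iota 0 m).

Lemma list_weight_invariant : order_invariant list_weight.
Proof.
move=> h [|x p] //=; elim: p x => [|y p IHp] x //= hm.
rewrite IHp; last by move=> z t zp tp; apply: hm; rewrite inE ?zp ?tp orbT.
by rewrite /step_weight hm ?inE ?eqxx ?orbT.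
Qed.

(** The maximum is entered by an ascent unless it comes first, and left by a descent unless it comes
    last. *)
Lemma list_weight_insert m p q : all (ltn^~ m) p -> all (ltn^~ m) q ->
  list_weight (p ++ m :: q) =
  (if nilp p then 1 else a) * (if nilp q then 1 else b)
    * (list_weight p * list_weight q).
Proof.
have E r : all (ltn^~ m) r ->
    path_prod step_weight m r = (if nilp r then 1 else b) * list_weight r.
  case: r => [|y r] /=; first by rewrite mulr1.
  by move=> /andP[ym _]; rewrite /step_weight ltnNge ltnW.
case: p => [|x p] pm qm.
  by rewrite [LHS]/= E // /= !mul1r.
rewrite [LHS]/= path_prod_cat /= E // /step_weight ifT;
  first by set d := (if _ then _ else _); ring.
by have := allP pm _ (mem_last x p).
Qed.

Lemma eulerian0 : eulerian 0 = 1.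
Proof. by rewrite /eulerian /psum big_seq1. Qed.

Lemma eulerian1 : eulerian 1 = 1.
Proof. by rewrite /eulerian /psum big_seq1. Qed.

Lemma perm_iotaS m : perm_eq (iota 0 m.+1) (m :: iota 0 m).
Proof. by rewrite -[m.+1]addn1 iotaD /= add0n perm_catC. Qed.

(* Split a permutation at its maximal entry. *)
Lemma eulerianS m : (0 < m)%N ->
  eulerian m.+1 = (a + b) * eulerian m +
    \sum_(1 <= j < m) ('C(m, j))%:R * (a * b * eulerian j * eulerian (m - j)).
Proof.
move=> m_gt0; rewrite {1}/eulerian (perm_psum _ (perm_iotaS m)) psum_insert;
  last first.
  by rewrite /= iota_uniq mem_iota ltnn andbF.
rewrite size_iota.
transitivity (\sum_(j < m.+1) (if j == 0 :> nat then 1 else a) *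
   (if j == m :> nat then 1 else b) *
     (('C(m, j))%:R * eulerian j * eulerian (m - j))).
  apply: eq_bigr => j _; have jm : (j <= m)%N by rewrite -ltnS.
  rewrite /eulerian -psum_iota_split //; try exact: list_weight_invariant.
  rewrite /psum big_distrr /= big_seq [RHS]big_seq; apply: eq_bigr => p.
  rewrite mem_permutations => pm.
  have sp : size p = m by rewrite (perm_size pm) size_iota.
  have am : all (ltn^~ m) p.
    by apply/allP => x; rewrite (perm_mem pm) mem_iota add0n.
  rewrite list_weight_insert; last 2 first.
  - by apply/allP => x /mem_take; apply: (allP am).
  - by apply/allP => x /mem_drop; apply: (allP am).
  rewrite /nilp size_drop sp size_takel ?sp //.
  by rewrite subn_eq0 [(m <= j)%N]leq_eqVlt ltnNge jm orbF [m == j]eq_sym.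
case: m m_gt0 => [//|m] _; rewrite big_ord_recl big_ord_recr.
rewrite bin0 binn subn0 subnn eulerian0 /= eqxx big_add1 big_mkord /=.
rewrite (eq_bigr (fun i : 'I_m => ('C(m.+1, i.+1))%:R *
   (a * b * eulerian i.+1 * eulerian (m.+1 - i.+1)))); first by ring.
by move=> i _; rewrite /bump /= add1n eqSS [i == m :> nat]ltn_eqF //; ring.
Qed.

End EulerianSums.

Section EulerianValues.
Variable K : comNzRingType.

Lemma eulerian_const (a : K) m : eulerian a a m.+1 = (m.+1)`!%:R * a ^+ m.
Proof.
rewrite /eulerian; set s := iota 0 m.+1.
have sm : size s = m.+1 by rewrite size_iota.
rewrite /psum big_seq (eq_bigr (fun=> a ^+ m)); last first.
  move=> p; rewrite mem_permutations => /perm_size; rewrite sm.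
  case: p => // x p [<-] /=; elim: p x => [|y p IHp] x //=.
  by rewrite IHp /step_weight if_same exprS.
rewrite -big_seq big_const_seq count_predT size_permutations ?iota_uniq // sm.
by rewrite -mulr_natl; elim: (_`!) => [|k IHk]; rewrite ?mul0r //= IHk -natr1;
  ring.
Qed.

End EulerianValues.

Section AlternatingSums.

Fixpoint alternates (up : bool) (p : seq nat) : bool :=
  if p is x :: q then
    (if q is y :: _ then (if up then x < y else y < x)%N else true)
    && alternates (~~ up) q
  else true.

Lemma alternates_invariant up h p : {in p &, {mono h : x y / (x < y)%N}} ->
  alternates up (map h p) = alternates up p.
Proof.
elim: p up => [|x p IHp] up //= hm; rewrite IHp; last first.
  by move=> z t zp tp; apply: hm; rewrite inE ?zp ?tp orbT.
by case: p hm {IHp} => [|y p] hm //=; rewrite !hm ?inE ?eqxx ?orbT.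
Qed.

(** The maximum has to be a peak, which fixes the parity of its position unless it stands alone. *)
Lemma alternates_insert up m p q : all (ltn^~ m) p -> all (ltn^~ m) q ->
  alternates up (p ++ m :: q) =
  [&& alternates up p, nilp p && nilp q || (up == odd (size p))
    & alternates (~~ up (+) odd (size p)) q].
Proof.
elim: p up => [|x p IHp] up.
  case: q => [|y q] _ /=; first by case: up.
  move=> /andP[ym _]; rewrite [(m < y)%N]ltnNge (ltnW ym) ym.
  by case: up.
move=> /= /andP[xm pm] qm; rewrite IHp //.
case: p {IHp} pm => [|y p] /=.
  move=> _; rewrite xm [(m < x)%N]ltnNge (ltnW xm) /= !addbF /=.
  by case: up; case: (q) => //=; case: nilp.
move=> _; rewrite !negbK !andbA; congr (_ && _ && _); first by case: up;
  case: odd.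
by congr alternates; case: up; case: odd.
Qed.

Lemma alternatesP up p : reflect
  (forall i, (i.+1 < size p)%N -> if up (+) odd i
     then (nth 0 p i < nth 0 p i.+1)%N else (nth 0 p i.+1 < nth 0 p i)%N)
  (alternates up p).
Proof.
elim: p up => [|x [|y p] IHp] up /=; try by constructor.
apply: (iffP andP) => [[xy /IHp H] [|i]|H].
- by rewrite addbF.
- by rewrite ltnS => /H /=; rewrite addNb addbN.
split; first by have := H 0%N; rewrite addbF; apply.
by apply/IHp => i ip; have := H i.+1; rewrite /= addNb addbN; apply.
Qed.

Variable K : comNzRingType.

Definition alt_sum m : K := psum (fun p => (alternates true p)%:R) (iota 0 m).

Lemma alt_sum1 : alt_sum 1 = 1.
Proof. by rewrite /alt_sum /psum big_seq1. Qed.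

(** The classical recurrence of the tangent numbers: the maximum of an alternating permutation of
    odd length sits at an odd position and separates two alternating permutations of odd length. *)
Lemma alt_sumS m : (0 < m)%N -> ~~ odd m ->
  alt_sum m.+1 = \sum_(1 <= j < m)
    ('C(m, j))%:R * ((odd j)%:R * alt_sum j * alt_sum (m - j)).
Proof.
move=> m_gt0 m_even; rewrite {1}/alt_sum (perm_psum _ (perm_iotaS m))
  psum_insert; last first.
  by rewrite /= iota_uniq mem_iota ltnn andbF.
have inv : order_invariant (fun p => (alternates true p)%:R : K).
  by move=> h p hm; rewrite alternates_invariant.
rewrite size_iota.
transitivity (\sum_(j < m.+1) ('C(m, j))%:R * ((odd j)%:R * alt_sum j * alt_sum
  (m - j))).
  apply: eq_bigr => j _; have jm : (j <= m)%N by rewrite -ltnS.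
  transitivity ((odd j)%:R * (('C(m, j))%:R * alt_sum j * alt_sum (m - j)));
    last by ring.
  rewrite /alt_sum -psum_iota_split //.
  rewrite /psum big_distrr /= big_seq [RHS]big_seq; apply: eq_bigr => p.
  rewrite mem_permutations => pm.
  have sp : size p = m by rewrite (perm_size pm) size_iota.
  have am : all (ltn^~ m) p.
    by apply/allP => x; rewrite (perm_mem pm) mem_iota add0n.
  rewrite alternates_insert; last 2 first.
  - by apply/allP => x /mem_take; apply: (allP am).
  - by apply/allP => x /mem_drop; apply: (allP am).
  rewrite /nilp size_drop sp size_takel ?sp //.
  rewrite -!natrM !mulnb; congr (_%:R); congr (nat_of_bool _).
  have -> : (j == 0 :> nat) && (m - j == 0)%N = false by lia.
  by case: (odd j) => /=; rewrite ?andbF ?andbT.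
case: m m_gt0 m_even => [//|m] _ m_even; rewrite big_ord_recl big_ord_recr.
rewrite /= in m_even *; rewrite (negbTE m_even) big_add1 big_mkord.
by rewrite !mul0r !mulr0 add0r addr0.
Qed.

Lemma alt_sum_euler_number m : alt_sum m = (euler_number m)%:R.
Proof.
pose L (s : 'S_m) := map s (enum 'I_m).
have L_inj : injective L.
  by move=> s t /eq_in_map E; apply/permP => i; apply: E; rewrite mem_enum.
rewrite /alt_sum -val_enum_ord psum_map ?enum_uniq //; last by apply: in2W;
  apply: val_inj.
rewrite /psum (perm_big [seq L s | s : 'S_m]); last first.
  rewrite perm_sym; apply: uniq_perm.
  - by rewrite map_inj_uniq ?enum_uniq.
  - exact: permutations_uniq.
  have sz : size [seq L s | s : 'S_m] = size (permutations (enum 'I_m)).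
    by rewrite size_image size_permutations ?enum_uniq // size_enum_ord card_Sn.
  apply: (uniq_min_size _ _ _).2;
    [by rewrite map_inj_uniq ?enum_uniq| |by rewrite sz].
  move=> _ /fintype.imageP[s _ ->]; rewrite mem_permutations; apply: uniq_perm.
  - by rewrite map_inj_uniq ?enum_uniq //; apply: perm_inj.
  - exact: enum_uniq.
  by move=> i; rewrite mem_enum -{1}(permKV s i) map_f ?mem_enum.
rewrite big_image /= /euler_number -sum1_card natr_sum.
rewrite [RHS]big_mkcond; apply: eq_bigr => s _ /=; rewrite inE.
suff -> : alternates true (map val (L s)) = alternating s by case: alternating.
have sz : size (map val (L s)) = m by rewrite /L 2!size_map size_enum_ord.
have nthE (i : 'I_m) : nth 0%N (map val (L s)) i = s i.
  by rewrite /L -map_comp (nth_map i) ?size_enum_ord //= nth_ord_enum.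
apply/alternatesP/forallP => [H i|H i].
  apply/forallP => j; apply/implyP => /eqP ji; have := H i;
    rewrite sz -ji ltn_ord.
  by rewrite !nthE addTb; case: odd; apply.
rewrite sz => im; have := H (Ordinal (ltnW im)) => /forallP/(_ (Ordinal im)).
rewrite /= eqxx /= -(nthE (Ordinal (ltnW im))) -(nthE (Ordinal im)) /=.
by case: odd.
Qed.

End AlternatingSums.

(** * Cycle-sums of a matrix *)

Section CyclicSums.
Variable K : comNzRingType.

(** The cycle-sum of a list instead of a set: the starting point and the order of the indices can be
    chosen to suit the matrix, and [cyclic_sum_perm] shows that they do not affect the value. *)
Definition cyclic_sum (T : eqType) (w : T -> T -> K) (s : seq T) : K :=
  if s is x :: s' then psum (fun p => path_prod w x (rcons p x)) s' else 1.

Lemma path_prodE (T : Type) (w : T -> T -> K) x0 x q :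
  path_prod w x q = \prod_(i < size q) w (nth x0 (x :: q) i) (nth x0 q i).
Proof.
elim: q x => [|y q IHq] x /=; first by rewrite big_ord0.
by rewrite big_ord_recl /= IHq.
Qed.

Lemma path_prod_rot (T : Type) (w : T -> T -> K) x y p q :
  path_prod w x (rcons (p ++ y :: q) x) = path_prod w y (rcons (q ++ x :: p) y).
Proof.
by rewrite !rcons_cat /= !path_prod_cat /= -!cats1 !path_prod_cat /=; ring.
Qed.

Lemma cyclic_sum_perm (T : eqType) (w : T -> T -> K) s t :
  uniq s -> perm_eq s t -> cyclic_sum w s = cyclic_sum w t.
Proof.
case: s => [|x s] us st; first by move: st => /perm_size; case: t.
case: t st => [|y t] st; first by move/perm_size: st.
rewrite /cyclic_sum; case: (eqVneq x y) => [exy|nxy].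
  by subst y; apply: perm_psum; rewrite perm_cons in st.
have ut : uniq (y :: t) by rewrite -(perm_uniq st).
have ys : y \in s by have := perm_mem st y;
  rewrite !inE eqxx eq_sym (negbTE nxy).
move: us ut => /= /andP[xs us] /andP[yt ut].
(* [g x y] rotates a cycle starting at [x] so that it starts at [y]; [g y x] rotates it back. *)
pose g u v (p : seq T) := drop (index v p).+1 p ++ u :: take (index v p) p.
have gE u v p q : v \notin p -> g u v (p ++ v :: q) = q ++ u :: p.
  move=> vp; rewrite /g index_cat (negbTE vp) /= eqxx addn0.
  by rewrite take_size_cat // -[p ++ _]cat_rcons drop_size_cat ?size_rcons.
have split p : p \in permutations s ->
    exists p1 p2, [/\ p = p1 ++ y :: p2, y \notin p1, x \notin p2
                    & perm_eq (p2 ++ x :: p1) t].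
  rewrite mem_permutations => ps.
  have up : uniq p by rewrite (perm_uniq ps).
  have : y \in p by rewrite (perm_mem ps).
  move=> yp; case/splitPr: yp ps up => p1 p2 ps up; exists p1, p2; split => //.
  - by move: up; rewrite cat_uniq /= negb_or -andbA => /and3P[_ yp1 _].
  - by apply: contra xs; rewrite -(perm_mem ps) mem_cat inE orbA => ->;
    rewrite orbT.
  rewrite -(perm_cons y) -(permPr st) -cat_cons perm_catC /=.
  by rewrite perm_cons.
have gsplit p : p \in permutations s -> [/\ g x y p \in permutations t,
    g y x (g x y p) = p &
    path_prod w x (rcons p x) = path_prod w y (rcons (g x y p) y)].
  move=> /split[p1 [p2 [-> yp1 xp2 pt]]]; rewrite gE //; split.
  - by rewrite mem_permutations.
  - by rewrite gE.
  exact: path_prod_rot.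
have ug : uniq (map (g x y) (permutations s)).
  rewrite map_inj_in_uniq ?permutations_uniq // => p q ps qs E.
  by have [_ <- _] := gsplit p ps; have [_ <- _] := gsplit q qs; rewrite E.
transitivity (\sum_(q <- map (g x y) (permutations s)) path_prod w y (rcons q
  y)).
  rewrite big_map /psum big_seq [RHS]big_seq; apply: eq_bigr => p ps.
  by have [_ _ ->] := gsplit p ps.
apply: perm_big; apply: uniq_perm => //; first exact: permutations_uniq.
apply: (uniq_min_size ug _ _).2.
  by move=> _ /mapP[p ps ->]; have [] := gsplit p ps.
have /= [sst] := perm_size st.
by rewrite size_map !size_permutations // sst.
Qed.

Lemma cyclic_sum_map (T U : eqType) (h : T -> U) (w : U -> U -> K) s :
  uniq s -> {in s &, injective h} ->
  cyclic_sum w (map h s) = cyclic_sum (fun x y => w (h x) (h y)) s.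
Proof.
case: s => [|x s] //= /andP[xs us] hinj; rewrite psum_map //; last first.
  by move=> y z ys zs; apply: hinj; rewrite inE ?ys ?zs orbT.
by apply: eq_psum => p _; rewrite -map_rcons path_prod_map.
Qed.

Lemma eq_cyclic_sum (T : eqType) (w w' : T -> T -> K) s : uniq s -> (1 < size
  s)%N ->
  {in s &, forall x y, x != y -> w x y = w' x y} ->
  cyclic_sum w s = cyclic_sum w' s.
Proof.
case: s => [|x s] // us s_gt1 ww; apply: eq_psum => p; rewrite inE => ps.
have up : uniq (x :: p) by rewrite -(perm_cons x) in ps; rewrite (perm_uniq ps).
rewrite -!cats1 !path_prod_cat (eq_in_path_prod _ up (w' := w')); last first.
  by move=> y z; rewrite !inE !(perm_mem ps) -!in_cons; apply: ww.
congr (_ * _) => /=; rewrite ww ?mem_head //.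
  by have := mem_last x p; rewrite !inE (perm_mem ps).
have /= [sp] := perm_size ps; case: p up ps sp => [|y p] /=.
  by move=> _ _ sp; rewrite /= -sp in s_gt1.
by move=> /andP[xp _] _ _; apply: contraNneq xp => <-; exact: mem_last.
Qed.

(** Conjugation by a diagonal matrix: along a closed cycle every index is left once and entered
    once, so the factors [d] and [e] cancel. *)
Lemma cyclic_sum_gauge (T : eqType) (d e : T -> K) (w : T -> T -> K) s :
  (forall x, e x * d x = 1) -> s != [::] ->
  cyclic_sum (fun x y => d x * w x y * e y) s = cyclic_sum w s.
Proof.
move=> ed; case: s => [|x s] // _; apply: eq_psum => p _.
have H z q : path_prod (fun x y => d x * w x y * e y) z q
           = d z * path_prod w z q * e (last z q).
  elim: q z => [|y q IHq] z /=; first by rewrite mulr1 mulrC ed.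
  rewrite IHq; transitivity (d z * w z y * (e y * d y) * path_prod w y q * e
    (last y q)).
    by ring.
  by rewrite ed; ring.
by rewrite H last_rcons mulrC mulrA ed mul1r.
Qed.

(** The cycle starts at its minimum 0, which it leaves by an ascent and reaches again by a descent;
    in between stands an arbitrary permutation of the other indices. *)
Lemma cyclic_sum_step (a b : K) k :
  cyclic_sum (step_weight a b) (iota 0 k.+2) = a * b * eulerian a b k.+1.
Proof.
have -> : eulerian a b k.+1 = psum (list_weight a b) (iota 1 k.+1).
  have := psum_sorted (list_weight_invariant a b) (iota_ltn_sorted 1 k.+1).
  by rewrite size_iota => ->.
rewrite -[LHS]/(psum _ (iota 1 k.+1)) /psum big_distrr big_seq [RHS]big_seq.
apply: eq_bigr => p; rewrite mem_permutations => pk.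
case: p pk => [|x p] pk; first by move/perm_size: pk.
have pos y : y \in x :: p -> (0 < y)%N by rewrite (perm_mem pk) mem_iota =>
  /andP[].
rewrite /= -cats1 path_prod_cat /= {1}/step_weight pos ?mem_head //.
by rewrite {2}/step_weight ltnNge ltnW ?pos ?mem_last //=; ring.
Qed.

Lemma psum1 (T : eqType) (F : seq T -> K) x : psum F [:: x] = F [:: x].
Proof. by rewrite psum_insert //= big_ord1 /psum big_seq1. Qed.

Lemma psum2 (T : eqType) (F : seq T -> K) x y : uniq [:: x; y] ->
  psum F [:: x; y] = F [:: x; y] + F [:: y; x].
Proof. by move=> u; rewrite psum_insert //= !big_ord_recl big_ord0 !psum1 /=
  addr0. Qed.

Lemma psum3 (T : eqType) (F : seq T -> K) x y z : uniq [:: x; y; z] ->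
  psum F [:: x; y; z] = F [:: x; y; z] + F [:: x; z; y] + F [:: y; x; z]
    + F [:: z; x; y] + F [:: y; z; x] + F [:: z; y; x].
Proof.
move=> u; have u2 : uniq [:: y; z] by case/andP: u.
by rewrite psum_insert //= !big_ord_recl big_ord0 !psum2 //= addr0 !addrA.
Qed.

Lemma cyclic_sum1 (T : eqType) (w : T -> T -> K) x : cyclic_sum w [:: x] = w x
  x.
Proof. by rewrite /cyclic_sum /psum big_seq1 /= mulr1. Qed.

Lemma cyclic_sum2 (T : eqType) (w : T -> T -> K) x y :
  cyclic_sum w [:: x; y] = w x y * w y x.
Proof. by rewrite /cyclic_sum psum1 /= mulr1. Qed.

Lemma cyclic_sum3 (T : eqType) (w : T -> T -> K) x y z : uniq [:: y; z] ->
  cyclic_sum w [:: x; y; z] = w x y * w y z * w z x + w x z * w z y * w y x.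
Proof. by move=> u; rewrite /cyclic_sum psum2 //=; ring. Qed.

Lemma cyclic_sum4 (T : eqType) (w : T -> T -> K) x y z t : uniq [:: y; z; t] ->
  cyclic_sum w [:: x; y; z; t] =
    w x y * w y z * w z t * w t x + w x y * w y t * w t z * w z x
  + w x z * w z y * w y t * w t x + w x z * w z t * w t y * w y x
  + w x t * w t y * w y z * w z x + w x t * w t z * w z y * w y x.
Proof. by move=> u; rewrite /cyclic_sum psum3 //=; ring. Qed.

End CyclicSums.

Section MatrixCycleSums.
Variables (K : comNzRingType) (n : nat).
Implicit Types (A : 'M[K]_n) (I : {set 'I_n}).

Lemma cycle_productE A x p : uniq (x :: p) ->
  cycle_product A (x :: p) = path_prod A x (rcons p x).
Proof.
move=> up; rewrite /cycle_product (big_nth x) big_mkord (path_prodE _ x)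
  size_rcons.
apply: eq_bigr => i _; have ip := ltn_ord i.
rewrite next_nth mem_nth // index_uniq // nth_rcons_default.
by rewrite -rcons_cons nth_rcons ip.
Qed.

Lemma cycle_sumE A I s : perm_eq s (enum I) -> cycle_sum A I = cyclic_sum A s.
Proof.
move=> sI; rewrite (cyclic_sum_perm _ _ sI); last first.
  by rewrite (perm_uniq sI) enum_uniq.
rewrite /cycle_sum /cyclic_sum; have := enum_uniq I.
case: (enum I) => [//|x s'] us.
rewrite /psum big_seq [RHS]big_seq; apply: eq_bigr => p.
rewrite mem_permutations -(perm_cons x) => ps.
by rewrite cycle_productE // (perm_uniq ps).
Qed.

Lemma cycle_sum_set A s : uniq s -> cycle_sum A [set x in s] = cyclic_sum A s.
Proof.
move=> us; apply: cycle_sumE; apply: uniq_perm; rewrite ?enum_uniq //.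
by move=> x; rewrite mem_enum inE.
Qed.

(** The order that decides between [a] and [b] is that of the list, not that of the indices; [d] and
    [e] undo a diagonal conjugation. *)
Lemma cyclic_sum_ordered A a b (d e : 'I_n -> K) s : uniq s -> (1 < size s)%N ->
  (forall x, e x * d x = 1) ->
  pairwise (fun x y => (A x y == d x * a * e y) && (A y x == d y * b * e x)) s
    ->
  cyclic_sum A s = a * b * eulerian a b (size s).-1.
Proof.
move=> us s_gt1 ed /(pairwiseP _) pw.
case: s us s_gt1 pw => // x0 [//|x1 s'] us _ pw; set s := x0 :: _ in us pw *.
pose h := nth x0 s.
have hinj : {in iota 0 (size s) &, injective h}.
  move=> i j; rewrite !mem_iota !add0n /= => im jm /eqP.
  by rewrite nth_uniq // => /eqP.
rewrite -{1}(mkseq_nth x0 s) /mkseq -/h cyclic_sum_map ?iota_uniq //.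
rewrite -(cyclic_sum_step a b (size s')) -[RHS](cyclic_sum_gauge (d := d \o h)
  (e := e \o h) _ (fun i => ed (h i))) //.
apply: eq_cyclic_sum; rewrite ?iota_uniq //= => i j.
rewrite -[0%N :: _]/(iota 0 (size s)) !mem_iota !add0n /= => im jm nij.
rewrite /step_weight; case: ltngtP nij => // ij _.
  by have /andP[/eqP-> _] := pw x0 i j im jm ij.
by have /andP[_ /eqP->] := pw x0 j i jm im ij.
Qed.

End MatrixCycleSums.

Section TwoValuedMatrix.
Variable K : comNzRingType.

(* The cycle-sums of the matrix with [c] on, [a] above and [b] below the diagonal. *)
Definition two_valued_cycle_sum (a b c : K) (k : nat) : K :=
  match k with
  | 0 => 1
  | 1 => c
  | k'.+2 => a * b * eulerian a b k'.+1
  end.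

Definition two_valued_mx n (a b c : K) : 'M[K]_n :=
  \matrix_(i, j) if i == j then c else step_weight a b i j.

Lemma cycle_sum_two_valued n (a b c : K) (I : {set 'I_n}) :
  cycle_sum (two_valued_mx n a b c) I = two_valued_cycle_sum a b c #|I|.
Proof.
rewrite (cycle_sumE _ (perm_refl _)) cardE.
case E : (enum I) => [//|x [|y s]]; first by rewrite cyclic_sum1 mxE eqxx.
rewrite -E (cyclic_sum_ordered (a := a) (b := b) (d := fun=> 1) (e := fun=> 1)).
- by rewrite E.
- exact: enum_uniq.
- by rewrite E.
- by rewrite mulr1.
have := sorted_enum_ord I; rewrite sorted_map sorted_pairwise; last first.
  by move=> z t u; apply: ltn_trans.
apply: sub_pairwise => z t /= zt.
rewrite !mxE -[z == t]/(val z == val t) -[t == z]/(val t == val z) ltn_eqF //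
  gtn_eqF //.
by rewrite /step_weight zt ltnNge ltnW //= !mul1r !mulr1 !eqxx.
Qed.

(** Multiplying [eulerianS] by [a * b] gives each half of a split permutation its own factor
    [a * b]. The recurrence thus closes on the cycle-sums of size at least 2, and the diagonal [c]
    does not enter. *)
Lemma two_valued_cycle_sumSS (a b c : K) m : (0 < m)%N ->
  two_valued_cycle_sum a b c m.+2 = (a + b) * two_valued_cycle_sum a b c m.+1 +
  \sum_(1 <= j < m) ('C(m, j))%:R *
    (two_valued_cycle_sum a b c j.+1 * two_valued_cycle_sum a b c (m - j).+1).
Proof.
case: m => // m _; rewrite {1}/two_valued_cycle_sum eulerianS // mulrDr.
congr (_ + _); first by rewrite /=; ring.
rewrite big_distrr /= !big_add1 !big_mkord; apply: eq_bigr => j _ /=.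
rewrite subSS; case E : (m - j)%N => [|k]; first by have := ltn_ord j; lia.
by ring.
Qed.

End TwoValuedMatrix.

(** * Symmetrized principal minors *)

Section PartitionSums.
Variables (K : comNzRingType) (g : nat -> K).

Definition partition_sum (T : finType) (S : {set T}) : K :=
  \sum_(P : {set {set T}} | finset.partition P S) \prod_(B in P) g #|B|.

Lemma partition_sum0 (T : finType) : partition_sum (finset.set0 : {set T}) = 1.
Proof.
rewrite /partition_sum (big_pred1 finset.set0) => [|P];
  first by rewrite big_set0.
by rewrite partition_set0.
Qed.

(** Deleting the block [B] of [x] is a bijection onto the partitions of [S :\: B]. *)
Lemma partition_sum_block (T : finType) (S : {set T}) x : x \in S ->
  partition_sum S =
  \sum_(B : {set T} | (x \in B) && (B \subset S))
    g #|B| * partition_sum (S :\: B).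
Proof.
move=> xS; rewrite /partition_sum.
rewrite (partition_big (pblock^~ x) (fun B => (x \in B) && (B \subset S)));
  last first.
  move=> P PS; have xP : x \in cover P by rewrite (cover_partition PS).
  by rewrite mem_pblock xP (partitionS PS) // pblock_mem.
apply: eq_bigr => B /andP[xB BS].
have B0 : B != finset.set0 by apply/finset.set0Pn; exists x.
have Bnotin Q : finset.partition Q (S :\: B) -> B \notin Q.
  move=> QS; apply/negP => /(partitionS QS)/subsetP/(_ x xB).
  by rewrite inE xB.
rewrite big_distrr /= (reindex_onto (fun Q => B |: Q) (fun P => P :\ B));
  last first.
  move=> P /andP[PS /eqP xPB]; rewrite finset.setD1K // -xPB pblock_mem //.
  by rewrite (cover_partition PS).
apply: eq_big => [Q|Q]; last first.
  move=> /andP[/andP[_ _] /eqP QE].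
  have BQ : B \notin Q by rewrite -QE !inE eqxx.
  by rewrite big_setU1.
apply/andP/idP => [[/andP[PS _] /eqP <-]|QS].
  by rewrite -[S :\: B]/(S :\: B); apply: partitionD1 => //; rewrite !inE eqxx.
have BQ := Bnotin Q QS.
have PS : finset.partition (B |: Q) S.
  rewrite -(finset.setID S B) (finset.setIidPr BS); apply: partitionU1 => //.
  by rewrite disjoint_sym; apply/finset.setDidPl;
    rewrite finset.setDDl finset.setUid.
rewrite PS finset.setU1K //= eqxx; split => //.
by apply/eqP/def_pblock; rewrite ?(partition_trivIset PS) // !inE eqxx.
Qed.

Lemma sum_over_sets_containing (T : finType) (S : {set T}) x (F : nat -> K) m :
  x \in S -> #|S| = m.+1 ->
  \sum_(B : {set T} | (x \in B) && (B \subset S)) F #|B| =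
  \sum_(j < m.+1) ('C(m, j))%:R * F j.+1.
Proof.
move=> xS cS.
have cSx : #|S :\ x| = m by move: cS; rewrite (cardsD1 x) xS => -[].
rewrite (reindex_onto (fun B => x |: B) (fun B => B :\ x)); last first.
  by move=> B /andP[xB _]; rewrite finset.setD1K.
rewrite (eq_bigl (fun B : {set T} => B \subset S :\ x)); last first.
  move=> B; rewrite !inE eqxx /= finset.subUset finset.sub1set xS /=
    finset.subsetD1.
  case: (boolP (x \in B)) => xB; rewrite ?andbF ?andbT;
    last by rewrite finset.setU1K ?eqxx ?andbT.
  have -> : ((x |: B) :\ x == B) = false.
    by apply/eqP => /finset.setP/(_ x); rewrite !inE eqxx xB.
  by rewrite andbF.
rewrite (eq_bigr (fun B : {set T} => F #|B|.+1)); last first.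
  by move=> B /subsetP BS; rewrite cardsU1; case: (boolP (x \in B)) => // /BS;
    rewrite !inE eqxx.
rewrite (partition_big (fun B : {set T} => inord #|B| : 'I_m.+1) xpredT) //=.
apply: eq_bigr => j _.
rewrite (eq_bigr (fun=> F j.+1)); last first.
  move=> B /andP[BS /eqP <-]; rewrite inordK // ltnS -cSx;
    exact: subset_leq_card.
rewrite (eq_bigl (fun B => B \in [set B : {set T} | B \subset S :\ x & #|B| ==
  j])).
  by rewrite sumr_const -[LHS]mulr_natl cards_draws cSx.
move=> B; rewrite inE; case: (boolP (B \subset S :\ x)) => //= BS.
by rewrite -val_eqE /= inordK // ltnS -cSx; exact: subset_leq_card.
Qed.

Definition partition_seq s : K := partition_sum (finset.setTfor 'I_s).

Lemma partition_seq0 : partition_seq 0 = 1.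
Proof.
transitivity (partition_sum (finset.set0 : {set 'I_0})).
  by congr partition_sum; apply/finset.setP => -[].
exact: partition_sum0.
Qed.

(** Dependence on the cardinality alone and the recurrence are proved together; isolating the
    induction step lets it serve for both. *)
Lemma partition_sum_card m : (forall (T : finType) (S : {set T}),
   (#|S| <= m)%N -> partition_sum S = partition_seq #|S|) ->
  forall (T : finType) (S : {set T}), #|S| = m.+1 ->
  partition_sum S = bconv (fun j => g j.+1) partition_seq m.
Proof.
move=> IH T S cS.
have [x xS] : exists x, x \in S by apply/finset.set0Pn; rewrite -card_gt0 cS.
rewrite (partition_sum_block xS).
rewrite (eq_bigr (fun B : {set T} => g #|B| * partition_seq (m.+1 - #|B|)));
  last first.
  move=> B /andP[xB BS]; have cSB : #|S :\: B| = (m.+1 - #|B|)%N.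
    by rewrite cardsD (finset.setIidPr BS) cS.
  have B_gt0 : (0 < #|B|)%N by apply/card_gt0P; exists x.
  by rewrite IH cSB //; lia.
rewrite (sum_over_sets_containing (fun k => g k * partition_seq (m.+1 - k)) xS
  cS).
by apply: eq_bigr => j _; rewrite subSS mulrA.
Qed.

(** The exponential formula in differential form: the generating function of [partition_seq] has the
    derivative of that of [g] as its logarithmic derivative. *)
Lemma partition_seqS m :
  partition_seq m.+1 = bconv (fun j => g j.+1) partition_seq m.
Proof.
apply: partition_sum_card; last by rewrite cardsT card_ord.
elim: m => [|m IHm] T S.
  rewrite leqn0 cards_eq0 => /eqP->; rewrite cards0 partition_sum0.
  by rewrite partition_seq0.
rewrite leq_eqVlt => /predU1P[cS|/IHm //].
rewrite (partition_sum_card IHm cS) cS.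
by rewrite /partition_seq (partition_sum_card IHm (m := m)) ?cardsT ?card_ord.
Qed.

End PartitionSums.

Section DVar.
Variables (K : comNzRingType) (n : nat).

(** The block sizes add up to [s], so the global sign is the product of the signs [(-1) ^+ #|B|.-1]
    and can be moved into the weights. *)
Lemma dvarE s : dvar K n s = partition_seq (fun k => (-1) ^+ k.-1 * cvar K n k)
  s.
Proof.
apply: eq_bigr => P PT; rewrite big_split /=; congr (_ * _).
rewrite prodrXr /=; congr (_ ^+ _).
have : (\sum_(B in P) #|B| = s)%N by rewrite -(card_partition PT) cardsT
  card_ord.
move=> sE; rewrite -[X in (X - _)%N]sE -sum1_card -sumnB => [|B BP]; last first.
  by rewrite card_gt0 (partition_neq0 PT).
by apply: eq_bigr => B BP; rewrite subn1.
Qed.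

Lemma dvar0 : dvar K n 0 = 1.
Proof. by rewrite dvarE partition_seq0. Qed.

Lemma dvarS m :
  dvar K n m.+1 = bconv (fun j => (-1) ^+ j * cvar K n j.+1) (dvar K n) m.
Proof. by rewrite dvarE partition_seqS; apply: eq_bconv => j _;
  rewrite ?dvarE. Qed.

End DVar.

(** * The matrices with symmetrized cycle-sums *)

Arguments cvar : simpl never.

Section RealizedCycleSums.
Variables (K : comNzRingType) (n : nat).

Definition realizes (A : 'M[K]_n) (c : 'I_n -> K) :=
  forall I, cycle_sum A I = (cvar K n #|I|).@[c].

Lemma meval_cvarS (c : 'I_n -> K) (k : 'I_n) : (cvar K n k.+1).@[c] = c k.
Proof. by rewrite /cvar valK /= mevalXU. Qed.

Lemma meval_cvar0 (c : 'I_n -> K) : (cvar K n 0).@[c] = 1.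
Proof. exact: meval1. Qed.

Lemma realizes_cyclic_sum A c s : realizes A c -> uniq s ->
  cyclic_sum A s = (cvar K n (size s)).@[c].
Proof. by move=> Ac us; rewrite -cycle_sum_set // Ac cardsE (card_uniqP us).
  Qed.

End RealizedCycleSums.

Lemma exists_notin n (s : seq 'I_n) : (size s < n)%N -> exists x, x \notin s.
Proof.
move=> sn; apply/existsP; rewrite -negb_forall; apply/negP => /forallP H.
have : (size (enum 'I_n) <= size s)%N.
  by apply: uniq_leq_size; [apply: enum_uniq | move=> x _; apply: H].
by rewrite size_enum_ord leqNgt sn.
Qed.

(** * Matrices with [c_2 = 0]: there are no nonzero short cycles *)

Section VanishingTwoCycles.
Variables (K : fieldType) (n : nat) (A : 'M[K]_n).

Let cp x p := path_prod A x (rcons p x).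

Section NoShorterCycle.
Variable k : nat.
Hypothesis short : forall x p, (0 < size p)%N -> ((size p).+1 < k)%N ->
  uniq (x :: p) -> cp x p = 0.

(* A chord of a nonvanishing cycle would cut off a shorter nonvanishing cycle. *)
Lemma cycle_no_chord u q v : uniq (u :: q) -> (size q).+1 = k -> cp u q != 0 ->
  v \in q -> A u v != 0 -> exists q2, q = v :: q2.
Proof.
move=> uq sq cq vq; case/splitPr: vq uq sq cq => q1 q2 uq sq cq Auv.
case: q1 uq sq cq => [|y q1] uq sq cq; first by exists q2.
have : cp u (v :: q2) = 0.
  apply: short => //; first by move: sq; rewrite /= size_cat /=; lia.
  apply: (subseq_uniq _ uq).
  exact: (cat_subseq (subseq_refl [:: u]) (suffix_subseq (y :: q1) (v :: q2))).
move/eqP; rewrite /cp /= mulf_eq0 (negbTE Auv) /=.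
move: cq; rewrite /cp rcons_cat path_prod_cat /= !mulf_eq0 !negb_or.
by case/andP=> _ /andP[_ /negbTE->].
Qed.

(** The first edge of one cycle is a nonzero edge of the matrix, so by [cycle_no_chord] it is also
    the first edge of the other. Rotate both cycles past it and repeat; [r] collects the vertices
    already compared. *)
Lemma nonzero_cycle_unique q q' r x : perm_eq q q' -> uniq (x :: q ++ r) ->
  (size (q ++ r)).+1 = k -> cp x (q ++ r) != 0 -> cp x (q' ++ r) != 0 -> q = q'.
Proof.
elim: q q' r x => [|y q IHq] q' r x qq' uq sq cq cq'.
  by move/perm_size: qq'; case: q' cq'.
have yq' : y \in q' ++ r by rewrite mem_cat -(perm_mem qq') mem_head.
have Axy : A x y != 0 by move: cq; rewrite /cp /= mulf_eq0 negb_or => /andP[].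
have uq' : uniq (x :: q' ++ r).
  by rewrite -(perm_uniq (s1 := x :: (y :: q) ++ r)) // perm_cons perm_cat2r.
have sq' : (size (q' ++ r)).+1 = k.
  by rewrite -sq !size_cat (perm_size qq').
have [q2 Eq2] := cycle_no_chord uq' sq' cq' yq' Axy.
case: q' qq' Eq2 uq' sq' cq' {yq'} => [|z q'] qq' /=;
  first by move/perm_size: qq'.
case=> zy _; subst z => uq' sq' cq'; congr (_ :: _);
  apply: (IHq _ (rcons r x) y).
- by rewrite perm_cons in qq'.
- by rewrite -rcons_cat -rcons_cons -rot1_cons rot_uniq.
- by rewrite -rcons_cat size_rcons.
- by move: cq; rewrite /cp -[_ ++ r]/([::] ++ y :: q ++ r) path_prod_rot cats1
  rcons_cat.
- by move: cq'; rewrite /cp -[y :: q' ++ r]/([::] ++ y :: q' ++ r)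
  path_prod_rot cats1 rcons_cat.
Qed.

(** At the least length of a nonzero cycle nothing can cancel, so a nonzero cycle forces a nonzero
    cycle-sum. *)
Lemma cyclic_sum_unique x p : uniq (x :: p) -> (size p).+1 = k -> cp x p != 0 ->
  cyclic_sum A (x :: p) = cp x p.
Proof.
move=> up sp cpx; rewrite /cyclic_sum /psum (bigD1_seq p) ?permutations_uniq
  //=.
  rewrite big_seq_cond big1 ?addr0 // => q /andP[].
  rewrite mem_permutations perm_sym => pq npq; apply/eqP/negP => /negP cq.
  case/eqP: npq; apply/esym; apply: (nonzero_cycle_unique (r := [::]) pq);
  by rewrite ?cats0; eassumption.
by rewrite mem_permutations.
Qed.

End NoShorterCycle.

Lemma cyclic_sum_neq0 x s : cyclic_sum A (x :: s) != 0 ->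
  exists2 q, perm_eq q s & cp x q != 0.
Proof.
move=> H; case: (boolP (has (fun q => cp x q != 0) (permutations s))).
  by move=> /hasP[q]; rewrite mem_permutations; exists q.
move=> /hasPn N; case/eqP: H; rewrite /cyclic_sum /psum big_seq big1 // => q qs.
by apply/eqP; have := N q qs; rewrite negbK.
Qed.

Variable c : 'I_n -> K.
Hypothesis Ac : realizes A c.
Hypothesis c2 : (cvar K n 2).@[c] = 0.

(** A nonzero cycle of minimal length [k] makes [c_k] nonzero, so all sets of [k] indices carry a
    nonzero cycle. As [k < n], there is room for one more vertex, and comparing the sets obtained by
    omitting one vertex gives [x] too many out-neighbours. *)
Lemma no_short_cycles k x p : (0 < size p)%N -> (size p).+1 = k -> (k < n)%N ->
  uniq (x :: p) -> cp x p = 0.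
Proof.
elim/ltn_ind: k x p => k IHk x p p_gt0 sp kn up.
have short y q : (0 < size q)%N -> ((size q).+1 < k)%N -> uniq (y :: q) -> cp y
  q = 0.
  by move=> q0 qk uq; apply: (IHk _ qk) => //; apply: ltn_trans kn.
case: p p_gt0 sp up => [|y p] // _ sp up; case: p sp up => [|z p] sp up.
  have := realizes_cyclic_sum Ac up;
    rewrite c2 cyclic_sum2 /cp /= mulr1 => -> //.
apply/eqP/negP => /negP cxp.
have ck : (cvar K n k).@[c] != 0.
  by rewrite -sp -(realizes_cyclic_sum Ac up) (cyclic_sum_unique short).
(* In any set of [k] vertices containing [x], the absence of chords leaves [x] exactly one
   out-neighbour. *)
have out s : uniq (x :: s) -> (size s).+1 = k ->
    exists2 u, u \in s & A x u != 0 /\ forall v, v \in s -> A x v != 0 -> v = u.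
  move=> us ss; have := realizes_cyclic_sum Ac us; rewrite [size _]/= ss => Es.
  have [|[|u q] qs cq] := @cyclic_sum_neq0 x s; first by rewrite Es.
    by move: ss; rewrite -(perm_size qs) -sp.
  exists u; first by rewrite -(perm_mem qs) mem_head.
  split; first by move: cq; rewrite /cp /= mulf_eq0 negb_or => /andP[].
  move=> v; rewrite -(perm_mem qs) => vq Axv.
  have [|| q2 [] //] := cycle_no_chord short _ _ cq vq Axv.
    by rewrite -(perm_uniq (s1 := x :: s)) // perm_cons perm_sym.
  by rewrite (perm_size qs).
have [w wV] : exists w, w \notin [:: x, y, z & p] by apply: exists_notin;
  rewrite -sp in kn.
pose V := [:: w, y, z & p].
have uV : uniq (x :: V).
  have : uniq [:: w, x, y, z & p] by rewrite cons_uniq wV.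
  by rewrite (perm_uniq (permEl (perm_catCA [:: w] [:: x] _))).
have outV t : t \in V -> exists2 u, u \in rem t V &
    A x u != 0 /\ forall v, v \in rem t V -> A x v != 0 -> v = u.
  move=> tV; apply: out; last by rewrite size_rem // -sp.
  apply: subseq_uniq uV; exact: (cat_subseq (subseq_refl [:: x]) (rem_subseq t
    V)).
have memV t u : (u \in rem t V) = (u != t) && (u \in V).
  by rewrite mem_rem_uniq ?inE //; case/andP: uV.
have [u0 + [Au0 _]] := outV w (mem_head _ _); rewrite memV => /andP[_ u0V].
have [u1 + [Au1 _]] := outV u0 u0V; rewrite memV => /andP[u10 u1V].
(* [u0] and [u1] are distinct out-neighbours of [x]. As [V] has [k >= 3] elements, some [t] differs
   from both, and omitting [t] keeps both: a contradiction. *)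
have /hasP[t tV] : has (fun t => t \notin [:: u0; u1]) V.
  rewrite -[has _ _]negbK -all_predC; apply/negP => /allP H.
  have : (size V <= size [:: u0; u1])%N.
    apply: uniq_leq_size; first by case/andP: uV.
    by move=> t /H /=; rewrite negbK.
  by [].
rewrite !inE negb_or => /andP[t0 t1].
have [u _ [_ Hu]] := outV t tV.
have Eu : u1 = u by apply: Hu => //; rewrite memV eq_sym t1.
by case/eqP: u10; rewrite Eu; apply/esym/Hu; rewrite // memV eq_sym t0.
Qed.

Lemma cvar_eq0_of_cvar2_eq0 k : (1 < k < n)%N -> (cvar K n k).@[c] = 0.
Proof.
move=> /andP[k1 kn]; pose s := take k (enum 'I_n).
have us : uniq s by rewrite take_uniq ?enum_uniq.
have ss : size s = k by rewrite size_takel // size_enum_ord ltnW.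
rewrite -ss -(realizes_cyclic_sum Ac us).
case: s us ss => [|x s] us /= ss; first by move: k1; rewrite -ss.
rewrite /psum big_seq big1 // => p; rewrite mem_permutations => ps.
apply: (@no_short_cycles k); rewrite ?(perm_size ps) ?ss //.
  by move: k1; rewrite -ss; case: (s).
by move: us; rewrite -(perm_uniq (s1 := x :: p)) // perm_cons.
Qed.

End VanishingTwoCycles.

(** * Matrices with [c_2 != 0]: two-valued or exceptional *)

Section Classification.
Variables (K : numFieldType) (n' : nat).
Let n := n'.+3.
Variables (A : 'M[K]_n) (c : 'I_n -> K).
Hypothesis Ac : realizes A c.
Let cv k := (cvar K n k).@[c].
Hypothesis c2 : cv 2 != 0.
Let p := cv 2.

Let i1 : 'I_n := inord 1.
Let i2 : 'I_n := inord 2.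

(* The off-diagonal entries of [A] after conjugating by a diagonal matrix that
   makes the first row constant. *)
Let b x y := A ord0 x * A x y * A y ord0 / p.
Let al := b i1 i2.
Let be := b i2 i1.

Lemma entry2 x y : x != y -> A x y * A y x = p.
Proof.
move=> xy; have := realizes_cyclic_sum Ac (s := [:: x; y]).
by rewrite cyclic_sum2 => ->; rewrite //= inE xy.
Qed.

Lemma entry_neq0 x y : x != y -> A x y != 0.
Proof. by move=> xy; apply: contraNneq c2 => a0;
  rewrite -/p -(entry2 xy) a0 mul0r. Qed.

Lemma normalized_mul x y : x != ord0 -> y != ord0 -> x != y -> b x y * b y x =
  p.
Proof.
move=> x0 y0 xy; rewrite /b; have p0 : p != 0 := c2.
have E : A ord0 x * A x y * A y ord0 / p * (A ord0 y * A y x * A x ord0 / p) =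
  (A ord0 x * A x ord0) * (A x y * A y x) * (A ord0 y * A y ord0) / p / p by
    ring.
rewrite E !entry2 //; try by rewrite eq_sym.
by field.
Qed.

Lemma normalized_add x y : x != ord0 -> y != ord0 -> x != y ->
  b x y + b y x = cv 3 / p.
Proof.
move=> x0 y0 xy; rewrite -mulrDl; congr (_ / _).
rewrite -[cv 3](realizes_cyclic_sum Ac (s := [:: ord0; x; y])).
  by rewrite cyclic_sum3 //= inE xy.
by rewrite /= !inE negb_or ![ord0 == _]eq_sym x0 y0 xy.
Qed.

Lemma i1_neq0 : i1 != ord0.
Proof. by rewrite -val_eqE /= inordK. Qed.
Lemma i2_neq0 : i2 != ord0.
Proof. by rewrite -val_eqE /= inordK. Qed.
Lemma i1_neq2 : i1 != i2.
Proof. by rewrite -val_eqE /= !inordK. Qed.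

Lemma al_be_mul : al * be = p.
Proof. exact: normalized_mul i1_neq0 i2_neq0 i1_neq2. Qed.

Lemma al_be_add : al + be = cv 3 / p.
Proof. exact: normalized_add i1_neq0 i2_neq0 i1_neq2. Qed.

(** The product and the sum of [b x y] and [b y x] do not depend on the pair, so these two numbers
    are always the roots of the same quadratic polynomial. *)
Lemma normalized_cases x y : x != ord0 -> y != ord0 -> x != y ->
  (b x y = al /\ b y x = be) \/ (b x y = be /\ b y x = al).
Proof.
move=> x0 y0 xy; have := normalized_add x0 y0 xy; rewrite -al_be_add => E.
have Ey : b y x = al + be - b x y by rewrite -E; ring.
have := normalized_mul x0 y0 xy; rewrite -al_be_mul Ey => /eqP.
rewrite -subr_eq0.
have -> : b x y * (al + be - b x y) - al * be = (b x y - al) * (be - b x y) by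
  ring.
rewrite mulf_eq0 !subr_eq0 => /orP[/eqP xE|/eqP xE]; [left; rewrite xE|right;
  rewrite -xE]; split => //; ring.
Qed.

(** A 4-cycle through [ord0] is a path of length two in [x, y, z]; a factor [p], the 2-cycle of
    [ord0] with the middle vertex, makes up the difference. *)
Lemma normalized_quad x y z : x != ord0 -> y != ord0 -> z != ord0 ->
  uniq [:: x; y; z] ->
  cv 4 = p * (b x y * b y z + b x z * b z y + b y x * b x z + b y z * b z x
              + b z x * b x y + b z y * b y x).
Proof.
move=> x0 y0 z0 u; have p0 : p != 0 := c2.
rewrite -[cv 4](realizes_cyclic_sum Ac (s := [:: ord0; x; y; z])); last first.
  by rewrite cons_uniq u !inE !negb_or ![ord0 == _]eq_sym x0 y0 z0.
rewrite cyclic_sum4 //.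
have E s t v : s != ord0 -> t != ord0 -> v != ord0 ->
    p * (b s t * b t v) = A ord0 s * A s t * A t v * A v ord0.
  move=> s0 t0 v0; rewrite /b.
  have -> : A ord0 s * A s t * A t v * A v ord0 =
    A ord0 s * A s t * A t v * A v ord0 * (A ord0 t * A t ord0) / p.
    by rewrite entry2 1?eq_sym //; field.
  by field.
by rewrite !mulrDr !E //; ring.
Qed.

(** [x] precedes [y] when the edge from [x] to [y] has weight [al], and [ord0] precedes all.
    Totality is automatic; transitivity separates the two cases of the classification. *)
Let le x y := [|| x == y, x == ord0 | (y != ord0) && (b x y == al)].

Lemma le_total : total le.
Proof.
move=> x y; rewrite /le; case: (eqVneq x y) => //= xy.
case: (eqVneq x ord0) => //= x0; case: (eqVneq y ord0) => //= y0.
by have [[-> _]|[_ ->]] := normalized_cases x0 y0 xy; rewrite eqxx ?orbT.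
Qed.

Lemma cvar_two_valued k : transitive le -> (1 < k <= n)%N ->
  cv k = two_valued_cycle_sum al be (cv 1) k.
Proof.
move=> le_trans /andP[k1 kn]; have p0 : p != 0 := c2.
have al0 : al != 0 by apply: contraNneq c2 => a0;
  rewrite -/p -al_be_mul a0 mul0r.
pose l := sort le (enum 'I_n); pose s := take k l.
have ul : uniq l by rewrite sort_uniq enum_uniq.
have us : uniq s by rewrite take_uniq.
have ss : size s = k by rewrite size_takel // size_sort size_enum_ord.
have ps : pairwise le s.
  have : pairwise le l by rewrite -sorted_pairwise //;
    apply: sort_sorted le_total _.
  exact/subseq_pairwise/take_subseq.
rewrite -[in LHS]ss -[LHS](realizes_cyclic_sum Ac us).
(* With the value [al] at [ord0], conjugation turns the first row into [al] and, because
   [al * be = p], the first column into [be]; so [ord0] fits in as the least element. *)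
pose e x := if x == ord0 then al else A ord0 x.
have e0 x : e x != 0.
  by rewrite /e; case: (eqVneq x ord0) => // x0; apply: entry_neq0;
    rewrite eq_sym.
rewrite (cyclic_sum_ordered (a := al) (b := be) (d := fun x => (e x)^-1) (e :=
  e)) ?ss //.
- by case: (k) k1 => [//|[//|k']] _.
- by move=> x; rewrite mulfV.
move: ps; rewrite uniq_pairwise in us.
move=> ps; have /andP := conj us ps; rewrite -pairwise_relI => {us ps}.
apply: sub_pairwise => x y /= /andP[xy].
rewrite /le (negbTE xy) /=; case: (eqVneq x ord0) => [x0 _|x0 /= /andP[y0 /eqP
  bxy]].
  have y0 : y != ord0 by rewrite -x0 eq_sym.
  have Ay : A ord0 y != 0 by apply: entry_neq0; rewrite eq_sym.
  rewrite x0 /e eqxx (negbTE y0) mulVf // mul1r eqxx /=.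
  apply/eqP; rewrite -[RHS]mulrA [be * al]mulrC al_be_mul.
  by rewrite -(entry2 (x := ord0) (y := y)) 1?eq_sym // mulKf.
have Ax : A ord0 x != 0 by apply: entry_neq0; rewrite eq_sym.
have Ay : A ord0 y != 0 by apply: entry_neq0; rewrite eq_sym.
have Ax' : A x ord0 = p / A ord0 x by rewrite -(entry2 (x := ord0) (y := x))
  1?eq_sym // mulrC mulKf.
have Ay' : A y ord0 = p / A ord0 y by rewrite -(entry2 (x := ord0) (y := y))
  1?eq_sym // mulrC mulKf.
have byx : b y x = be.
  apply: (addrI (b x y)); rewrite {2}bxy al_be_add; exact: normalized_add.
rewrite /e (negbTE x0) (negbTE y0) -bxy -byx /b Ax' Ay'.
by apply/andP; split; apply/eqP; field; rewrite ?Ax ?Ay ?p0.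
Qed.

Lemma le_trans_distinct : (forall x y z, x != ord0 -> y != ord0 -> z != ord0 ->
    uniq [:: x; y; z] -> b x y = al -> b y z = al -> b x z = al) -> transitive
      le.
Proof.
move=> H y x z; rewrite /le; case: (eqVneq x ord0) => [x0|x0];
  first by rewrite !orbT.
rewrite /=; case: (eqVneq x y) => [<- _|xy] /=; first by rewrite (negbTE x0).
move=> /andP[y0 /eqP bxy].
rewrite (negbTE y0) /=; case: (eqVneq y z) => [<- _|yz] /=.
  by rewrite y0 bxy eqxx orbT.
case: (eqVneq x z) => //= xz /andP[z0 /eqP byz].
by rewrite z0 (H x y z) ?eqxx //= !inE negb_or xy xz yz.
Qed.

(** A cyclic and a transitive triple of nonzero indices give values of [c_4] that differ by
    [2 * p * (al - be) ^+ 2]. One cyclic triple thus excludes all transitive ones, while a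
    tournament on four vertices always contains a transitive triple; hence only three nonzero
    indices exist. *)
Lemma cvar_exceptional : ~ transitive le ->
  [/\ n = 4, cv 3 = 0 & cv 4 = - 6 * cv 2 ^+ 2].
Proof.
move=> ntr; have p0 : p != 0 := c2.
have al_be : al != be.
  apply/eqP => E; apply/ntr/le_trans_distinct => x y z x0 y0 z0.
  rewrite /= !inE negb_or => /and3P[/andP[_ xz] _ _] _ _.
  by have [[-> _]|[-> _]] := normalized_cases x0 z0 xz.
have : exists x y z,
    [/\ x != ord0, y != ord0, z != ord0, uniq [:: x; y; z]
     & [/\ b x y = al, b y z = al & b x z = be]].
  apply: contrapT => N; apply/ntr/le_trans_distinct => x y z x0 y0 z0 uxyz bxy
    byz.
  have xz : x != z by move: uxyz; rewrite /= !inE negb_or => /andP[/andP[]].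
  have [[-> _ //]|[bxz _]] := normalized_cases x0 z0 xz.
  by case: N; exists x, y, z.
move=> [u [v [w [u0 v0 w0 uvw [buv bvw buw]]]]].
have rev x y : x != ord0 -> y != ord0 -> x != y ->
    (b x y = al -> b y x = be) /\ (b x y = be -> b y x = al).
  by move=> x0 y0 xy; have [[-> ->]|[-> ->]] := normalized_cases x0 y0 xy;
    split=> // ->.
have al_be2 : (al - be) ^+ 2 != 0 by rewrite expf_eq0 /= subr_eq0.
have /and3P[] := uvw; rewrite !inE negb_or => /andP[uv uw] vw _.
have bvu := (rev _ _ u0 v0 uv).1 buv; have bwv := (rev _ _ v0 w0 vw).1 bvw.
have bwu := (rev _ _ u0 w0 uw).2 buw.
have c4 : cv 4 = p * (3 * al ^+ 2 + 3 * be ^+ 2).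
  rewrite (normalized_quad u0 v0 w0 uvw) buv bvw buw bvu bwv bwu; ring.
have not_transitive x y z : x != ord0 -> y != ord0 -> z != ord0 ->
    uniq [:: x; y; z] -> b x y = al -> b y z = al -> b x z = be.
  move=> x0 y0 z0 uxyz bxy byz; have := normalized_quad x0 y0 z0 uxyz.
  have /and3P[] := uxyz; rewrite !inE negb_or => /andP[xy xz] yz _.
  have byx := (rev _ _ x0 y0 xy).1 bxy; have bzy := (rev _ _ y0 z0 yz).1 byz.
  have [[bxz bzx]|[]//] := normalized_cases x0 z0 xz.
  rewrite c4 bxy byz bxz byx bzy bzx => /(mulfI p0)/eqP; rewrite -subr_eq0.
  set t := _ - _; have -> : t = 2 * (al - be) ^+ 2 by rewrite /t; ring.
  by rewrite mulf_eq0 pnatr_eq0 /= (negbTE al_be2).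
have n4 : n = 4.
  have un : uniq [:: ord0; u; v; w].
    by rewrite cons_uniq uvw !inE !negb_or ![ord0 == _]eq_sym u0 v0 w0.
  have : (size [:: ord0; u; v; w] <= size (enum 'I_n))%N.
    by apply: uniq_leq_size => // x; rewrite mem_enum.
  rewrite size_enum_ord [size _]/= leq_eqVlt => /orP[/eqP/esym //|n5].
  have [t] := @exists_notin n [:: ord0; u; v; w] n5.
  rewrite !inE !negb_or => /and4P[t0 tu tv tw].
  (* If [y] did not beat [t], then [x, y, t] would be a transitive triple whichever way the edge
     between [x] and [t] points. Hence [v] and [w] both beat [t], and [v, w, t] is transitive. *)
  have step x y : x != ord0 -> y != ord0 -> x != y -> t != x -> t != y ->
      b x y = al -> b y t = al.
    move=> x0 y0 xy tx ty bxy; have byx := (rev _ _ x0 y0 xy).1 bxy.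
    have [[//]|[byt bty]] : (b y t = al /\ b t y = be) \/ (b y t = be /\ b t y
      = al).
      by apply: normalized_cases => //; rewrite eq_sym.
    have u3 : uniq [:: x; t; y] by rewrite /= !inE negb_or xy ty eq_sym tx.
    have u3' : uniq [:: t; x; y] by rewrite /= !inE negb_or xy ty tx.
    have xt : x != t by rewrite eq_sym.
    have [[bxt btx]|[bxt btx]] := normalized_cases x0 t0 xt.
      have := not_transitive _ _ _ x0 t0 y0 u3 bxt bty.
      by rewrite bxy => /eqP; rewrite (negbTE al_be).
    have := not_transitive _ _ _ t0 x0 y0 u3' btx bxy.
    by rewrite bty => /eqP; rewrite (negbTE al_be).
  have bvt := step u v u0 v0 uv tu tv buv;
    have bwt := step v w v0 w0 vw tv tw bvw.
  have u4 : uniq [:: v; w; t] by rewrite /= !inE negb_or vw ![_ == t]eq_sym tv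
    tw.
  have := not_transitive _ _ _ v0 w0 t0 u4 bvw bwt.
  by rewrite bvt => /eqP; rewrite (negbTE al_be).
have c3 : cv 3 = p * (al + be) by rewrite al_be_add mulrC divfK.
(* Here [c_3] is read off the cyclic triple [u, v, w] and above off a triangle through [ord0]; the
   two values agree only if [(al - be) ^+ 2 * (al + be) = 0]. *)
have c3' : cv 3 = al ^+ 3 + be ^+ 3.
  rewrite -[cv 3](realizes_cyclic_sum Ac (s := [:: u; v; w])) // cyclic_sum3 //.
    have E x y z : x != ord0 -> y != ord0 -> z != ord0 ->
      A x y * A y z * A z x = b x y * b y z * b z x.
      move=> x0 y0 z0; rewrite /b.
      have -> : A ord0 x * A x y * A y ord0 / p * (A ord0 y * A y z * A z ord0
        / p) *
        (A ord0 z * A z x * A x ord0 / p) = A x y * A y z * A z x *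
         (A ord0 x * A x ord0) * (A ord0 y * A y ord0) * (A ord0 z * A z ord0)
           / p / p / p.
        by ring.
      by rewrite !entry2 1?eq_sym //; field.
    by rewrite !E // buv bvw bwu buw bwv bvu; ring.
  by rewrite /= !inE vw.
have be_al : be = - al.
  have : (al - be) ^+ 2 * (al + be) = 0.
    have -> : (al - be) ^+ 2 * (al + be) = al ^+ 3 + be ^+ 3 - (al * be) * (al
      + be) by ring.
    by rewrite -c3' al_be_mul c3 subrr.
  by move/eqP; rewrite mulf_eq0 (negbTE al_be2) /= addrC addr_eq0 => /eqP.
split=> //; first by rewrite c3 be_al; ring.
by rewrite c4 -/p -al_be_mul be_al; ring.
Qed.

Lemma cvar_cases :
  (exists a b, forall k, (1 < k <= n)%N ->
     cv k = two_valued_cycle_sum a b (cv 1) k)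
  \/ [/\ n = 4, cv 3 = 0 & cv 4 = - 6 * cv 2 ^+ 2].
Proof.
have [tr|ntr] := EM (transitive le); [left | right];
  last exact: cvar_exceptional.
by exists al, be => k; apply: cvar_two_valued.
Qed.

End Classification.

Theorem cvar_classification (K : numFieldType) n (A : 'M[K]_n) c :
  (2 < n)%N -> realizes A c -> (cvar K n 2).@[c] != 0 ->
  (exists a b, forall k, (1 < k <= n)%N -> (cvar K n k).@[c] =
     two_valued_cycle_sum a b (cvar K n 1).@[c] k)
  \/ [/\ n = 4, (cvar K n 3).@[c] = 0
      & (cvar K n 4).@[c] = - 6 * (cvar K n 2).@[c] ^+ 2].
Proof. by case: n A c => [|[|[|n]]] // A c _; apply: cvar_cases. Qed.

(** * Ideals and polynomials vanishing on a set *)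

Local Open Scope classical_set_scope.
Local Open Scope ring_scope.

Section GeneratedIdeals.
Variables (S : comNzRingType) (G : set S).
Implicit Types p q : S.

Lemma ideal_gen0 : ideal_gen G 0.
Proof. by exists [::] => //; rewrite big_nil. Qed.

Lemma ideal_gen_sub : G `<=` ideal_gen G.
Proof.
move=> p Gp; exists [:: (1, p)]; last by rewrite big_seq1 mul1r.
by move=> x; rewrite inE => /eqP->.
Qed.

Lemma ideal_genD p q : ideal_gen G p -> ideal_gen G q -> ideal_gen G (p + q).
Proof.
move=> [s sG ->] [t tG ->]; exists (s ++ t); last by rewrite big_cat.
by move=> x; rewrite mem_cat => /orP[/sG|/tG].
Qed.

Lemma ideal_genM p q : ideal_gen G q -> ideal_gen G (p * q).
Proof.
move=> [s sG ->]; exists [seq (p * x.1, x.2) | x <- s].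
  by move=> _ /mapP[x /sG xs ->].
by rewrite big_map mulr_sumr; apply: eq_bigr => x _; rewrite mulrA.
Qed.

Lemma ideal_genN p : ideal_gen G p -> ideal_gen G (- p).
Proof. by rewrite -mulN1r; apply: ideal_genM. Qed.

Lemma ideal_genB p q : ideal_gen G p -> ideal_gen G q -> ideal_gen G (p - q).
Proof. by move=> Ip Iq; apply/ideal_genD/ideal_genN. Qed.

Lemma ideal_gen_sum (I : Type) (r : seq I) (P : pred I) (F : I -> S) :
  (forall i, P i -> ideal_gen G (F i)) -> ideal_gen G (\sum_(i <- r | P i) F i).
Proof.
by move=> IF; elim/big_ind: _ => //; [exact: ideal_gen0 | exact: ideal_genD].
Qed.

Lemma ideal_gen_min (V : set S) : V 0 -> (forall p q, V p -> V q -> V (p + q))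
  ->
  (forall p q, V q -> V (p * q)) -> G `<=` V -> ideal_gen G `<=` V.
Proof.
move=> V0 VD VM GV _ [s sG ->]; rewrite big_seq; elim/big_ind: _ => // x xs.
exact/VM/GV/sG.
Qed.

Lemma ideal_gen_ker (T : comNzRingType) (f : {rmorphism S -> T}) :
  (forall p, G p -> f p = 0) -> forall p, ideal_gen G p -> f p = 0.
Proof.
move=> Gf; apply: (@ideal_gen_min [set p | f p = 0]) => //=;
  first exact: rmorph0.
  by move=> p q fp fq; rewrite rmorphD /= fp fq addr0.
by move=> p q fq; rewrite rmorphM /= fq mulr0.
Qed.

End GeneratedIdeals.

Lemma ideal_genS (S : comNzRingType) (G H : set S) :
  G `<=` ideal_gen H -> ideal_gen G `<=` ideal_gen H.
Proof.
move=> GH; apply: ideal_gen_min => //; first exact: ideal_gen0.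
  by move=> p q; apply: ideal_genD.
by move=> p q; apply: ideal_genM.
Qed.

Lemma prime_ideal_ker (S : comNzRingType) (T : idomainType) (f : {rmorphism S
  -> T}) :
  prime_ideal [set p | f p = 0].
Proof.
split; last first.
  move=> p q; rewrite !in_setE /= => /eqP; rewrite rmorphM mulf_eq0.
  by move=> /orP[]/eqP fp; apply/orP; [left|right]; rewrite in_setE.
split.
- by rewrite in_setE /= rmorph0.
- by rewrite notin_setE /= rmorph1; apply/eqP/oner_neq0.
move=> a p q; rewrite !in_setE /= => fp fq.
by rewrite rmorphD rmorphM /= fp fq mulr0 addr0.
Qed.

Section MPolyMorphisms.
Variables (K : comNzRingType) (n : nat).

Lemma mpoly_ring_ind (P : {mpoly K[n]} -> Prop) :
  (forall a, P a%:MP) -> (forall i, P 'X_i) ->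
  (forall p q, P p -> P q -> P (p + q)) ->
  (forall p q, P p -> P q -> P (p * q)) -> forall p, P p.
Proof.
move=> PC PX PD PM p; have P0 : P 0 by rewrite -mpolyC0.
rewrite (mpolyE p); elim/big_ind: _ => // m _.
rewrite -mul_mpolyC; apply: (PM) => //; rewrite mpolyXE_id.
elim/big_ind: _; [by rewrite -mpolyC1 | exact: PM |].
move=> i _; elim: (m i) => [|k IHk]; first by rewrite expr0 -mpolyC1.
by rewrite exprS; apply: (PM).
Qed.

Lemma mpoly_morph_eq (T : comNzRingType) (f g : {rmorphism {mpoly K[n]} -> T}) :
  (forall a, f a%:MP = g a%:MP) -> (forall i, f 'X_i = g 'X_i) -> f =1 g.
Proof.
move=> fgC fgX p; elim/mpoly_ring_ind: p => // p q fgp fgq.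
  by rewrite !rmorphD /= fgp fgq.
by rewrite !rmorphM /= fgp fgq.
Qed.

(** Modulo the ideal, [g \o f] fixes the scalars and the variables, hence every polynomial; so [p]
    is congruent to [g (f p) = 0]. *)
Lemma mpoly_retract_ideal (G : set {mpoly K[n]}) (T : comNzRingType)
    (f : {rmorphism {mpoly K[n]} -> T}) (g : {rmorphism T -> {mpoly K[n]}}) :
  (forall a, g (f a%:MP) = a%:MP) ->
  (forall i, ideal_gen G ('X_i - g (f 'X_i))) ->
  forall p, f p = 0 -> ideal_gen G p.
Proof.
move=> gfC gfX p fp; rewrite -[p]subr0 -(rmorph0 g) -fp.
elim/mpoly_ring_ind: p {fp} => // [a|p q Ip Iq|p q Ip Iq].
- by rewrite gfC subrr; apply: ideal_gen0.
- rewrite !rmorphD /= opprD addrACA; exact: ideal_genD.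
rewrite !rmorphM /=.
have -> : p * q - g (f p) * g (f q) = q * (p - g (f p)) + g (f p) * (q - g (f
  q)) by ring.
by apply: ideal_genD; apply: ideal_genM.
Qed.

Lemma ord_cvar (P : {mpoly K[n]} -> Prop) :
  (forall k, (0 < k <= n)%N -> P (cvar K n k)) -> forall i : 'I_n, P 'X_i.
Proof. by move=> H i; have := H i.+1; rewrite /cvar valK; apply;
  apply: ltn_ord. Qed.

Variable T : comNzRingType.
Variables (f : {rmorphism K -> T}) (h : nat -> T).

Definition cvar_morph : {mpoly K[n]} -> T := mmap f (fun i : 'I_n => h i.+1).

HB.instance Definition _ := GRing.RMorphism.on cvar_morph.

Lemma cvar_morphC a : cvar_morph a%:MP = f a.
Proof. exact: mmapC. Qed.

Lemma cvar_morphE k : h 0 = 1 -> (k <= n)%N -> cvar_morph (cvar K n k) = h k.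
Proof.
case: k => [|k] h0 kn; first by rewrite h0; exact: rmorph1.
by rewrite /cvar insubT /= /cvar_morph mmapX mmap1U.
Qed.

End MPolyMorphisms.

Arguments cvar_morph {K} n {T} f h _.

Section PolynomialVanishing.

(** The sequence [h] of roots is left free because skew-symmetric matrices with integer entries
    reach only the values [- k ^+ 2] of [c_2]. *)
Lemma poly_vanish (S : idomainType) (h : nat -> S) (p : {poly S}) :
  injective h -> (forall k, p.[h k] = 0) -> p = 0.
Proof.
move=> hinj ph; apply/eqP/negP => /negP p0.
have := max_poly_roots p0 (rs := map h (iota 0 (size p))).
rewrite size_map size_iota ltnn => H; apply: notF; apply: H.
  by apply/allP => _ /mapP[k _ ->]; apply/eqP.
by rewrite map_inj_uniq ?iota_uniq.
Qed.

Variable K : numFieldType.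

Lemma natr_inj : injective (fun k : nat => k%:R : K).
Proof. exact: mulrIn (oner_neq0 K). Qed.

Lemma poly_vanish1 (p : {poly K}) : (forall x, p.[x] = 0) -> p = 0.
Proof. by move=> H; apply: poly_vanish natr_inj _ => k; apply: H. Qed.

Lemma poly_vanish2 (p : {poly {poly K}}) : (forall x y, p.[y%:P].[x] = 0) -> p
  = 0.
Proof.
move=> H; apply: (poly_vanish (h := fun k => k%:R%:P)).
  by move=> i j /polyC_inj/natr_inj.
by move=> k; apply: poly_vanish1 => x; apply: H.
Qed.

Lemma poly_vanish3 (p : {poly {poly {poly K}}}) :
  (forall x y z, p.[z%:P%:P].[y%:P].[x] = 0) -> p = 0.
Proof.
move=> H; apply: (poly_vanish (h := fun k => k%:R%:P%:P)).
  by move=> i j /polyC_inj/polyC_inj/natr_inj.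
by move=> k; apply: poly_vanish2 => x y; apply: H.
Qed.

End PolynomialVanishing.

Section SymmetrizedPoints.
Variables (K : comNzRingType) (n : nat).

Lemma symmetrized_pointsE (Q : set 'M[K]_n) c :
  symmetrized_points (@cycle_sums K n @` Q) c <-> exists2 A, Q A & realizes A c.
Proof.
split=> [[v [[A QA <-] sv] vc]|[A QA Ac]].
  exists A => // I; case E : #|I| => [|k].
    have -> : I = finset.set0 by apply/eqP; rewrite -cards_eq0 E.
    by rewrite /cycle_sum finset.enum_set0 meval_cvar0.
  have kn : (k < n)%N by rewrite -E -[X in (_ <= X)%N]card_ord max_card.
  by rewrite (meval_cvarS c (Ordinal kn)); apply: (vc (Ordinal kn)).
exists (cycle_sums A).
  split; first by exists A.
  by move=> I I' II'; rewrite /cycle_sums !Ac II'.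
by move=> k I Ik; rewrite /cycle_sums Ac Ik meval_cvarS.
Qed.

Lemma JE p : J K n p <-> forall A c, realizes A c -> p.@[c] = 0.
Proof.
split=> [Jp A c Ac|H c].
  by apply: Jp; apply/symmetrized_pointsE; exists A.
by move=> /symmetrized_pointsE[A _ Ac]; apply: H Ac.
Qed.

Lemma JsymE p : Jsym K n p <-> forall A c, A^T = A -> realizes A c -> p.@[c] =
  0.
Proof.
split=> [Jp A c AT Ac|H c].
  by apply: Jp; apply/symmetrized_pointsE; exists A.
by move=> /symmetrized_pointsE[A AT Ac]; apply: H Ac.
Qed.

Lemma JskewE p : Jskew K n p <-> forall A c, A^T = - A -> realizes A c ->
  p.@[c] = 0.
Proof.
split=> [Jp A c AT Ac|H c].
  by apply: Jp; apply/symmetrized_pointsE; exists A.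
by move=> /symmetrized_pointsE[A AT Ac]; apply: H Ac.
Qed.

Lemma meval_cvar (h : nat -> K) k : h 0 = 1 -> (k <= n)%N ->
  (cvar K n k).@[fun i => h i.+1] = h k.
Proof.
case: k => [|k] h0 kn; first by rewrite h0 meval_cvar0.
by rewrite /cvar insubT /= mevalXU.
Qed.

Lemma realizes_two_valued (a b x : K) :
  realizes (two_valued_mx n a b x) (fun i => two_valued_cycle_sum a b x i.+1).
Proof.
move=> I; rewrite cycle_sum_two_valued (meval_cvar (h := two_valued_cycle_sum a
  b x)) //.
by rewrite -[X in (_ <= X)%N]card_ord max_card.
Qed.

End SymmetrizedPoints.

(** * Skew-symmetric matrices *)

Lemma ideal_eq_ker (S : comNzRingType) (T : idomainType) (f : {rmorphism S ->
  T})
    (I J : set S) :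
  I `<=` J -> (forall p, J p -> f p = 0) -> (forall p, f p = 0 -> I p) ->
  J = I /\ prime_ideal J.
Proof.
move=> IJ Jf fI; have -> : J = [set p | f p = 0].
  by apply/seteqP; split=> [p /Jf|p /fI/IJ].
split; last exact: prime_ideal_ker.
by apply/seteqP; split=> [p /fI|p /IJ/Jf].
Qed.

Section EvaluatePolynomials.
Variables (K : comNzRingType) (n : nat).

Definition subst_poly (u : {mpoly K[n]}) : {poly K} -> {mpoly K[n]} :=
  horner_eval u \o map_poly (@mpolyC n K).
HB.instance Definition _ u := GRing.RMorphism.copy (subst_poly u)
  (horner_eval u \o map_poly (@mpolyC n K)).

Lemma subst_polyC u a : subst_poly u a%:P = a%:MP.
Proof. by rewrite /subst_poly /= map_polyC /horner_eval hornerC. Qed.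

Lemma subst_polyX u : subst_poly u 'X = u.
Proof. by rewrite /subst_poly /= map_polyX /horner_eval hornerX. Qed.

Definition subst_poly2 (u v : {mpoly K[n]}) : {poly {poly K}} -> {mpoly K[n]} :=
  horner_eval v \o map_poly (subst_poly u).
HB.instance Definition _ u v := GRing.RMorphism.copy (subst_poly2 u v)
  (horner_eval v \o map_poly (subst_poly u)).

Lemma subst_poly2C u v q : subst_poly2 u v q%:P = subst_poly u q.
Proof. by rewrite /subst_poly2 /= map_polyC /horner_eval hornerC. Qed.

Lemma subst_poly2X u v : subst_poly2 u v 'X = v.
Proof. by rewrite /subst_poly2 /= map_polyX /horner_eval hornerX. Qed.

End EvaluatePolynomials.

Section SkewSymmetric.
Variable K : numFieldType.

(** For [b = - a] the linear term of [two_valued_cycle_sumSS] drops out, and what remains is the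
    recurrence [alt_sumS] of the tangent numbers. *)
Lemma two_valued_cycle_sum_skew (x : K) m :
  two_valued_cycle_sum x (- x) 0 m =
  if odd m then 0 else alt_sum K m.-1 * (- x ^+ 2) ^+ m./2.
Proof.
elim/ltn_ind: m => -[|[|[|m]]] IHm.
- by rewrite /= /alt_sum /psum big_seq1 mulr1.
- by [].
- by rewrite /= eulerian1 alt_sum1; ring.
rewrite two_valued_cycle_sumSS // subrr mul0r add0r.
rewrite (eq_big_nat _ _ (F2 := fun j => if odd m.+1 then 0 else
    ('C(m.+1, j))%:R * ((odd j)%:R * alt_sum K j * alt_sum K (m.+1 - j)) *
     (- x ^+ 2) ^+ m.+3./2)).
  have -> : odd m.+3 = odd m.+1 by rewrite /= negbK.
  case: (boolP (odd m.+1)) => om; first by rewrite big1.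
  by rewrite -big_distrl -alt_sumS.
move=> j /andP[j1 jm]; rewrite (IHm j.+1) ?(IHm (m.+1 - j).+1) ?ltnS; try lia.
rewrite !oddS oddB; last by lia.
rewrite oddS; case: (boolP (odd m)) => om; case: (boolP (odd j)) => oj /=;
  rewrite ?(mul0r, mulr0) //.
have -> : (uphalf m).+1 = (uphalf j + uphalf (m.+1 - j))%N by lia.
by rewrite exprD /=; ring.
Qed.

(** The variable stands for [c_2 = - x ^+ 2], not for the entry [x]; sending it back to [c_2] gives
    the retraction needed to compute the kernel. *)
Definition skew_poly m : {poly K} :=
  if odd m then 0 else alt_sum K m.-1 *: 'X^(m./2).

Lemma skew_poly0 : skew_poly 0 = 1.
Proof. by rewrite /skew_poly /= /alt_sum /psum big_seq1 scale1r. Qed.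

Lemma horner_skew_poly m x : (skew_poly m).[- x ^+ 2] = two_valued_cycle_sum x
  (- x) 0 m.
Proof.
rewrite two_valued_cycle_sum_skew /skew_poly; case: ifP => _;
  first by rewrite horner0.
by rewrite hornerZ hornerXn.
Qed.

Lemma cyclic_sum_diag0 n (A : 'M[K]_n) s : (forall x y, x != y -> A x y = 0) ->
  uniq s -> (1 < size s)%N -> cyclic_sum A s = 0.
Proof.
move=> A0 us s1; rewrite (eq_cyclic_sum (w' := fun _ _ => 0)) //; last first.
  by move=> x y _ _; apply: A0.
case: s us s1 => [|x [|y s]] // _ _; rewrite /cyclic_sum /psum big1 // => p _.
by case: p => [|z p] /=; rewrite mul0r.
Qed.

Lemma ord_seq n k : (k <= n)%N -> exists2 s : seq 'I_n, uniq s & size s = k.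
Proof.
move=> kn; exists (take k (enum 'I_n)); first by rewrite take_uniq ?enum_uniq.
by rewrite size_takel // size_enum_ord.
Qed.

Lemma ord_pair n (x y : 'I_n) : x != y -> uniq [:: x; y].
Proof. by move=> xy; rewrite /= inE xy. Qed.

(** If [c_2 = 0], then every off-diagonal entry has square 0. Otherwise skew-symmetry gives
    [c_3 = 0], which in the two-valued case reads [a * b * (a + b) = 0] and forces [b = - a]. *)
Lemma skew_points n (A : 'M[K]_n) c : (2 < n)%N -> A^T = - A -> realizes A c ->
  (forall k, (k <= n)%N -> (cvar K n k).@[c] = (skew_poly k).[(cvar K n
    2).@[c]])
  \/ [/\ n = 4, (cvar K n 1).@[c] = 0, (cvar K n 3).@[c] = 0
       & (cvar K n 4).@[c] = - 6 * (cvar K n 2).@[c] ^+ 2].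
Proof.
move=> n2 /matrixP AT Ac; set cv := fun k => (cvar K n k).@[c].
have As x y : A y x = - A x y by have := AT x y; rewrite !mxE.
have c1 : cv 1 = 0.
  have [[|x []] // us ss] := ord_seq (ltnW (ltnW n2)).
  rewrite -[cv 1](realizes_cyclic_sum Ac us) cyclic_sum1.
  by apply/eqP; have /eqP := As x x; rewrite -addr_eq0 -mulr2n mulrn_eq0.
have c3 : cv 3 = 0.
  have [[|x [|y [|z []]]] // us ss] := ord_seq n2.
  rewrite -[cv 3](realizes_cyclic_sum Ac us) cyclic_sum3; last by case/andP: us.
  by rewrite (As x y) (As x z) (As y z); ring.
have [c2|c2] := eqVneq (cv 2) 0.
  left=> k kn; case: (k) kn => [|[|k']] kn;
    rewrite -![(cvar _ _ _).@[_]]/(cv _).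
  - by rewrite skew_poly0 hornerC /cv meval_cvar0.
  - by rewrite c1 /skew_poly horner0.
  have [s us ss] := ord_seq kn.
  have -> : cv k'.+2 = cyclic_sum A s by rewrite (realizes_cyclic_sum Ac us) ss.
  rewrite cyclic_sum_diag0 ?ss //.
    rewrite c2 /skew_poly; case: ifP => _; first by rewrite horner0.
    by rewrite hornerZ hornerXn /= expr0n mulr0.
  move=> x y xy; have := realizes_cyclic_sum Ac (ord_pair xy).
  rewrite -/(cv _) c2 cyclic_sum2 (As x y) mulrN => /eqP.
  by rewrite oppr_eq0 mulf_eq0 orbb => /eqP.
have [[a [b tv]]|[]] := cvar_classification n2 Ac c2; last by right.
left=> k kn; rewrite -![(cvar _ _ _).@[_]]/(cv _).
have E2 : cv 2 = a * b by rewrite /cv tv ?(ltnW n2) //= eulerian1 mulr1.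
have ba : b = - a.
  have := tv 3; rewrite n2 => /(_ isT);
    rewrite -/(cv _) c3 two_valued_cycle_sumSS //.
  rewrite big_geq // addr0 /= eulerian1 mulr1 -E2 => /esym/eqP.
  by rewrite mulf_eq0 (negbTE c2) orbF addrC addr_eq0 => /eqP.
have -> : cv 2 = - a ^+ 2 by rewrite E2 ba mulrN.
rewrite horner_skew_poly; case: (ltnP 1 k) => k1.
  by rewrite [LHS]tv ?k1 // -/(cv _) c1 ba.
case: (k) k1 => [|[|//]] _; last by rewrite c1.
by rewrite /cv meval_cvar0.
Qed.

Definition skew_morph n : {rmorphism {mpoly K[n]} -> {poly K}} :=
  cvar_morph n (@polyC K) skew_poly.

Lemma cvar_morph_horner n (f : nat -> {poly K}) (c : 'I_n -> K) x p : f 0 = 1 ->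
  (forall k, (k <= n)%N -> (cvar K n k).@[c] = (f k).[x]) ->
  (cvar_morph n (@polyC K) f p).[x] = p.@[c].
Proof.
move=> f0 fc; move: p.
pose g : {rmorphism _ -> _} := horner_eval x \o cvar_morph n (@polyC K) f.
apply: (@mpoly_morph_eq _ _ _ g (meval c)) => [a|].
  by rewrite /g /= cvar_morphC /horner_eval hornerC mevalC.
apply: (ord_cvar (P := fun q => g q = q.@[c])) => k /andP[k0 kn].
by rewrite /g /= cvar_morphE // /horner_eval fc.
Qed.

Lemma neg_sqr_inj : injective (fun k : nat => - (k%:R ^+ 2) : K).
Proof.
move=> i j /oppr_inj; rewrite -!natrX => /natr_inj/eqP.
by rewrite eqn_exp2r // => /eqP.
Qed.

Lemma Jskew_sub_ker n p : Jskew K n p -> skew_morph n p = 0.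
Proof.
move=> /JskewE Jp; apply: poly_vanish neg_sqr_inj _ => k.
rewrite (cvar_morph_horner (c := fun i => two_valued_cycle_sum k%:R (- k%:R) 0
  i.+1)).
- apply: (Jp (two_valued_mx n k%:R (- k%:R) 0));
  last exact: realizes_two_valued.
  apply/matrixP => i j; rewrite !mxE eq_sym; case: eqVneq => [_|];
    first by rewrite oppr0.
  by rewrite -val_eqE /step_weight /=; case: ltngtP => //; rewrite opprK.
- exact: skew_poly0.
move=> m mn; rewrite horner_skew_poly.
by rewrite (meval_cvar (h := two_valued_cycle_sum k%:R (- k%:R) 0)).
Qed.

Lemma cvar_morph_ker_ideal n (G : set {mpoly K[n]}) (f : nat -> {poly K}) : f 0
  = 1 ->
  (forall k, (0 < k <= n)%N -> ideal_gen G (cvar K n k - subst_poly (cvar K n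
    2) (f k))) ->
  forall p, cvar_morph n (@polyC K) f p = 0 -> ideal_gen G p.
Proof.
move=> f0 Gf; apply: (mpoly_retract_ideal (g := subst_poly (cvar K n 2))) =>
  [a|].
  by rewrite /= cvar_morphC subst_polyC.
apply: (ord_cvar (P := fun q => ideal_gen G
   (q - subst_poly (cvar K n 2) (cvar_morph n (@polyC K) f q)))) => k kn.
have /andP[k0 kn'] := kn.
by rewrite /= cvar_morphE //; apply: Gf.
Qed.

Lemma subst_skew_poly n k : subst_poly (cvar K n 2) (skew_poly k) =
  if odd k then 0 else (alt_sum K k.-1)%:MP * cvar K n 2 ^+ k./2.
Proof.
rewrite /skew_poly; case: ifP => _; first by rewrite rmorph0.
by rewrite -mul_polyC rmorphM /= subst_polyC rmorphXn /= subst_polyX.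
Qed.

Lemma skew_vanish n A c p : (2 < n)%N -> n != 4 -> A^T = - A -> realizes A c ->
  skew_morph n p = 0 -> p.@[c] = 0.
Proof.
move=> n2 n4 AT Ac fp; have [H|[]] := skew_points n2 AT Ac;
  last by move/eqP: n4.
by rewrite -(cvar_morph_horner p skew_poly0 H) [cvar_morph _ _ _ _]fp horner0.
Qed.

Lemma alt_sum3 : alt_sum K 3 = 2.
Proof. by rewrite alt_sumS // big_nat1 -[(2 - 1)%N]/1%N alt_sum1 bin1 /=
  !mulr1. Qed.

Lemma alt_sum_ge0 m : 0 <= alt_sum K m.
Proof. by rewrite alt_sum_euler_number ler0n. Qed.

(** The summand [j = 1] of the recurrence is already positive. [Jskew_ge5] divides by these
    numbers. *)
Lemma alt_sum_gt0 j : 0 < alt_sum K j.*2.+1.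
Proof.
elim: j => [|j IHj]; first by rewrite alt_sum1 ltr01.
rewrite alt_sumS ?odd_double // doubleS big_ltn //.
rewrite ltr_wpDr //; last first.
  rewrite mulr_gt0 ?ltr0n ?bin_gt0 // alt_sum1 !mul1r.
  by rewrite subSS subn0.
by apply: sumr_ge0 => i _; rewrite !mulr_ge0 ?ler0n ?alt_sum_ge0.
Qed.

Lemma Jskew3 : Jskew K 3 = ideal_gen [set 'c_1; 'c_3].
Proof.
apply: (proj1 (ideal_eq_ker (f := skew_morph 3) _ _ _)).
- move=> p Ip; apply/JskewE => A c AT Ac; apply: skew_vanish AT Ac _ => //.
  apply: (ideal_gen_ker _ Ip) => q [] ->; exact: cvar_morphE skew_poly0 _.
- exact: Jskew_sub_ker.
apply: cvar_morph_ker_ideal skew_poly0 _ => k; rewrite subst_skew_poly.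
case: k => [|[|[|[|]]]] //= _; rewrite ?subr0.
- by apply: ideal_gen_sub; left.
- by rewrite alt_sum1 mul1r expr1 subrr; apply: ideal_gen0.
- by apply: ideal_gen_sub; right.
Qed.

Lemma Jskew_ge5 n : (5 <= n)%N ->
  let E := fun m => (euler_number m)%:R : {mpoly K[n]} in
  Jskew K n =
    ideal_gen
      ([set p | exists2 k : nat, (1 <= k <= uphalf n)%N &
          p = 'c_(2 * k - 1)] `|`
       [set p | exists i j : nat,
          [/\ (1 <= i)%N, (i <= j)%N, (2 * (i + j) <= n)%N &
           p = E (2 * (i + j) - 1)%N * ('c_(2 * i) * 'c_(2 * j))
               - E (2 * i - 1)%N * E (2 * j - 1)%N * 'c_(2 * (i + j))]])
  /\ prime_ideal (Jskew K n).
Proof.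
move=> n5 E; set G := (X in ideal_gen X).
have EE k : E k = (alt_sum K k)%:MP by rewrite /E alt_sum_euler_number
  rmorph_nat.
apply: (@ideal_eq_ker _ _ (skew_morph n)); last 2 first.
- exact: Jskew_sub_ker.
- apply: cvar_morph_ker_ideal skew_poly0 _ => k; rewrite subst_skew_poly.
  case: ifP => ok /andP[k0 kn].
    rewrite subr0; apply: ideal_gen_sub; left; exists k.+1./2; first lia.
    by congr cvar; lia.
  have -> : k = (2 * k./2)%N by lia.
  have : (0 < k./2)%N by lia.
  have : (2 * k./2 <= n)%N by lia.
  elim: (k./2) => [//|[|j] IHj] jn _.
    by rewrite alt_sum1 mul1r subrr; apply: ideal_gen0.
  (* The relation with [i = 1] expresses [c_(2(j+2))] through [c_2 * c_(2(j+1))], so inductively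
     each even variable becomes a multiple of a power of [c_2]. *)
  have H : ideal_gen G (E (2 * (1 + j.+1) - 1)%N * ('c_(2 * 1) * 'c_(2 * j.+1))
     - E (2 * 1 - 1)%N * E (2 * j.+1 - 1)%N * 'c_(2 * (1 + j.+1))).
    by apply: ideal_gen_sub; right; exists 1%N, j.+1; split.
  have a0 : alt_sum K (2 * j.+1 - 1) != 0.
    by rewrite lt0r_neq0 // (_ : (_ - 1 = j.*2.+1)%N) ?alt_sum_gt0 //; lia.
  move: H; rewrite !EE muln1 -[(2 - 1)%N]/1%N alt_sum1 mul1r.
  set x := 'c_2; set y := 'c_(2 * j.+1); set z := 'c_(2 * (1 + j.+1)).
  move=> /(ideal_genM (alt_sum K (2 * j.+1 - 1))^-1%:MP) H.
  have jn' : (2 * j.+1 <= n)%N by lia.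
  have /(ideal_genM ((alt_sum K (2 * j.+1 - 1))^-1%:MP *
    (alt_sum K (2 * (1 + j.+1) - 1))%:MP * x)) H' := IHj jn' isT.
  have -> : (2 * j.+2 = 2 * (1 + j.+1))%N by lia.
  move: (ideal_genB H' H); congr (ideal_gen G _).
  rewrite -/y -/z -[(2 * j.+1).-1]subn1 -[(2 * (1 + j.+1)).-1]subn1.
  have aa : (alt_sum K (2 * j.+1 - 1))^-1%:MP * (alt_sum K (2 * j.+1 - 1))%:MP
    = 1 :> {mpoly K[n]}.
    by rewrite -mpolyCM mulVf.
  move: aa; set u := _^-1%:MP; set v := (alt_sum K (2 * j.+1 - 1))%:MP => uv.
  set w := (alt_sum K (2 * (1 + j.+1) - 1))%:MP.
  rewrite !mul2n !doubleK add1n -/x.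
  transitivity ((u * v) * (z - w * x ^+ j.+2)); last by rewrite uv mul1r.
  rewrite [x ^+ j.+2]exprS; ring.
move=> p Ip; apply/JskewE => A c AT Ac; apply: skew_vanish AT Ac _; [lia|lia|].
apply: (ideal_gen_ker _ Ip) => q [[k kn ->]|[i [j [i1 ij ijn ->]]]].
  rewrite [LHS](cvar_morphE _ skew_poly0); last lia.
  by rewrite /skew_poly ifT //; lia.
rewrite rmorphB !rmorphM /= !EE !cvar_morphC !(cvar_morphE _ skew_poly0) //;
  try lia.
rewrite !mul2n /skew_poly !odd_double !doubleK -!mul_polyC !subn1 exprD; ring.
Qed.

End SkewSymmetric.

(** * The exceptional matrices of size four *)

Section ExceptionalPoint.
Variable K : comNzRingType.

(* The tournament in which [0] beats the 3-cycle [1 -> 2 -> 3 -> 1]. *)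
Definition exceptional_sign (i j : nat) : K :=
  if (i < j)%N (+) ((minn i j == 1%N) && (maxn i j == 3%N)) then 1 else -1.

Definition exceptional_mx (a c : K) : 'M[K]_4 :=
  \matrix_(i, j) if i == j then c else exceptional_sign i j * a.

Definition exceptional_cycle_sum (a c : K) (k : nat) : K :=
  nth 0 [:: 1; c; - a ^+ 2; 0; - 6 * a ^+ 4] k.

Lemma exceptional_mx_skew a c i j : i != j ->
  exceptional_mx a c j i = - exceptional_mx a c i j.
Proof.
move=> ij; rewrite !mxE eq_sym (negbTE ij) /exceptional_sign minnC maxnC.
by case: ltngtP (ij : i != j :> nat) => //= _ _; case: andb => /=; ring.
Qed.

Lemma realizes_exceptional a c :
  realizes (exceptional_mx a c) (fun i => exceptional_cycle_sum a c i.+1).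
Proof.
move=> I; set A := exceptional_mx a c.
have IE : (#|I| <= 4)%N by rewrite -[X in (_ <= X)%N]card_ord max_card.
rewrite (meval_cvar (h := exceptional_cycle_sum a c)) //.
rewrite (cycle_sumE _ (perm_refl _)) cardE; rewrite cardE in IE.
move: IE (enum_uniq I); case: (enum I) => [|x [|y [|z [|t [|//]]]]] _ //.
- by rewrite cyclic_sum1 mxE eqxx.
- move=> u; have xy : x != y by move: u; rewrite /= inE andbT.
  rewrite cyclic_sum2 (exceptional_mx_skew _ _ xy) !mxE (negbTE xy).
  by rewrite /exceptional_sign /exceptional_cycle_sum /=; case: addb; ring.
- move=> u; rewrite cyclic_sum3; last by case/andP: u.
  have /and3P[/andP[xy xz] yz _] : [&& (x != y) && (x != z), y != z & true].
    by move: u; rewrite /= !inE negb_or.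
  rewrite (exceptional_mx_skew _ _ xy) (exceptional_mx_skew _ _ xz)
    (exceptional_mx_skew _ _ yz).
  by rewrite /exceptional_cycle_sum /=; ring.
(* A set of four indices is the whole index set; listing it explicitly leaves six 4-cycles to
   evaluate. *)
move=> u; pose s := [seq inord i | i <- [:: 0; 1; 2; 3]%N] : seq 'I_4.
have us : uniq s by rewrite map_inj_in_uniq // => i j;
  rewrite !inE => /or4P[]/eqP-> /or4P[]/eqP-> // /(congr1 val) /=;
  rewrite !inordK.
have full (r : seq 'I_4) : uniq r -> size r = 4 -> r =i enum 'I_4.
  move=> ur sr; apply: (uniq_min_size ur _ _).2; first by move=> i _;
    rewrite mem_enum.
  by rewrite size_enum_ord sr.
rewrite (@cyclic_sum_perm _ _ _ _ s) //; last first.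
  by apply: uniq_perm => // i; rewrite !full.
rewrite cyclic_sum4; last by case/andP: us.
rewrite !mxE -!val_eqE /= !inordK // /exceptional_sign /exceptional_cycle_sum
  /=; ring.
Qed.

End ExceptionalPoint.

Section SkewFour.
Variable K : numFieldType.

Lemma decompose_kernels (S : comNzRingType) (T1 T2 : idomainType)
    (f1 : {rmorphism S -> T1}) (f2 : {rmorphism S -> T2}) (I I1 I2 : set S) :
  (forall p, I1 p <-> f1 p = 0) -> (forall p, I2 p <-> f2 p = 0) ->
  (forall p, I p <-> I1 p /\ I2 p) ->
  (exists2 p, I1 p & f2 p != 0) -> (exists2 p, I2 p & f1 p != 0) ->
  decomposes_into_primes I I1 I2.
Proof.
move=> E1 E2 E [p1 p1I1 p1f2] [p2 p2I2 p2f1].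
have F1 : I1 = [set p | f1 p = 0] by apply/seteqP; split=> p /E1.
have F2 : I2 = [set p | f2 p = 0] by apply/seteqP; split=> p /E2.
split.
- by apply/seteqP; split=> p /E.
- by rewrite F1; apply: prime_ideal_ker.
- by rewrite F2; apply: prime_ideal_ker.
- by move=> /(_ p1 p1I1)/E2/eqP; rewrite (negbTE p1f2).
- by move=> /(_ p2 p2I2)/E1/eqP; rewrite (negbTE p2f1).
Qed.

Definition exceptional_skew_poly (k : nat) : {poly K} :=
  nth 0 [:: 1; 0; 'X; 0; - 6 *: 'X ^+ 2] k.

(** Both families of points are parametrized by [c_2], and each component is the kernel of one
    parametrization. The first generators tell them apart: each takes the value [8] or [- 8] times
    ['X ^+ 2] on the other family. *)
Lemma Jskew4 : decomposes_into_primes (Jskew K 4)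
  (ideal_gen [set - 2 * 'c_2 ^+ 2 + 'c_4; 'c_1; 'c_3])
  (ideal_gen [set 6 * 'c_2 ^+ 2 + 'c_4; 'c_1; 'c_3]).
Proof.
set I1 := ideal_gen _; set I2 := ideal_gen _.
pose f2 := cvar_morph 4 (@polyC K) exceptional_skew_poly.
have s0 := skew_poly0 K.
have E1 p : I1 p <-> skew_morph K 4 p = 0.
  split=> [I1p|].
    apply: (ideal_gen_ker _ I1p) => q [[->|->]|->].
    - rewrite rmorphD rmorphM rmorphXn rmorphN rmorph_nat /= !(cvar_morphE _
      s0) //.
      rewrite /skew_poly /= alt_sum1 alt_sum3 !scale1r -mul_polyC rmorph_nat;
        ring.
    - by rewrite /= (cvar_morphE _ s0).
    - by rewrite /= (cvar_morphE _ s0).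
  apply: cvar_morph_ker_ideal s0 _ p => k; rewrite subst_skew_poly.
  case: k => [|[|[|[|[|]]]]] //= _; rewrite ?subr0.
  - by apply: ideal_gen_sub; left; right.
  - by rewrite alt_sum1 mul1r expr1 subrr; apply: ideal_gen0.
  - by apply: ideal_gen_sub; right.
  - apply: ideal_gen_sub; left; left; rewrite alt_sum3 rmorph_nat; ring.
have E2 p : I2 p <-> f2 p = 0.
  split=> [I2p|].
    apply: (ideal_gen_ker _ I2p) => q [[->|->]|->].
    - rewrite rmorphD rmorphM rmorphXn rmorph_nat /= !cvar_morphE //.
      rewrite /exceptional_skew_poly /= -mul_polyC rmorphN rmorph_nat; ring.
    - by rewrite /= cvar_morphE.
    - by rewrite /= cvar_morphE.
  apply: (cvar_morph_ker_ideal (f := exceptional_skew_poly) (erefl _)) => k.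
  case: k => [|[|[|[|[|]]]]] //= _;
    rewrite /exceptional_skew_poly /= ?rmorph0 ?subr0.
  - by apply: ideal_gen_sub; left; right.
  - by rewrite subst_polyX subrr; apply: ideal_gen0.
  - by apply: ideal_gen_sub; right.
  - apply: ideal_gen_sub; left; left;
    rewrite -mul_polyC rmorphM rmorphXn /= subst_polyX subst_polyC.
    rewrite rmorphN rmorph_nat; ring.
apply: (decompose_kernels (f1 := skew_morph K 4) (f2 := f2)) => // [p||].
- split=> [Jp|[I1p I2p]].
    split; first by apply/E1/Jskew_sub_ker.
    apply/E2; apply: poly_vanish (@neg_sqr_inj K) _ => k.
    rewrite /f2 (cvar_morph_horner (c := fun i => exceptional_cycle_sum k%:R 0
      i.+1)) //.
      move/JskewE: Jp => /(_ (exceptional_mx k%:R 0)); apply;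
        last exact: realizes_exceptional.
      apply/matrixP => i j; rewrite mxE [RHS]mxE; case: (eqVneq i j) => [->|ij].
        by rewrite mxE eqxx oppr0.
      exact: exceptional_mx_skew.
    move=> m mn; rewrite (meval_cvar (h := exceptional_cycle_sum k%:R 0)) //.
    case: m mn => [|[|[|[|[|]]]]] //= _;
      rewrite /exceptional_skew_poly /exceptional_cycle_sum /= ?hornerC
      ?hornerX ?hornerZ ?hornerXn //; ring.
  apply/JskewE => A c AT Ac; have [H|[_ c1 c3 c4]] := skew_points (isT : (2 <
    4)%N) AT Ac.
    by rewrite -(cvar_morph_horner p s0 H) [cvar_morph _ _ _ _](E1 p).1 //
      horner0.
  rewrite -(@cvar_morph_horner _ 4 exceptional_skew_poly c (cvar K 4 2).@[c] p)
    //.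
    by rewrite [cvar_morph _ _ _ _](E2 p).1 // horner0.
  case=> [|[|[|[|[|]]]]] //= _; rewrite /exceptional_skew_poly /= ?hornerC
    ?hornerX ?hornerZ ?hornerXn ?c1 ?c3 ?c4 //.
  exact: meval_cvar0.
- exists (- 2 * 'c_2 ^+ 2 + 'c_4); first by apply: ideal_gen_sub; left; left.
  rewrite rmorphD rmorphM rmorphXn rmorphN rmorph_nat /= /f2 !cvar_morphE //.
  have -> : - 2 * exceptional_skew_poly 2 ^+ 2 + exceptional_skew_poly 4 = (- 8
    : K) *: 'X ^+ 2.
    by rewrite /exceptional_skew_poly /= -!mul_polyC !rmorphN !rmorph_nat; ring.
  by rewrite scaler_eq0 oppr_eq0 pnatr_eq0 expf_eq0 polyX_eq0.
exists (6 * 'c_2 ^+ 2 + 'c_4); first by apply: ideal_gen_sub; left; left.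
rewrite rmorphD rmorphM rmorphXn rmorph_nat /= !(cvar_morphE _ s0) //.
have -> : 6 * skew_poly K 2 ^+ 2 + skew_poly K 4 = (8 : K) *: 'X ^+ 2.
  by rewrite /skew_poly /= alt_sum1 alt_sum3 !scale1r -!mul_polyC !rmorph_nat;
    ring.
by rewrite scaler_eq0 pnatr_eq0 expf_eq0 polyX_eq0.
Qed.

End SkewFour.

(** * Symmetric matrices *)

Section Symmetric.
Variable K : numFieldType.

Definition sym_cycle_sum (a c : K) (k : nat) : K :=
  match k with 0 => 1 | 1 => c | _ => (k.-1)`!%:R * a ^+ k end.

Lemma two_valued_cycle_sum_sym (a c : K) k :
  two_valued_cycle_sum a a c k = sym_cycle_sum a c k.
Proof. by case: k => [|[|k]] //=; rewrite eulerian_const !exprS; ring. Qed.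

(** Each off-diagonal entry has square [c_2], whence [c_3 ^+ 2 = 4 * c_2 ^+ 3]. This excludes the
    exceptional case, where [c_3 = 0], and forces [a = b], since the difference of the two sides is
    [(a * b) ^+ 2 * (a - b) ^+ 2]. *)
Lemma sym_points n (A : 'M[K]_n) c : (2 < n)%N -> A^T = A -> realizes A c ->
  exists a, forall k, (k <= n)%N ->
    (cvar K n k).@[c] = sym_cycle_sum a (cvar K n 1).@[c] k.
Proof.
move=> n2 /matrixP AT Ac; set cv := fun k => (cvar K n k).@[c].
have As x y : A y x = A x y by have := AT x y; rewrite !mxE.
have A2 x y : x != y -> A x y ^+ 2 = cv 2.
  move=> xy; rewrite -[cv 2](realizes_cyclic_sum Ac (ord_pair xy)) cyclic_sum2.
  by rewrite (As x y) expr2.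
have c3 : cv 3 ^+ 2 = 4 * cv 2 ^+ 3.
  have [[|x [|y [|z []]]] // us ss] := ord_seq n2.
  rewrite -[cv 3](realizes_cyclic_sum Ac us) cyclic_sum3; last by case/andP: us.
  rewrite (As x y) (As x z) (As y z).
  have /and3P[/andP[xy xz] yz _] : [&& (x != y) && (x != z), y != z & true].
    by move: us; rewrite /= !inE negb_or.
  transitivity (4 * (A x y ^+ 2 * A x z ^+ 2 * A y z ^+ 2)); first by ring.
  by rewrite !A2 //; ring.
suff [a Ha] : exists a, forall k, (1 < k <= n)%N -> cv k = sym_cycle_sum a (cv
  1) k.
  exists a => -[|[|k]] kn //; first exact: meval_cvar0.
  by rewrite -/(cv _) Ha.
have [c2|c2] := eqVneq (cv 2) 0.
  exists 0 => k /andP[k1 kn]; have [s us ss] := ord_seq kn.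
  have -> : cv k = cyclic_sum A s by rewrite (realizes_cyclic_sum Ac us) ss.
  rewrite cyclic_sum_diag0 ?ss //.
    by case: k k1 {kn ss} => [|[|k]] // _; rewrite /sym_cycle_sum expr0n mulr0.
  by move=> x y /A2/eqP; rewrite c2 expf_eq0 => /eqP.
have [[a [b tv]]|[_ c30]] := cvar_classification n2 Ac c2; last first.
  by move: c3; rewrite /cv c30 expr0n => /esym/eqP;
    rewrite mulf_eq0 pnatr_eq0 expf_eq0 -/(cv 2) (negbTE c2).
have E2 : cv 2 = a * b by rewrite /cv tv ?(ltnW n2) //= eulerian1 mulr1.
have E3 : cv 3 = (a + b) * (a * b).
  rewrite /cv tv ?n2 // two_valued_cycle_sumSS // big_geq // addr0 /=
    eulerian1; ring.
have ab : a = b.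
  move: c3; rewrite E3 E2 => /eqP; rewrite -subr_eq0.
  have -> : ((a + b) * (a * b)) ^+ 2 - 4 * (a * b) ^+ 3 = (a * b) ^+ 2 * (a -
    b) ^+ 2 by ring.
  by rewrite mulf_eq0 !expf_eq0 /= -E2 (negbTE c2) subr_eq0 => /eqP.
by exists a => k kn; rewrite -two_valued_cycle_sum_sym /cv tv // ab.
Qed.

(** The inner variable is [c_1], the outer one the off-diagonal entry [a]. *)
Definition sym_poly (k : nat) : {poly {poly K}} :=
  match k with 0 => 1 | 1 => 'X%:P | _ => (k.-1)`!%:R * 'X ^+ k end.

Definition sym_morph n : {rmorphism {mpoly K[n]} -> {poly {poly K}}} :=
  cvar_morph n (@polyC _ \o @polyC K) sym_poly.

Lemma sym_morph_horner n (c : 'I_n -> K) a p :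
  (forall k, (k <= n)%N -> (cvar K n k).@[c] = sym_cycle_sum a (cvar K n
    1).@[c] k) ->
  (sym_morph n p).[a%:P].[(cvar K n 1).@[c]] = p.@[c].
Proof.
move=> fc; move: p; set c1 := (cvar K n 1).@[c] in fc *.
pose g : {rmorphism _ -> _} := horner_eval c1 \o (horner_eval a%:P \o sym_morph
  n).
apply: (@mpoly_morph_eq _ _ _ g (meval c)) => [x|].
  by rewrite /g /= cvar_morphC /horner_eval /= !hornerC mevalC.
apply: (ord_cvar (P := fun q => g q = q.@[c])) => k /andP[k0 kn].
rewrite /g /= cvar_morphE // /horner_eval fc //.
case: k k0 kn => [|[|k]] // _ _; first by rewrite /= hornerC hornerX.
rewrite /sym_poly hornerM hornerXn -(rmorph_nat (@polyC _)) hornerC hornerM.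
by rewrite -(rmorph_nat (@polyC _)) hornerC -rmorphXn /= hornerC.
Qed.

Lemma Jsym_sub_ker n p : (0 < n)%N -> Jsym K n p -> sym_morph n p = 0.
Proof.
move=> n0 /JsymE Jp; apply: poly_vanish2 => x a.
pose c (i : 'I_n) := two_valued_cycle_sum a a x i.+1.
have ck k : (k <= n)%N -> (cvar K n k).@[c] = two_valued_cycle_sum a a x k.
  exact: (meval_cvar (h := two_valued_cycle_sum a a x)).
have <- : (cvar K n 1).@[c] = x by rewrite ck.
rewrite sym_morph_horner; last by move=> k kn;
  rewrite !ck // two_valued_cycle_sum_sym.
apply: (Jp (two_valued_mx n a a x)); last exact: realizes_two_valued.
by apply/matrixP => i j; rewrite !mxE eq_sym /step_weight !if_same.
Qed.

Lemma sym_morph_subst n q : (1 < n)%N ->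
  sym_morph n (subst_poly2 (cvar K n 1) (cvar K n 2) q) = q \Po 'X^2.
Proof.
move=> n1; elim/poly_ind: q => [|q r IHq]; first by rewrite comp_poly0 !rmorph0.
rewrite comp_poly_MXaddC -IHq !rmorphD !rmorphM /= subst_poly2X subst_poly2C.
rewrite cvar_morphE //= mul1r; congr (_ + _).
elim/poly_ind: r {IHq} => [|r a IHr]; first by rewrite !rmorph0.
rewrite !rmorphD !rmorphM /= subst_polyX subst_polyC cvar_morphE ?(ltnW n1) //=.
by rewrite cvar_morphC IHr.
Qed.

Local Notation subst_c12 n := (subst_poly2 (cvar K n 1) (cvar K n 2)).

(** The entry [a] is not in the image of [sym_morph], which contains only [a ^+ 2] and higher
    powers, so a normal form replaces the retraction: the relations eliminate [c_s] for [s > 3] and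
    leave [c_3] in degree at most one. *)
Lemma sym_reduce n (G : set {mpoly K[n]}) : (2 < n)%N ->
  ideal_gen G (cvar K n 3 ^+ 2 - 4 * cvar K n 2 ^+ 3) ->
  (forall s, (3 < s <= n)%N ->
     ideal_gen G (((s - 1)`!)%:R * (cvar K n 2 * cvar K n (s - 2))
                  - ((s - 3)`!)%:R * cvar K n s)) ->
  forall p, exists q0 q1, ideal_gen G (p - ((subst_c12 n) q0 + cvar K n 3 *
    (subst_c12 n) q1)).
Proof.
move=> n2 G3 Gs.
have iX := subst_poly2X (cvar K n 1) (cvar K n 2).
elim/mpoly_ring_ind => [a||p q [p0 [p1 Ip]] [q0 [q1 Iq]]|p q [p0 [p1 Ip]] [q0
  [q1 Iq]]].
- exists a%:P%:P, 0; rewrite rmorph0 mulr0 addr0 subst_poly2C subst_polyC subrr.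
  exact: ideal_gen0.
- apply: (ord_cvar (P := fun p => exists q0 q1, ideal_gen G (p - ((subst_c12 n)
  q0 + cvar K n 3 * (subst_c12 n) q1)))).
  elim/ltn_ind => -[|[|[|[|k]]]] IHk //= kn.
  + exists 'X%:P, 0; rewrite rmorph0 mulr0 addr0 subst_poly2C subst_polyX subrr.
    exact: ideal_gen0.
  + exists 'X, 0; rewrite rmorph0 mulr0 addr0 iX subrr; exact: ideal_gen0.
  + exists 0, 1; rewrite rmorph0 rmorph1 mulr1 add0r subrr; exact: ideal_gen0.
  have [] := IHk k.+2; [lia|lia|] => q0 [q1 Iq].
  have [e eE] : exists e : K, e = ((k.+3)`!)%:R / ((k.+1)`!)%:R by eexists.
  exists (e%:P%:P * 'X * q0), (e%:P%:P * 'X * q1).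
  have fact0 : ((k.+1)`!)%:R != 0 :> K by rewrite pnatr_eq0 -lt0n fact_gt0.
  have /(ideal_genM (- (((k.+1)`!)%:R^-1)%:MP)) H := Gs k.+4 kn.
  have H' := ideal_genM (e%:MP * cvar K n 2) Iq.
  move: (ideal_genD H H'); congr (ideal_gen G _).
  rewrite !rmorphM /= iX subst_poly2C subst_polyC.
  rewrite !subSS !subn0.
  have -> : e%:MP = ((k.+1)`!%:R^-1)%:MP * ((k.+3)`!)%:R :> {mpoly K[n]}.
    by rewrite eE mulrC rmorphM /= rmorph_nat.
  have : ((k.+1)`!%:R^-1)%:MP * ((k.+1)`!)%:R = 1 :> {mpoly K[n]}.
    by rewrite -(rmorph_nat (@mpolyC n K)) -rmorphM mulVf.
  set u := _%:MP; set v := (_`!)%:R; set w := (_`!)%:R => uv.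
  transitivity (u * v * cvar K n k.+4 - (u * w * cvar K n 2 * (subst_c12 n) q0 +
     cvar K n 3 * (u * w * cvar K n 2 * (subst_c12 n) q1))); first by ring.
  by rewrite uv mul1r.
- exists (p0 + q0), (p1 + q1); move: (ideal_genD Ip Iq); congr (ideal_gen G _).
  by rewrite !rmorphD /=; ring.
exists (p0 * q0 + 4%:R * 'X ^+ 3 * (p1 * q1)), (p0 * q1 + p1 * q0).
have H1 := ideal_genM q Ip.
have H2 := ideal_genM ((subst_c12 n) p0 + cvar K n 3 * (subst_c12 n) p1) Iq.
have H3 := ideal_genM ((subst_c12 n) p1 * (subst_c12 n) q1) G3.
move: (ideal_genD (ideal_genD H1 H2) H3); congr (ideal_gen G _).
rewrite !rmorphD !rmorphM !rmorph_nat /= iX; ring.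
Qed.

(** Under the morphism [c_2] becomes ['X ^+ 2] and [c_3] becomes [2 * 'X ^+ 3], so the two parts of
    the normal form have even and odd exponents and must vanish separately. *)
Lemma sym_ker_ideal n (G : set {mpoly K[n]}) : (2 < n)%N ->
  ideal_gen G (cvar K n 3 ^+ 2 - 4 * cvar K n 2 ^+ 3) ->
  (forall s, (3 < s <= n)%N ->
     ideal_gen G (((s - 1)`!)%:R * (cvar K n 2 * cvar K n (s - 2))
                  - ((s - 3)`!)%:R * cvar K n s)) ->
  (forall p, G p -> sym_morph n p = 0) ->
  forall p, sym_morph n p = 0 -> ideal_gen G p.
Proof.
move=> n2 G3 Gs GJ p fp; have [q0 [q1 I]] := sym_reduce n2 G3 Gs p.
have := ideal_gen_ker GJ I.
rewrite rmorphB /= fp sub0r => /eqP; rewrite oppr_eq0 rmorphD rmorphM /=.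
rewrite -[cvar_morph _ _ _ _]/(sym_morph n _) -[cvar_morph _ _ _ (_ _ _
  q1)]/(sym_morph n _).
rewrite !sym_morph_subst ?(ltnW n2) // cvar_morphE //= => /eqP E.
have E2 i : (2 %| i.*2)%N /\ (i.*2 %/ 2 = i)%N by rewrite -muln2 dvdn_mull
  ?mulnK.
have {}E : (q0 \Po 'X^2) + (2%:R * (q1 \Po 'X^2)) * 'X^3 = 0 by rewrite -E
  -[2`!]/2%N; ring.
have q00 : q0 = 0.
  apply/polyP => i; have /polyP/(_ i.*2) := E.
  rewrite coefD coef_comp_poly_Xn // (E2 i).1 (E2 i).2 coefMXn.
  case: ltnP => [_|i3]; first by rewrite !coef0 addr0.
  rewrite mulr_natl coefMn coef_comp_poly_Xn // ifF ?mul0rn ?addr0 ?coef0 //;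
    lia.
have q10 : q1 = 0.
  apply/polyP => i; have /polyP/(_ (i.*2 + 3)%N) := E.
  rewrite q00 comp_poly0 add0r coefMXn ltnNge leq_addl /= addnK.
  rewrite mulr_natl coefMn coef_comp_poly_Xn // (E2 i).1 (E2 i).2 !coef0 =>
    /eqP.
  by rewrite -mulr_natl mulf_eq0 -(rmorph_nat (@polyC K)) polyC_eq0 pnatr_eq0
    => /eqP.
by move: I; rewrite q00 q10 !rmorph0 mulr0 addr0 subr0.
Qed.

Lemma Jsym3 : Jsym K 3 = ideal_gen [set - 4 * 'c_2 ^+ 3 + 'c_3 ^+ 2].
Proof.
have GJ p : p = - 4 * 'c_2 ^+ 3 + 'c_3 ^+ 2 -> sym_morph 3 p = 0.
  move=> ->; rewrite rmorphD rmorphM rmorphXn rmorphXn rmorphN rmorph_nat /=.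
  by rewrite !cvar_morphE //= !factS fact0; ring.
apply: (proj1 (ideal_eq_ker (f := sym_morph 3) _ _ _)).
- move=> p Ip; apply/JsymE => A c AT Ac.
  have [a Ha] := sym_points (isT : (2 < 3)%N) AT Ac.
  by rewrite -(sym_morph_horner p Ha) (ideal_gen_ker GJ Ip) !horner0.
- by move=> p; apply: Jsym_sub_ker.
apply: sym_ker_ideal => // [|s]; last by case: s => [|[|[|[|]]]].
by apply: ideal_gen_sub; rewrite /=; ring.
Qed.

Lemma Jsym_ge4 n : (4 <= n)%N ->
  Jsym K n =
    ideal_gen
      ([set 4 * 'c_2 ^+ 3 - 'c_3 ^+ 2] `|`
       [set p | exists2 s : nat, (4 <= s <= n)%N &
          p = ((s - 1)`!)%:R * ('c_2 * 'c_(s - 2))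
              - ((s - 3)`!)%:R * 'c_s])
  /\ prime_ideal (Jsym K n).
Proof.
move=> n4; have n2 : (2 < n)%N by lia.
set G := (X in ideal_gen X).
have GJ p : G p -> sym_morph n p = 0.
  case=> [->|[s /andP[s4 sn] ->]].
    rewrite rmorphB rmorphM rmorphXn rmorphXn rmorph_nat /=.
    by rewrite !cvar_morphE //= ?(ltnW n2) // !factS fact0; ring.
  rewrite rmorphB !rmorphM !rmorph_nat /= !cvar_morphE //; try lia.
  case: s s4 sn => [|[|[|[|s]]]] // _ _.
  by rewrite !subSS !subn0 /= ?subn0 -[1`!]/1%N !exprS; ring.
apply: (ideal_eq_ker (f := sym_morph n)).
- move=> p Ip; apply/JsymE => A c AT Ac.
  have [a Ha] := sym_points n2 AT Ac.
  by rewrite -(sym_morph_horner p Ha) (ideal_gen_ker GJ Ip) !horner0.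
- by move=> p; apply: Jsym_sub_ker; lia.
apply: sym_ker_ideal => // [|s sn].
  by rewrite -opprB; apply/ideal_genN/ideal_gen_sub; left.
by apply: ideal_gen_sub; right; exists s.
Qed.

End Symmetric.

(** * Maximal minors of the Hankel matrix *)

Section HankelDeterminant.
Variable S : comNzRingType.
Implicit Types u v : nat -> S.

(* The minor of the Hankel matrix [u (i + j)] on rows 0, 1, 2 and columns j, k, l. *)
Definition hankel3 u (j k l : nat) : S :=
  u j * (u k.+1 * u l.+2 - u l.+1 * u k.+2)
  - u k * (u j.+1 * u l.+2 - u l.+1 * u j.+2)
  + u l * (u j.+1 * u k.+2 - u k.+1 * u j.+2).

Definition det3 (p q r : nat -> S) : S :=
  p 0 * (q 1 * r 2 - r 1 * q 2) - q 0 * (p 1 * r 2 - r 1 * p 2)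
  + r 0 * (p 1 * q 2 - q 1 * p 2).

Lemma det3_sum1 m (a : 'I_m -> S) (p : 'I_m -> nat -> S) q r :
  det3 (fun i => \sum_k a k * p k i) q r = \sum_k a k * det3 (p k) q r.
Proof.
rewrite (eq_bigr (fun k => (q 1 * r 2 - r 1 * q 2) * (a k * p k 0)
   + (r 0 * q 2 - q 0 * r 2) * (a k * p k 1) + (q 0 * r 1 - r 0 * q 1) * (a k *
     p k 2))).
  by rewrite !big_split /= -!big_distrr /= /det3; ring.
by move=> k _; rewrite /det3; ring.
Qed.

Lemma det3_rot p q r : det3 p q r = det3 q r p.
Proof. by rewrite /det3; ring. Qed.

Lemma det3_sum m1 m2 m3 (a1 : 'I_m1 -> S) (a2 : 'I_m2 -> S) (a3 : 'I_m3 -> S)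
    (p : 'I_m1 -> nat -> S) (q : 'I_m2 -> nat -> S) (r : 'I_m3 -> nat -> S) :
  det3 (fun i => \sum_k a1 k * p k i) (fun i => \sum_k a2 k * q k i)
    (fun i => \sum_k a3 k * r k i) =
  \sum_k1 \sum_k2 \sum_k3 a1 k1 * (a2 k2 * (a3 k3 * det3 (p k1) (q k2) (r k3))).
Proof.
rewrite det3_sum1; apply: eq_bigr => k1 _.
rewrite det3_rot det3_sum1 big_distrr; apply: eq_bigr => k2 _.
rewrite det3_rot det3_sum1 !big_distrr; apply: eq_bigr => k3 _ /=.
by rewrite (det3_rot (p k1)) (det3_rot (q k2)).
Qed.

Lemma lift_inord m (i : 'I_m.+1) (j : 'I_m) : lift i j = inord (bump i j).
Proof. by apply/val_inj; rewrite /= inordK // (ltn_ord (lift i j)). Qed.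

Lemma det_col3 (M : 'M[S]_3) :
  \det M = det3 (fun i => M (inord i) (inord 0)) (fun i => M (inord i) (inord
    1))
    (fun i => M (inord i) (inord 2)).
Proof.
have ord0E m : ord0 = inord 0 :> 'I_m.+1 by apply/val_inj; rewrite /= inordK.
have det2 (N : 'M[S]_2) : \det N = N (inord 0) (inord 0) * N (inord 1) (inord 1)
     - N (inord 0) (inord 1) * N (inord 1) (inord 0).
  rewrite (expand_det_row _ ord0) !big_ord_recl big_ord0 /cofactor !det_mx11
    !mxE.
  rewrite !lift_inord /= /bump /= !add0n !addn0 !inordK //= -!ord0E.
  by rewrite expr0 expr1; ring.
rewrite (expand_det_row _ ord0) !big_ord_recl big_ord0 /cofactor !det2 !mxE.
rewrite !lift_inord /= /bump /= ?add0n ?addn0 !inordK //= ?add0n ?addn0 ?add1n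
  -!ord0E /=.
rewrite /det3 -!ord0E; ring.
Qed.

End HankelDeterminant.

Section HankelMinors.
Variables (K : comNzRingType) (n : nat).
Notation d := (dvar K n).
Notation I := (ideal_gen (maximal_minors (hankel_mx K n))).

Lemma det_colsub_hankel (f : 'I_3 -> 'I_n.-1) :
  \det (colsub f (hankel_mx K n)) =
  hankel3 d (f (inord 0)) (f (inord 1)) (f (inord 2)).
Proof. by rewrite det_col3 /det3 !mxE !inordK. Qed.

Lemma maximal_minors_hankel p : maximal_minors (hankel_mx K n) p <->
  exists j k l, [/\ (j < k)%N, (k < l)%N, (l < n.-1)%N & p = hankel3 d j k l].
Proof.
split=> [[f fh ->]|[j [k [l [jk kl ln ->]]]]].
  exists (f (inord 0)), (f (inord 1)), (f (inord 2)).
  by split; rewrite ?ltn_ord ?det_colsub_hankel //; apply: fh; rewrite !inordK.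
have kn := ltn_trans kl ln; have jn := ltn_trans jk kn.
pose f (i : 'I_3) := nth (Ordinal jn) [:: Ordinal jn; Ordinal kn; Ordinal ln] i.
exists f; last by rewrite det_colsub_hankel /f !inordK.
have jl := ltn_trans jk kl.
by case=> [[|[|[|]]] //= ?] [[|[|[|]]] //= ?].
Qed.

(** Minors alternate in their columns; dropping the order of the columns makes multilinear
    expansions usable. *)
Lemma hankel3_ideal j k l : (j < n.-1)%N -> (k < n.-1)%N -> (l < n.-1)%N ->
  I (hankel3 d j k l).
Proof.
have sorted j' k' l' : (j' < k')%N -> (k' < l')%N -> (l' < n.-1)%N -> I
  (hankel3 d j' k' l').
  by move=> *; apply/ideal_gen_sub/maximal_minors_hankel; exists j', k', l'.
have S12 j' k' l' : hankel3 d j' k' l' = - hankel3 d k' j' l' by rewrite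
  /hankel3; ring.
have S23 j' k' l' : hankel3 d j' k' l' = - hankel3 d j' l' k' by rewrite
  /hankel3; ring.
have D12 j' l' : hankel3 d j' j' l' = 0 by rewrite /hankel3; ring.
have D23 j' l' : hankel3 d j' l' l' = 0 by rewrite /hankel3; ring.
have D13 j' l' : hankel3 d j' l' j' = 0 by rewrite /hankel3; ring.
have I0 := ideal_gen0 (maximal_minors (hankel_mx K n)).
move=> jn kn ln; case: (ltngtP j k) => [jk|kj|->]; last by rewrite D12.
- case: (ltngtP k l) => [kl|lk|->]; [exact: sorted| |by rewrite D23].
  case: (ltngtP j l) => [jl|lj|->]; last by rewrite D13.
    by rewrite S23; apply/ideal_genN/sorted.
  by rewrite S23 S12 opprK; apply: sorted.
case: (ltngtP j l) => [jl|lj|->]; last by rewrite D13.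
  by rewrite S12; apply/ideal_genN/sorted.
case: (ltngtP k l) => [kl|lk|->]; last by rewrite D23.
  by rewrite S12 S23 opprK; apply: sorted.
by rewrite S12 S23 S12 opprK; apply/ideal_genN/sorted.
Qed.

(* Subtracting [c_1] from the diagonal of a matrix replaces its principal minors
   [d_k] by the [centered k]. *)
Definition centered (k : nat) : {mpoly K[n]} :=
  bconv (fun j => (- cvar K n 1) ^+ j) d k.

Lemma centered0 : centered 0 = 1.
Proof. by rewrite /centered bconv0 dvar0 mulr1. Qed.

Lemma dvar1 : d 1 = cvar K n 1.
Proof. by rewrite dvarS bconv0 dvar0; ring. Qed.

Lemma centered1 : centered 1 = 0.
Proof. by rewrite /centered bconvS !bconv0 /shift dvar0 dvar1; ring. Qed.

(** Row [i], column [k] of the Hankel matrix after the column operations alone; [partS] performs the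
    row operations that lead to [centered]. *)
Let part i k := bconv (fun j => (- cvar K n 1) ^+ j) (fun j => d (j + i)%N) k.

Lemma partS i k : part i k.+1 = part i.+1 k - cvar K n 1 * part i k.
Proof.
rewrite /part bconvS addrC -mulNr -bconvZl; congr (_ + _).
  by apply: eq_bconv => // j _; rewrite /shift addSnnS.
by apply: eq_bconv => // j _; rewrite /shift exprS.
Qed.

Lemma centered_part k : centered k = part 0 k.
Proof. by apply: eq_bconv => // j _; rewrite addn0. Qed.

(* The centered Hankel matrix is [U *m H *m V] with [U] and [V] unitriangular. *)
Lemma hankel3_centered_ideal j k l : (j < n.-1)%N -> (k < n.-1)%N -> (l <
  n.-1)%N ->
  I (hankel3 centered j k l).
Proof.
move=> jn kn ln.
have -> : hankel3 centered j k l = det3 (part^~ j) (part^~ k) (part^~ l).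
  by rewrite /hankel3 !centered_part !partS /det3; ring.
have E m : part^~ m = (fun i => \sum_(b < m.+1)
    (('C(m, b))%:R * (- cvar K n 1) ^+ (m - b)) * d (b + i)%N).
  by apply/funext => i; rewrite /part bconvC; apply: eq_bigr => b _; ring.
rewrite !E det3_sum; do 3!(apply: ideal_gen_sum => ? _).
do 3!apply: ideal_genM.
rewrite /det3 !addn0 !addn1 !addn2.
apply: hankel3_ideal; apply: leq_trans (ltn_ord _) _ => //.
Qed.

Notation x k := (centered k.+2).

(** Expand the minor on columns 0, [a.+1] and [j] along column 0, which is [(1, 0, x 0)]. For
    [a = 0] the value 0 stands for [centered 1]. *)
Lemma centered_exchange a j : (a.+1 < j)%N -> (j < n.-1)%N ->
  I (x a * x j - x a.+1 * x j.-1
     - x 0 * (x a * x j.-2 - (if a is a'.+1 then x a' else 0) * x j.-1)).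
Proof.
move=> aj jn; have := @hankel3_centered_ideal 0 a.+1 j.
move=> /(_ _ _ jn) []; [lia|lia|].
case: j aj jn => [|[|j]] // aj jn; rewrite /hankel3 centered0 centered1 /=.
move=> s sG E; exists s => //; rewrite -E.
case: a aj {E} => [|a] aj; rewrite ?centered1; ring.
Qed.

End HankelMinors.

(* The list of [k] numbers at most [N] with sum [q] that is as uneven as possible. *)
Fixpoint uneven N k q : seq nat :=
  if k is k'.+1 then minn q N :: uneven N k' (q - minn q N)%N else [::].

Lemma size_uneven N k q : size (uneven N k q) = k.
Proof. by elim: k q => //= k IHk q; rewrite IHk. Qed.

Lemma all_uneven N k q : all (leq^~ N) (uneven N k q).
Proof. by elim: k q => //= k IHk q; rewrite geq_minr IHk. Qed.

Lemma sumn_uneven N k q : (q <= k * N)%N -> sumn (uneven N k q) = q.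
Proof.
elim: k q => [|k IHk] q /=; first by rewrite leqn0 => /eqP.
by rewrite mulSn => qk; rewrite IHk; lia.
Qed.

Lemma sumn_leq_mul N l : all (leq^~ N) l -> (sumn l <= size l * N)%N.
Proof. by elim: l => //= a l IHl /andP[aN /IHl]; rewrite mulSn; lia. Qed.

(** * Normal form modulo the maximal minors *)

Section NormalForm.
Variables (K : comNzRingType) (n : nat).
Hypothesis n2 : (2 <= n)%N.
Let N := n.-2.
Notation I := (ideal_gen (maximal_minors (hankel_mx K n))).
Notation x k := (centered K n k.+2).

Definition centered_prod (l : seq nat) : {mpoly K[n]} := \prod_(k <- l) x k.

(** No product of [k] factors with indices up to [N] has index sum above [k * N]; the value 0 fills
    these places. *)
Definition normal_prod k q : {mpoly K[n]} :=
  if (q <= k * N)%N then centered_prod (uneven N k q) else 0.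

Definition normal_sum B (g : nat -> nat -> {poly K}) : {mpoly K[n]} :=
  \sum_(k < B) \sum_(q < B) subst_poly (cvar K n 1) (g k q) * normal_prod k q.

Definition reducible B p := exists g, I (p - normal_sum B g).

Lemma normal_sumD B g h :
  normal_sum B (fun k q => g k q + h k q) = normal_sum B g + normal_sum B h.
Proof.
rewrite /normal_sum -big_split; apply: eq_bigr => k _.
by rewrite -big_split; apply: eq_bigr => q _; rewrite rmorphD /= mulrDl.
Qed.

Lemma normal_sumM B g a :
  normal_sum B (fun k q => a * g k q) = subst_poly (cvar K n 1) a * normal_sum
    B g.
Proof.
rewrite /normal_sum big_distrr; apply: eq_bigr => k _.
by rewrite big_distrr; apply: eq_bigr => q _; rewrite rmorphM /= mulrA.
Qed.

Lemma reducibleD B p q : reducible B p -> reducible B q -> reducible B (p + q).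
Proof.
move=> [g Ig] [h Ih]; exists (fun k q => g k q + h k q).
by rewrite normal_sumD opprD addrACA; apply: ideal_genD.
Qed.

Lemma reducibleM B a p : reducible B p -> reducible B (subst_poly (cvar K n 1)
  a * p).
Proof.
move=> [g Ig]; exists (fun k q => a * g k q).
by rewrite normal_sumM -mulrBr; apply: ideal_genM.
Qed.

Lemma reducibleN B p : reducible B p -> reducible B (- p).
Proof. by move=> /(reducibleM (- 1)); rewrite rmorphN rmorph1 mulN1r. Qed.

Lemma reducible_ideal B p : I p -> reducible B p.
Proof.
move=> Ip; exists (fun _ _ => 0); rewrite /normal_sum big1 ?subr0 // => k _.
by rewrite big1 // => q _; rewrite rmorph0 mul0r.
Qed.

Lemma reducible0 B : reducible B 0.
Proof. exact/reducible_ideal/ideal_gen0. Qed.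

Lemma reducible_normal B k q : (k < B)%N -> (q < B)%N -> reducible B
  (normal_prod k q).
Proof.
move=> kB qB; exists (fun k' q' => ((k' == k) && (q' == q))%:R).
rewrite /normal_sum (bigD1 (Ordinal kB)) //= (bigD1 (Ordinal qB)) //= !eqxx
  rmorph1 mul1r.
rewrite big1 ?addr0 => [|q' nq]; last first.
  have -> : (q' == q :> nat) = false by apply: contraNF nq => /eqP E;
    apply/eqP/val_inj.
  by rewrite rmorph0 mul0r.
rewrite big1 ?addr0 ?subrr => [|k' nk]; first exact: ideal_gen0.
have -> : (k' == k :> nat) = false by apply: contraNF nk => /eqP E;
  apply/eqP/val_inj.
by rewrite big1 // => q' _; rewrite rmorph0 mul0r.
Qed.

Lemma centered_prod_cons a l : centered_prod (a :: l) = x a * centered_prod l.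
Proof. exact: big_cons. Qed.

Lemma centered_prod_cat l r : centered_prod (l ++ r) = centered_prod l *
  centered_prod r.
Proof. exact: big_cat. Qed.

Section Step.
Variables (B m s : nat).
(* Modulo the minors, exchanging produces products with one more factor and the
   same weight, hence a smaller index sum. *)
Hypothesis IH : forall l, all (leq^~ N) l -> (size l = m.+1)%N -> (sumn l + 2 =
  s)%N ->
  reducible B (centered_prod l).

Let equiv l l' := reducible B (centered_prod l - centered_prod l').

Lemma equiv_refl l : equiv l l.
Proof. by rewrite /equiv subrr; apply: reducible0. Qed.

Lemma equiv_trans l1 l2 l3 : equiv l1 l2 -> equiv l2 l3 -> equiv l1 l3.
Proof.
move=> E12 E23; have := reducibleD E12 E23.
by rewrite addrA subrK.
Qed.

Lemma equiv_sym l l' : equiv l l' -> equiv l' l.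
Proof. by move=> /reducibleN; rewrite opprB. Qed.

Lemma equiv_exchange a j r : (a.+1 < j)%N -> (j <= N)%N -> all (leq^~ N) r ->
  (size r).+2 = m -> (a + j + sumn r = s)%N ->
  equiv [:: a, j & r] [:: a.+1, j.-1 & r].
Proof.
move=> aj jN rN sr ss; rewrite /equiv !centered_prod_cons.
have jn : (j < n.-1)%N by rewrite /N in jN; lia.
have /(ideal_genM (centered_prod r))/(reducible_ideal B) := @centered_exchange
  K n _ _ aj jn.
set e := (if a is _.+1 then _ else _).
have R1 : reducible B (centered_prod [:: 0%N, a, j.-2 & r]).
  by apply: IH => /=; rewrite ?rN ?sr //; lia.
have R2 : reducible B (x 0 * e * x j.-1 * centered_prod r).
  rewrite /e; case: (a) ss aj => [|a'] ss aj; first by rewrite mulr0 !mul0r;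
    apply: reducible0.
  rewrite -!mulrA -!centered_prod_cons; apply: IH => /=; rewrite ?rN ?sr //;
    lia.
move: R1; rewrite !centered_prod_cons => R1 R0.
have := reducibleD (reducibleD R0 R1) (reducibleN R2); congr reducible; ring.
Qed.

(** Read backwards, [equiv_exchange] moves one unit from the smaller index to the larger one;
    [t - b] such moves are needed. *)
Lemma equiv_spread a b t r : (a <= b)%N -> (b <= t)%N -> (t <= N)%N -> (t <= a
  + b)%N ->
  all (leq^~ N) r -> (size r).+2 = m -> (a + b + sumn r = s)%N ->
  equiv [:: a, b & r] [:: t, (a + b - t)%N & r].
Proof.
move=> ab bt tN ts rN sr ss.
have swap i j : centered_prod [:: i, j & r] = centered_prod [:: j, i & r].
  by rewrite !centered_prod_cons mulrCA.
have [k tk] : exists k, t = (b + k)%N by exists (t - b)%N; lia.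
elim: k a b ab bt ts ss tk => [|k IHk] a b ab bt ts ss tk.
  have -> : (a + b - t = a)%N by lia.
  have -> : t = b by lia.
  by rewrite /equiv swap; apply: equiv_refl.
have := IHk a.-1 b.+1; have -> : (a.-1 + b.+1 = a + b)%N by lia.
move=> /(_ _ _ ts ss) H; apply: equiv_trans (H _ _ _); try lia.
have := @equiv_exchange a.-1 b.+1 r; rewrite prednK /=; last by lia.
move=> H'; apply/equiv_sym/H' => //; lia.
Qed.

Lemma equiv_spread_minn a b r : (a <= N)%N -> (b <= N)%N ->
  all (leq^~ N) r -> (size r).+2 = m -> (a + b + sumn r = s)%N ->
  equiv [:: a, b & r] [:: minn (a + b) N, (a + b - minn (a + b) N)%N & r].
Proof.
move=> aN bN rN sr ss; case: (leqP a b) => ab;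
  first by apply: equiv_spread => //; lia.
have -> : equiv [:: a, b & r] = equiv [:: b, a & r].
  by apply/funext => l; rewrite /equiv !centered_prod_cons mulrCA.
rewrite addnC; apply: equiv_spread => //; lia.
Qed.

(** Make the tail uneven, so that its head is [minn (sumn l) N]. Spreading [a] against this head
    already produces the final head [minn (a + sumn l) N], and the tail is made uneven a second
    time. *)
Lemma equiv_uneven l r : all (leq^~ N) l -> all (leq^~ N) r ->
  (size l + size r = m)%N -> (sumn l + sumn r = s)%N ->
  equiv (l ++ r) (uneven N (size l) (sumn l) ++ r).
Proof.
move El : (size l) => k; elim: k l r El => [|k IHk] [|a l] // r.
  by move=> _ *; apply: equiv_refl.
move=> /= [sl] /andP[aN lN] rN sr ss.
have middle l' r' b : equiv (l' ++ b :: r') = equiv (b :: l' ++ r').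
  apply/funext => z; rewrite /equiv centered_prod_cons !centered_prod_cat.
  by rewrite centered_prod_cons mulrCA.
apply: equiv_trans (_ : equiv (uneven N k (sumn l) ++ a :: r) _).
  by rewrite -middle; apply: IHk => //=; rewrite ?aN //; lia.
rewrite middle.
have lk : (sumn l <= k * N)%N by rewrite -sl; apply: sumn_leq_mul.
case: k sl IHk sr lk => [|k] sl IHk sr lk.
  have l0 : sumn l = 0%N by lia.
  by rewrite /= l0 addn0 (minn_idPl aN); apply: equiv_refl.
rewrite /=; set b := minn (sumn l) N; set g := uneven N k _.
have bN : (b <= N)%N by rewrite geq_minr.
have gs : sumn g = (sumn l - b)%N.
  by apply: sumn_uneven; move: lk; rewrite mulSn /b; lia.
have gN := all_uneven N k (sumn l - b).
have lb : (b <= sumn l)%N by rewrite geq_minl.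
have t1 : minn (a + b) N = minn (a + sumn l) N by rewrite /b; lia.
apply: equiv_trans (equiv_spread_minn aN bN _ _ _) _.
- by rewrite all_cat gN.
- by rewrite size_cat size_uneven; lia.
- by rewrite sumn_cat gs; lia.
rewrite t1; set t := minn (a + sumn l) N.
have tN : (t <= N)%N by rewrite geq_minr.
have ta : (t <= a + b)%N by rewrite /t -t1 geq_minl.
have -> : equiv [:: t, (a + b - t)%N & g ++ r] = equiv (((a + b - t)%N :: g) ++
  t :: r).
  by rewrite middle /=; apply/funext => z;
    rewrite /equiv !centered_prod_cons mulrCA.
apply: equiv_trans (IHk _ _ _ _ _ _ _) _; rewrite /= ?size_uneven ?tN ?gN //=;
  try lia.
rewrite gs -cat_cons middle; have -> : (a + b - t + (sumn l - b) = a + sumn l -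
  t)%N by lia.
exact: equiv_refl.
Qed.

End Step.

(** [2 * size l + sumn l] is the weight of the product, [x k] having weight [k + 2]. Exchanges
    preserve it, so one bound [B] covers every product that arises. *)
Lemma centered_prod_reducible B l : all (leq^~ N) l -> (2 * size l + sumn l <
  B)%N ->
  reducible B (centered_prod l).
Proof.
have [s] := ubnP (sumn l); elim: s l => // s IHs l ls lN lB.
have E := @equiv_uneven B (size l) (sumn l) _ l [::] lN.
rewrite !cats0 /= !addn0 in E.
have := reducibleD (E _ isT erefl erefl) (_ : reducible B (normal_prod (size l)
  (sumn l))).
rewrite /normal_prod sumn_leq_mul // subrK; apply.
  by move=> l' l'N sl' ss'; apply: IHs => //; lia.
have := @reducible_normal B (size l) (sumn l);
  rewrite /normal_prod sumn_leq_mul //; apply; lia.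
Qed.

End NormalForm.

(** * The generic point *)

Section MinorRecurrence.
Variables (T : comNzRingType) (a b c : T).
Let h := two_valued_cycle_sum a b c.
Let g j := (-1) ^+ j * h j.+1.
(** [tau] and [pi] are the sum and the product of [c - a] and [c - b], the characteristic roots of
    the recurrence for the minors. *)
Let tau := 2 * c - (a + b).
Let pi := (c - a) * (c - b).

(* The Riccati equation [g' + g ^ 2 = tau * g - pi] for exponential generating
   functions, [g] being the logarithmic derivative of that of [minor]. *)
Lemma two_valued_riccati m :
  shift g m + bconv g g m = tau * g m - pi * delta0 T m.
Proof.
have hSS := @two_valued_cycle_sumSS T a b c; rewrite -/h in hSS.
have h1 : h 1 = c by []; have h2 : h 2 = a * b by rewrite /h /= eulerian1 mulr1.
rewrite /g; move: (h) hSS h1 h2 => h' hSS h1 h2; case: m => [|m].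
  by rewrite bconv0 /shift /delta0 /= h1 h2 /tau /pi; ring.
rewrite /bconv big_ord_recl big_ord_recr bin0 binn subn0 subnn /shift /delta0
  /= h1.
have -> : \sum_(i < m) ('C(m.+1, bump 0 i))%:R * ((-1) ^+ bump 0 i * h' (bump 0
  i).+1)
     * ((-1) ^+ (m.+1 - bump 0 i) * h' (m.+1 - bump 0 i).+1) =
   (-1) ^+ m.+1 * \sum_(1 <= j < m.+1) ('C(m.+1, j))%:R * (h' j.+1 * h' (m.+1 -
     j).+1).
  rewrite big_add1 big_mkord big_distrr; apply: eq_bigr => i _.
  rewrite /bump /= add1n; have im : (i.+1 <= m.+1)%N by rewrite ltnS ltnW.
  by rewrite -{4}(subnKC im) exprD; ring.
by rewrite /bump /= add1n hSS // /tau exprS; ring.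
Qed.

Definition minor : nat -> T := partition_seq (fun k => (-1) ^+ k.-1 * h k).

Lemma minor0 : minor 0 = 1.
Proof. exact: partition_seq0. Qed.

Lemma minorS m : minor m.+1 = bconv g minor m.
Proof. exact: partition_seqS. Qed.

(** With [D] the generating function of [minor], [D' = g * D] gives [D'' = (g' + g ^ 2) * D], and
    the Riccati equation turns this into [tau * D' - pi * D]. *)
Lemma minorSS m : minor m.+2 = tau * minor m.+1 - pi * minor m.
Proof.
rewrite [LHS]minorS bconvS.
rewrite (eq_bconv (u' := g) (v' := bconv g minor) (v := shift minor)) //;
  last first.
  by move=> j _; rewrite /shift minorS.
rewrite bconvA -bconvDl (eq_bconv (v' := minor)
  (u' := fun j => tau * g j + (- pi) * delta0 T j)) //; last first.
  by move=> j _; rewrite two_valued_riccati mulNr.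
by rewrite bconvDl !bconvZl bconv1 -minorS mulNr.
Qed.

Definition centered_minor := bconv (fun j => (- c) ^+ j) minor.

(** Centering multiplies the generating function by [exp (- c x)], which moves the characteristic
    roots [c - a] and [c - b] to [- a] and [- b]. *)
Lemma centered_minorSS m :
  centered_minor m.+2 = - (a + b) * centered_minor m.+1 - a * b *
    centered_minor m.
Proof.
pose e : nat -> T := fun j => (- c) ^+ j.
have eS v k : bconv (shift e) v k = - c * bconv e v k.
  by rewrite -bconvZl; apply: eq_bconv => // j _; rewrite /shift /e exprS.
have S1 k : centered_minor k.+1 = bconv e (shift minor) k - c * centered_minor
  k.
  by rewrite /centered_minor bconvS eS; ring.
have S2 : bconv e (shift (shift minor)) m =
    tau * bconv e (shift minor) m - pi * centered_minor m.
  rewrite [LHS]bconvC [X in tau * X]bconvC /centered_minor -/e [X in pi *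
    X]bconvC.
  transitivity (bconv (fun j => tau * shift minor j + (- pi) * minor j) e m).
    by apply: eq_bconv => // j _; rewrite /shift minorSS mulNr.
  by rewrite bconvDl !bconvZl mulNr.
have := S1 m; move: (S1 m.+1); rewrite bconvS eS S2 => -> E.
have -> : bconv e (shift minor) m = centered_minor m.+1 + c * centered_minor m.
  by rewrite E; ring.
by rewrite /tau /pi; ring.
Qed.

Variables (K : comNzRingType) (n : nat) (f : {rmorphism {mpoly K[n]} -> T}).
Hypothesis fh : forall k, (k <= n)%N -> f (cvar K n k) = h k.

Lemma morph_dvar m : (m <= n)%N -> f (dvar K n m) = minor m.
Proof.
elim/ltn_ind: m => -[|m] IHm mn; first by rewrite dvar0 rmorph1 minor0.
rewrite dvarS minorS rmorph_sum; apply: eq_bigr => j _.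
have jm : (j <= m)%N by rewrite -ltnS.
rewrite !rmorphM rmorph_nat rmorphXn rmorphN1 fh; last by apply: leq_trans mn.
by rewrite IHm // ?ltnS ?leq_subr //; apply: leq_trans (leq_subr _ _) (ltnW mn).
Qed.

Lemma morph_hankel3 j k l : (j < n.-1)%N -> (k < n.-1)%N -> (l < n.-1)%N ->
  f (hankel3 (dvar K n) j k l) = 0.
Proof.
move=> jn kn ln; rewrite /hankel3 !(rmorphN, rmorphD, rmorphM) /= !morph_dvar;
  try lia.
by rewrite !minorSS; ring.
Qed.

Lemma morph_minors p : maximal_minors (hankel_mx K n) p -> f p = 0.
Proof.
move=> /maximal_minors_hankel[j [k [l [jk kl ln ->]]]].
by apply: morph_hankel3; lia.
Qed.

Lemma morph_centered m : (0 < n)%N -> (m <= n)%N -> f (centered K n m) =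
  centered_minor m.
Proof.
move=> n0 mn; rewrite rmorph_sum; apply: eq_bigr => j _.
rewrite !rmorphM rmorph_nat rmorphXn rmorphN fh //=.
by rewrite morph_dvar //; apply: leq_trans (leq_subr _ _) mn.
Qed.

Lemma morph_centeredSS m : (m.+2 <= n)%N -> f (centered K n m.+2) =
  - (a + b) * f (centered K n m.+1) - a * b * f (centered K n m).
Proof. by move=> mn; rewrite !morph_centered ?centered_minorSS //; lia. Qed.

End MinorRecurrence.

(** * Reduction of all polynomials to normal form *)

Section Generation.
Variables (K : comNzRingType) (n : nat).
Hypothesis n2 : (2 <= n)%N.
Let N := n.-2.
Notation d := (dvar K n).
Notation iota1 := (subst_poly (cvar K n 1)).

(** A polynomial in [c_1] and the centered minors of sizes [2] to [n]. These are new coordinates,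
    because the change from the [c_k] is triangular. *)
Definition centered_comb (p : {mpoly K[n]}) :=
  exists2 s : seq ({poly K} * seq nat), all (fun t => all (leq^~ N) t.2) s &
    p = \sum_(t <- s) iota1 t.1 * centered_prod K n t.2.

Lemma centered_combD p q : centered_comb p -> centered_comb q -> centered_comb
  (p + q).
Proof.
move=> [s sN ->] [t tN ->]; exists (s ++ t); first by rewrite all_cat sN.
by rewrite big_cat.
Qed.

Lemma centered_combM p q : centered_comb p -> centered_comb q -> centered_comb
  (p * q).
Proof.
move=> [s /allP sN ->] [t /allP tN ->].
exists [seq (u.1 * v.1, u.2 ++ v.2) | u <- s, v <- t].
  by apply/allP => _ /allpairsP[[u v] /= [/sN us /tN vt ->]] /=;
    rewrite all_cat us.
rewrite big_allpairs_dep big_distrl; apply: eq_bigr => u _.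
rewrite big_distrr; apply: eq_bigr => v _ /=.
by rewrite rmorphM centered_prod_cat /=; ring.
Qed.

Lemma centered_comb_iota q : centered_comb (iota1 q).
Proof. by exists [:: (q, [::])] => //;
  rewrite big_seq1 /centered_prod big_nil mulr1. Qed.

Lemma centered_combC a : centered_comb a%:MP.
Proof. by rewrite -(subst_polyC (cvar K n 1)); apply: centered_comb_iota. Qed.

Lemma centered_comb_nat m : centered_comb m%:R.
Proof. by rewrite -(rmorph_nat iota1); apply: centered_comb_iota. Qed.

Lemma centered_combN p : centered_comb p -> centered_comb (- p).
Proof.
by rewrite -mulN1r; apply: centered_combM; rewrite -(rmorphN1 iota1);
  apply: centered_comb_iota.
Qed.

Lemma centered_comb_X p m : centered_comb p -> centered_comb (p ^+ m).
Proof.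
move=> cp; elim: m => [|m IHm]; first by rewrite expr0 -(rmorph1 iota1);
  apply: centered_comb_iota.
by rewrite exprS; apply: centered_combM.
Qed.

Lemma centered_comb_sum (J : Type) (r : seq J) (P : pred J) F :
  (forall i, P i -> centered_comb (F i)) -> centered_comb (\sum_(i <- r | P i)
    F i).
Proof.
move=> H; elim/big_ind: _ => //; last exact: centered_combD.
by rewrite -(rmorph0 iota1); apply: centered_comb_iota.
Qed.

Lemma centered_comb_c1 : centered_comb (cvar K n 1).
Proof. by rewrite -(subst_polyX (cvar K n 1)); apply: centered_comb_iota. Qed.

Lemma centered_comb_centered k : (k <= n)%N -> centered_comb (centered K n k).
Proof.
case: k => [|[|k]] kn.
- by rewrite centered0; apply: centered_comb_nat 1.
- by rewrite centered1; apply: centered_comb_nat 0.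
exists [:: (1, [:: k])]; first by rewrite /= /N; lia.
by rewrite big_seq1 rmorph1 mul1r /centered_prod big_seq1.
Qed.

(** The factors [exp (c_1 x)] and [exp (- c_1 x)] cancel. *)
Lemma dvar_centered k : d k = bconv (fun j => cvar K n 1 ^+ j) (centered K n) k.
Proof.
rewrite [RHS](bconvA _ (fun j => (- cvar K n 1) ^+ j) d) -[LHS]bconv1.
apply: eq_bconv => // j _; rewrite bconv_exp subrr expr0n /delta0.
by case: j.
Qed.

Lemma centered_comb_dvar k : (k <= n)%N -> centered_comb (d k).
Proof.
move=> kn; rewrite dvar_centered; apply: centered_comb_sum => j _.
apply: centered_combM; first apply: centered_combM;
  first exact: centered_comb_nat.
  exact/centered_comb_X/centered_comb_c1.
by apply/centered_comb_centered/(leq_trans (leq_subr _ _)).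
Qed.

(** As [d_0 = 1], the last term of [dvarS] is [c_(m+1)] up to sign, so the recurrence can be solved
    for it. *)
Lemma centered_comb_cvar k : (0 < k <= n)%N -> centered_comb (cvar K n k).
Proof.
elim/ltn_ind: k => -[//|m] IHm /= mn.
have E : (-1) ^+ m * cvar K n m.+1 = d m.+1 -
    \sum_(j < m) ('C(m, j))%:R * ((-1) ^+ j * cvar K n j.+1) * d (m - j).
  by rewrite dvarS /bconv big_ord_recr /= binn subnn dvar0; ring.
have -> : cvar K n m.+1 = (-1) ^+ m * ((-1) ^+ m * cvar K n m.+1).
  by rewrite mulrA -exprMn mulrNN mulr1 expr1n mul1r.
have sgn j : centered_comb ((-1) ^+ j).
  by apply/centered_comb_X/centered_combN/(centered_comb_nat 1).
apply: centered_combM => //; rewrite E; apply: centered_combD.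
  exact: centered_comb_dvar.
apply/centered_combN/centered_comb_sum => j _.
apply: centered_combM; last by apply: centered_comb_dvar; lia.
apply: centered_combM; first exact: centered_comb_nat.
by apply: centered_combM => //; apply: IHm; rewrite ?ltnS //;
  have := ltn_ord j; lia.
Qed.

Lemma centered_comb_all p : centered_comb p.
Proof.
elim/mpoly_ring_ind: p => [a||p q|p q].
- exact: centered_combC.
- apply: ord_cvar => k; exact: centered_comb_cvar.
- exact: centered_combD.
exact: centered_combM.
Qed.

Lemma all_reducible (p : {mpoly K[n]}) : exists B, reducible B p.
Proof.
have [s sN ->] := centered_comb_all p.
pose B := (\max_(t <- s) (2 * size t.2 + sumn t.2)).+1; exists B.
rewrite big_seq; elim/big_ind: _ => [||t ts]; first exact: reducible0.
  exact: reducibleD.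
apply/reducibleM/centered_prod_reducible => //; first exact: (allP sN).
rewrite ltnS; exact: (@leq_bigmax_seq _ s xpredT (fun t => 2 * size t.2 + sumn
  t.2)%N t).
Qed.

End Generation.

Lemma rmorph_two_valued (S T : comNzRingType) (f : {rmorphism S -> T}) a b c k :
  f (two_valued_cycle_sum a b c k) = two_valued_cycle_sum (f a) (f b) (f c) k.
Proof.
case: k => [|[|k]] /=; rewrite ?rmorph1 // !rmorphM /=; congr (_ * _).
rewrite rmorph_sum; apply: eq_bigr => -[|x p] _ /=; first exact: rmorph1.
elim: p x => [|y p IHp] x /=; first exact: rmorph1.
by rewrite rmorphM /= IHp /step_weight; case: ifP.
Qed.

Section GenericPoint.
Variables (K : numFieldType) (n : nat).
Hypothesis n2 : (2 <= n)%N.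
Let N := n.-2.
Notation D := {poly {poly {poly K}}}.
Notation I := (ideal_gen (maximal_minors (hankel_mx K n))).
Notation iota1 := (subst_poly (cvar K n 1)).

(** From the outermost variable inwards these are [b], [a] and [c]; leading terms at [b = 0] are
    then plain coefficients of the outer polynomial. *)
Definition generic_point (k : nat) : D :=
  two_valued_cycle_sum 'X%:P 'X 'X%:P%:P k.

Definition generic_morph : {rmorphism {mpoly K[n]} -> D} :=
  cvar_morph n (@polyC _ \o (@polyC _ \o @polyC K)) generic_point.

Lemma generic_morph_cvar k : (k <= n)%N -> generic_morph (cvar K n k) =
  generic_point k.
Proof. exact: cvar_morphE. Qed.

(** The recurrence with roots [- a] and [- b] starts with 1, 0; from there on its values are
    divisible by [b], and modulo [b ^ 2] they form the geometric progression
    [b * (- a) ^ (k + 1)]. *)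
Lemma generic_morph_centered k : (k <= N)%N ->
  exists2 P : D, generic_morph (centered K n k.+2) = 'X * P & P.[0] = (- 'X) ^+
    k.+1.
Proof.
have R m := morph_centeredSS generic_morph_cvar (m := m).
elim/ltn_ind: k => k IHk kN; rewrite R; last by rewrite /N in kN; lia.
case: k IHk kN => [|[|k]] IHk kN.
- exists (- 'X%:P); last by rewrite hornerN hornerC expr1.
  by rewrite centered0 centered1 rmorph0 rmorph1; ring.
- have [//|//|P -> P0] := IHk 0%N; exists (- ('X%:P + 'X) * P).
    by rewrite centered1 rmorph0; ring.
  by rewrite hornerM hornerN hornerD hornerC hornerX addr0 P0 -exprS.
have [//||P -> P0] := IHk k.+1; first lia.
have [//||Q -> Q0] := IHk k; first lia.
exists (- ('X%:P + 'X) * P - 'X%:P * 'X * Q); first by ring.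
rewrite !(hornerM, hornerN, hornerD, hornerC, hornerX) mulr0 mul0r oppr0 !addr0
  P0.
by rewrite -exprS.
Qed.

Lemma generic_morph_prod l : all (leq^~ N) l ->
  exists2 P : D, generic_morph (centered_prod K n l) = 'X ^+ size l * P &
    P.[0] = (- 'X) ^+ (size l + sumn l).
Proof.
elim: l => [|k l IHl] /=.
  by move=> _; exists 1; rewrite ?hornerC // /centered_prod big_nil rmorph1
    mul1r.
move=> /andP[kN /IHl[P EP P0]]; have [Q EQ Q0] := generic_morph_centered kN.
exists (Q * P); first by rewrite centered_prod_cons rmorphM /= EQ [cvar_morph _
  _ _ _]EP exprS; ring.
rewrite hornerM P0 Q0 -exprD; congr (_ ^+ _); lia.
Qed.

Lemma coef_generic_normal k q j : (j <= k)%N ->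
  (generic_morph (normal_prod K n k q))`_j =
  if (j == k) && (q <= k * N)%N then (- 'X) ^+ (k + q) else 0.
Proof.
move=> jk; rewrite /normal_prod -/N; case: ifP => qk;
  last by rewrite rmorph0 coef0 andbF.
have [P -> P0] := generic_morph_prod (all_uneven N k q).
rewrite size_uneven sumn_uneven // in P0 *.
rewrite andbT coefXnM ltn_neqAle jk andbT; case: eqVneq => [->|] //=.
by rewrite subnn -horner_coef0 P0.
Qed.

Lemma generic_morph_iota g : generic_morph (iota1 g) = g%:P%:P.
Proof.
elim/poly_ind: g => [|g a IHg]; first by rewrite !rmorph0.
rewrite !rmorphD !rmorphM /= subst_polyX subst_polyC cvar_morphC.
by rewrite cvar_morphE ?(ltnW n2) //= -IHg.
Qed.

(** A normal product of degree [k] and index sum [q] has order [k] in [b] with leading coefficient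
    [(- a) ^ (k + q)]. By induction on [k], the coefficient of [b ^ k] involves only the degree [k],
    where distinct [q] give distinct powers of [a]. *)
Lemma generic_morph_inj_normal B g :
  generic_morph (normal_sum n B g) = 0 -> normal_sum n B g = 0.
Proof.
move=> E.
have g0 k : (k < B)%N -> forall q, (q < B)%N -> (q <= k * N)%N -> g k q = 0.
  elim/ltn_ind: k => k IHk kB q qB qk.
  have Ek : \sum_(k' < B) \sum_(q' < B) (g k' q')%:P *
      (generic_morph (normal_prod K n k' q'))`_k = 0 :> {poly {poly K}}.
    transitivity ((generic_morph (normal_sum n B g))`_k);
      last by rewrite E coef0.
    rewrite rmorph_sum coef_sum; apply: eq_bigr => k' _.
    rewrite rmorph_sum coef_sum; apply: eq_bigr => q' _.
    by rewrite rmorphM [_ (iota1 _)]generic_morph_iota coefCM.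
  rewrite (bigD1 (Ordinal kB)) //= [X in _ + X]big1 ?addr0 in Ek; last first.
    move=> i nik; rewrite big1 // => r _.
    case: (ltngtP i k) => [ik|ki|ik]; last by case/eqP: nik; apply/val_inj.
      case: (leqP r (i * N)) => ri; first by rewrite IHk // rmorph0 mul0r.
      by rewrite /normal_prod -/N leqNgt ri rmorph0 coef0 mulr0.
    by rewrite [X in _ * X]coef_generic_normal ?(ltnW ki) // ltn_eqF //= mulr0.
  have sgnX r : (- 'X) ^+ r = ((-1) ^+ r)%:P * 'X^r :> {poly {poly K}}.
    by rewrite [LHS]exprNn polyC_exp polyCN polyC1.
  have Eq : \sum_(r < B) (if (r <= k * N)%N && (k + q == k + r)%N then g k r *
    (-1) ^+ (k + r) else 0) = 0.
    transitivity ((\sum_(q' < B) (g k q')%:P * (generic_morph (normal_prod K n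
      k q'))`_k)`_(k + q)).
      rewrite coef_sum; apply: eq_bigr => r _;
        rewrite coefCM coef_generic_normal // eqxx.
      rewrite /=; case: (leqP r (k * N)) => _ /=; last by rewrite coef0 mulr0.
      by rewrite sgnX coefCM coefXn; case: eqVneq => _; rewrite ?mulr1 ?mulr0.
    by rewrite Ek coef0.
  rewrite (bigD1 (Ordinal qB)) //= qk eqxx /= [X in _ + X]big1 ?addr0 in Eq;
    last first.
    move=> r nrq; rewrite eqn_add2l ifF //.
    by apply/negP => /andP[_ /eqP rq]; case/eqP: nrq; apply/val_inj.
  by move/eqP: Eq; rewrite mulf_eq0 signr_eq0 orbF => /eqP.
rewrite /normal_sum big1 // => k _; rewrite big1 // => q _.
case: (leqP q (k * N)) => qk; first by rewrite g0 // rmorph0 mul0r.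
by rewrite /normal_prod -/N leqNgt qk mulr0.
Qed.

(** [p] is congruent to a normal sum, which lies in the kernel together with [p] and hence is
    zero. *)
Lemma generic_ker_ideal p : generic_morph p = 0 -> I p.
Proof.
move=> fp; have [B [g Ig]] := all_reducible n2 p.
have := ideal_gen_ker (morph_minors generic_morph_cvar) Ig.
rewrite rmorphB /= [cvar_morph _ _ _ p]fp sub0r => /eqP;
  rewrite oppr_eq0 => /eqP.
by move=> /generic_morph_inj_normal ns0; rewrite ns0 subr0 in Ig.
Qed.

Lemma generic_morph_horner a b c p : (generic_morph p).[b%:P%:P].[a%:P].[c] =
  p.@[fun i => two_valued_cycle_sum a b c i.+1].
Proof.
move: p; set v := fun i : 'I_n => _.
pose g : {rmorphism _ -> _} :=
  horner_eval c \o (horner_eval a%:P \o (horner_eval b%:P%:P \o generic_morph)).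
apply: (@mpoly_morph_eq _ _ _ g (meval v)) => [x|].
  by rewrite /g /= cvar_morphC /horner_eval /= !hornerC mevalC.
apply: (ord_cvar (P := fun q => g q = q.@[v])) => k /andP[k0 kn].
rewrite (meval_cvar (h := two_valued_cycle_sum a b c)) // /g /= cvar_morphE //.
rewrite /generic_point !rmorph_two_valued /=; congr two_valued_cycle_sum;
  by rewrite /horner_eval ?(hornerC, hornerX).
Qed.

Lemma J_sub_ker p : J K n p -> generic_morph p = 0.
Proof.
move=> /JE Jp; apply: poly_vanish3 => c a b; rewrite generic_morph_horner.
exact: (Jp _ _ (realizes_two_valued (n := n) a b c)).
Qed.

Lemma hankel_ideal_vanish p A c : I p -> realizes A c ->
  (exists a b, forall k, (1 < k <= n)%N -> (cvar K n k).@[c] =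
     two_valued_cycle_sum a b (cvar K n 1).@[c] k) -> p.@[c] = 0.
Proof.
move=> Ip Ac [a [b H]]; apply: (ideal_gen_ker (f := meval c)) Ip.
apply: (morph_minors (a := a) (b := b) (c := (cvar K n 1).@[c])) => k kn.
case: k kn => [|[|k]] kn //; first exact: meval_cvar0.
exact: H.
Qed.

End GenericPoint.

(** * The ideals of general matrices *)

Section General.
Variable K : numFieldType.

Lemma J3 : J K 3 = [set 0].
Proof.
apply/seteqP; split=> [p Jp|p ->]; last by apply/JE => A c _; rewrite meval0.
have := generic_ker_ideal (isT : (2 <= 3)%N) (J_sub_ker Jp).
apply: ideal_gen_min => //=.
- by move=> q r -> ->; rewrite addr0.
- by move=> q r ->; rewrite mulr0.
(* For [n = 3] the matrix has two columns and hence no minors of size three. *)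
by move=> q /maximal_minors_hankel[j [k [l [jk kl /= l2 _]]]]; lia.
Qed.

Lemma J_ge5 n : (5 <= n)%N ->
  J K n = ideal_gen (maximal_minors (hankel_mx K n)) /\ prime_ideal (J K n).
Proof.
move=> n5; have n2 : (2 <= n)%N by lia.
apply: (ideal_eq_ker (f := generic_morph K n)).
- move=> p Ip; apply/JE => A c Ac.
  have [c2|c2] := eqVneq (cvar K n 2).@[c] 0; last first.
    have [//|H|[n4 _ _]] := cvar_classification _ Ac c2; first by lia.
      exact: hankel_ideal_vanish Ip Ac H.
    by rewrite n4 in n5.
  apply: (ideal_gen_ker (f := meval c)) Ip => q.
  move=> /maximal_minors_hankel[j [k [l [jk kl ln ->]]]].
  (* Here [c_n] is arbitrary, but [d_n] occurs only in the last row; below index [n] the [d_m] form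
     a geometric progression, so the first two rows are proportional. *)
  have dS m : (m.+1 < n)%N -> (dvar K n m.+1).@[c] = (cvar K n 1).@[c] * (dvar
    K n m).@[c].
    move=> mn; rewrite dvarS rmorph_sum big_ord_recl big1 => [|i _] /=;
      last first.
      rewrite !rmorphM /= (cvar_eq0_of_cvar2_eq0 Ac c2) ?mulr0 ?mul0r //.
      by rewrite /bump /=; have := ltn_ord i; lia.
    by rewrite addr0 bin0 subn0 !mul1r rmorphM.
  rewrite /hankel3 !(rmorphN, rmorphD, rmorphM) /= !(dS j, dS k, dS l); try lia.
  by ring.
- exact: J_sub_ker.
by move=> p; apply: generic_ker_ideal.
Qed.

Definition exceptional_poly (k : nat) : {poly {poly K}} :=
  nth 0 [:: 1; 'X%:P; 'X; 0; - 6 *: 'X ^+ 2] k.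

(** A square matrix has a single maximal minor; [c_1] disappears from it, in accordance with its
    invariance under centering. *)
Lemma hankel_minors4 : ideal_gen (maximal_minors (hankel_mx K 4)) =
  ideal_gen [set 2 * 'c_2 ^+ 3 + 'c_3 ^+ 2 - 'c_2 * 'c_4].
Proof.
have E : hankel3 (dvar K 4) 0 1 2 = - (2 * 'c_2 ^+ 3 + 'c_3 ^+ 2 - 'c_2 * 'c_4).
  pose c := cvar K 4; rewrite -!/(c _); pose d := dvar K 4; rewrite -/d.
  have d0 : d 0 = 1 by exact: dvar0.
  have d1 : d 1 = c 1 by exact: dvar1.
  have d2 : d 2 = c 1 ^+ 2 - c 2.
    by rewrite /d dvarS !bconvS !bconv0 /shift -/d -!/(c _) d0 d1; ring.
  have d3 : d 3 = c 1 ^+ 3 - 3 * c 1 * c 2 + c 3.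
    by rewrite /d dvarS !bconvS !bconv0 /shift -/d -!/(c _) d0 d1 d2; ring.
  have d4 : d 4 = c 1 ^+ 4 - 6 * c 1 ^+ 2 * c 2 + 4 * c 1 * c 3 + 3 * c 2 ^+ 2
    - c 4.
    by rewrite /d dvarS !bconvS !bconv0 /shift -/d -!/(c _) d0 d1 d2 d3; ring.
  by rewrite /hankel3 d0 d1 d2 d3 d4; ring.
have M : maximal_minors (hankel_mx K 4) = [set hankel3 (dvar K 4) 0 1 2].
  apply/seteqP; split=> [p /maximal_minors_hankel[j [k [l [jk kl /= l3 ->]]]]|p
    ->].
    have [-> -> ->] : [/\ j = 0%N, k = 1%N & l = 2%N] by split; lia.
    by [].
  by apply/maximal_minors_hankel; exists 0%N, 1%N, 2%N.
rewrite M E; apply/seteqP; split; apply: ideal_genS => p ->.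
  by apply/ideal_genN/ideal_gen_sub.
by rewrite -[X in ideal_gen _ X]opprK; apply/ideal_genN/ideal_gen_sub.
Qed.

Lemma J4 : decomposes_into_primes (J K 4)
  (ideal_gen [set 2 * 'c_2 ^+ 3 + 'c_3 ^+ 2 - 'c_2 * 'c_4])
  (ideal_gen [set 'c_3; 6 * 'c_2 ^+ 2 + 'c_4]).
Proof.
set I1 := ideal_gen _; set I2 := ideal_gen _.
pose f2 := cvar_morph 4 (@polyC _ \o @polyC K) exceptional_poly.
have E1 p : I1 p <-> generic_morph K 4 p = 0.
  rewrite /I1 -hankel_minors4; split; last exact: generic_ker_ideal.
  apply: ideal_gen_ker; exact: (morph_minors (@generic_morph_cvar K 4)).
have E2 p : I2 p <-> f2 p = 0.
  split=> [I2p|].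
    apply: (ideal_gen_ker _ I2p) => q [->|->]; first by rewrite /= cvar_morphE.
    rewrite rmorphD rmorphM rmorphXn rmorph_nat /= !cvar_morphE //.
    by rewrite /exceptional_poly /= -mul_polyC rmorphN rmorph_nat; ring.
  apply: (@mpoly_retract_ideal _ _ _ _ f2 (subst_poly2 (cvar K 4 1) (cvar K 4
    2))) => [a|].
    by rewrite /f2 /= cvar_morphC /= subst_poly2C subst_polyC.
  apply: (ord_cvar (P := fun q => ideal_gen _ (q - subst_poly2 _ _ (f2 q)))) =>
    k kn.
  have /andP[_ kn'] := kn; rewrite /f2 cvar_morphE //.
  case: k kn kn' => [|[|[|[|[|]]]]] //= _ _;
    rewrite /exceptional_poly /= ?rmorph0 ?subr0.
  - by rewrite subst_poly2C subst_polyX subrr; apply: ideal_gen0.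
  - by rewrite subst_poly2X subrr; apply: ideal_gen0.
  - by apply: ideal_gen_sub; left.
  - apply: ideal_gen_sub; right; rewrite -mul_polyC rmorphM rmorphXn /=
    subst_poly2X subst_poly2C.
    by rewrite !rmorphN !rmorph_nat; ring.
have f2_horner p c : (forall k, (k <= 4)%N -> (cvar K 4 k).@[c] =
     (exceptional_poly k).[((cvar K 4 2).@[c])%:P].[(cvar K 4 1).@[c]]) ->
    (f2 p).[((cvar K 4 2).@[c])%:P].[(cvar K 4 1).@[c]] = p.@[c].
  set c1 := (cvar K 4 1).@[c]; set c2 := (cvar K 4 2).@[c] => H; move: p.
  pose g : {rmorphism _ -> _} := horner_eval c1 \o (horner_eval c2%:P \o f2).
  apply: (@mpoly_morph_eq _ _ _ g (meval c)) => [x|].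
    by rewrite /g /= cvar_morphC /horner_eval /= !hornerC mevalC.
  apply: (ord_cvar (P := fun q => g q = q.@[c])) => k /andP[k0 kn].
  by rewrite /g /= /f2 cvar_morphE // /horner_eval H.
apply: (decompose_kernels (f1 := generic_morph K 4) (f2 := f2)) => // [p||].
- split=> [Jp|[I1p I2p]].
    split; first by apply/E1/J_sub_ker.
    apply/E2; apply: (poly_vanish (h := fun k => (- (k%:R ^+ 2))%:P)).
      by move=> i j /polyC_inj/neg_sqr_inj.
    move=> k; apply: poly_vanish1 => x.
    pose c (i : 'I_4) := exceptional_cycle_sum (k%:R : K) x i.+1.
    have ck m : (m <= 4)%N -> (cvar K 4 m).@[c] = exceptional_cycle_sum k%:R x
      m.
      exact: (meval_cvar (h := exceptional_cycle_sum k%:R x)).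
    have := f2_horner p c; rewrite (ck 2) // (ck 1) // => -> .
      move/JE: Jp; apply; exact: realizes_exceptional.
    move=> m m4; rewrite ck //.
    case: m m4 => [|[|[|[|[|]]]]] //= _;
      rewrite /exceptional_poly /exceptional_cycle_sum /= ?hornerC ?hornerX //.
      by rewrite hornerC.
    have -> : - 6 = (- 6)%:P :> {poly K} by rewrite rmorphN rmorph_nat.
    by rewrite hornerZ hornerXn -polyC_exp hornerM !hornerC; ring.
  apply/JE => A c Ac.
  (* With [c_2 = 0] also [c_3 = 0], while [c_4] is arbitrary; such a point lies on the first
     component. *)
  have [c2|c2] := eqVneq (cvar K 4 2).@[c] 0.
    apply: (ideal_gen_ker (f := meval c)) I1p => q ->.
    rewrite rmorphB rmorphD !rmorphM /= c2.
    by rewrite (cvar_eq0_of_cvar2_eq0 Ac c2 (k := 3)) //; ring.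
  have [//|H|[_ c3 c4]] := cvar_classification _ Ac c2.
    apply: hankel_ideal_vanish _ Ac H; by rewrite hankel_minors4.
  apply: (ideal_gen_ker (f := meval c)) I2p => q [->|->];
    first by rewrite /= c3.
  rewrite rmorphD rmorphM rmorphXn rmorph_nat /= c4; ring.
- exists (2 * 'c_2 ^+ 3 + 'c_3 ^+ 2 - 'c_2 * 'c_4); first exact: ideal_gen_sub.
  rewrite rmorphB rmorphD !rmorphM rmorph_nat /= /f2 !cvar_morphE //.
  have -> : 2 * exceptional_poly 2 ^+ 3 + exceptional_poly 3 ^+ 2
      - exceptional_poly 2 * exceptional_poly 4 = (8 : {poly K}) *: 'X ^+ 3.
    by rewrite /exceptional_poly /= -!mul_polyC !rmorphN !rmorph_nat; ring.
  rewrite -mul_polyC mulf_eq0 polyC_eq0 -(rmorph_nat (@polyC K)) polyC_eq0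
    pnatr_eq0.
  by rewrite expf_eq0 polyX_eq0.
exists 'c_3; first by apply: ideal_gen_sub; left.
apply/eqP => E; have := generic_morph_horner (1 : K) 1 1 (cvar K 4 3).
rewrite E !horner0 (meval_cvar (h := two_valued_cycle_sum 1 1 1)) //.
by rewrite two_valued_cycle_sum_sym /= !expr1n mulr1 => /esym/eqP;
  rewrite pnatr_eq0.
Qed.

End General.

Theorem theorem1p2 (R : realType) :
  (* (1) *)
  [/\ Jsym R[i] 3 =
        ideal_gen [set - 4 * 'c_2 ^+ 3 + 'c_3 ^+ 2]
    & forall n : nat, (4 <= n)%N ->
        Jsym R[i] n =
          ideal_gen
            ([set 4 * 'c_2 ^+ 3 - 'c_3 ^+ 2] `|`
             [set p | exists2 s : nat, (4 <= s <= n)%N &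
                p = ((s - 1)`!)%:R * ('c_2 * 'c_(s - 2))
                    - ((s - 3)`!)%:R * 'c_s])
        /\ prime_ideal (Jsym R[i] n)]
  /\
  (* (2) *)
  [/\ Jskew R[i] 3 = ideal_gen [set 'c_1; 'c_3],
      decomposes_into_primes (Jskew R[i] 4)
         (ideal_gen [set - 2 * 'c_2 ^+ 2 + 'c_4; 'c_1; 'c_3])
         (ideal_gen [set 6 * 'c_2 ^+ 2 + 'c_4; 'c_1; 'c_3])
    & forall n : nat, (5 <= n)%N ->
        let E := fun m => (euler_number m)%:R : {mpoly R[i][n]} in
        Jskew R[i] n =
          ideal_gen
            ([set p | exists2 k : nat, (1 <= k <= uphalf n)%N &
                p = 'c_(2 * k - 1)] `|`
             [set p | exists i j : nat,
                [/\ (1 <= i)%N, (i <= j)%N, (2 * (i + j) <= n)%N &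
                 p = E (2 * (i + j) - 1)%N * ('c_(2 * i) * 'c_(2 * j))
                     - E (2 * i - 1)%N * E (2 * j - 1)%N
                       * 'c_(2 * (i + j))]])
        /\ prime_ideal (Jskew R[i] n)]
  /\
  (* (3) *)
  [/\ J R[i] 3 = [set 0],
      decomposes_into_primes (J R[i] 4)
         (ideal_gen [set 2 * 'c_2 ^+ 3 + 'c_3 ^+ 2 - 'c_2 * 'c_4])
         (ideal_gen [set 'c_3; 6 * 'c_2 ^+ 2 + 'c_4])
    & forall n : nat, (5 <= n)%N ->
        J R[i] n = ideal_gen (maximal_minors (hankel_mx R[i] n))
        /\ prime_ideal (J R[i] n)].
Proof.
split; last split.
- by split; [exact: Jsym3 | exact: Jsym_ge4].
- by split; [exact: Jskew3 | exact: Jskew4 | exact: Jskew_ge5].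
by split; [exact: J3 | exact: J4 | exact: J_ge5].
Qed.
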